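(* Let $d\ge 2$ be an integer and let $x_1,\dots,x_{2d-2}$ be $2d-2$ distinct real points. Then there exist at least $u_d=\frac1d\binom{2d-2}{d-1}$ pairwise non-equivalent real rational functions of degree $d$ whose set of critical points is $\{x_1,\dots,x_{2d-2}\}$.
   Context: Two rational functions $f_1,f_2$ are called equivalent if $f_1=\ell\circ f_2$ for some fractional-linear transformation $\ell$ (with complex coefficients). A rational function is real if it can be written with real coefficients. Rational functions are regarded as holomorphic maps of the Riemann sphere. The number $u_d=\frac1d\binom{2d-2}{d-1}$ is called the $d$-th Catalan number. *)

(* Defs.v *)
From mathcomp Require Import all_boot all_order all_algebra.
From mathcomp Require Import complex.
From mathcomp Require Import all_classical all_reals all_analysis.

Set Implicit Arguments.
Unset Strict Implicit.
Unset Printing Implicit Defensive.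

Import Order.TTheory GRing.Theory Num.Theory.
Import numFieldNormedType.Exports.

Local Open Scope classical_set_scope.
Local Open Scope complex_scope.
Local Open Scope ring_scope.

(* [Some z] is the finite point z and [None] is the point at infinity. *)
Notation sphere R := (one_point_compactification R[i]).

Section RationalMaps.
Variable R : realType.
Local Notation C := R[i].

(* The holomorphic self-map of the sphere defined by the fraction p / q; it has
   this meaning only when p and q are coprime.  For d the maximum of the degrees
   of p and q, the value at infinity is the quotient of the coefficients of 'X^d
   in p and q. *)
Definition ratmap (p q : {poly C}) (s : sphere R) : sphere R :=
  match s with
  | Some z => if q.[z] == 0 then None else Some (p.[z] / q.[z])
  | None => let d := (maxn (size p) (size q)).-1 in
            if q`_d == 0 then None else Some (p`_d / q`_d)
  end.

(* As [size p] is 1 + deg p for p != 0, the last equation says that the larger of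
   the degrees of p and q is d. *)
Definition rational_of_degree (d : nat) (f : sphere R -> sphere R) : Prop :=
  exists p q : {poly C},
    [/\ coprimep p q, f = ratmap p q & maxn (size p) (size q) = d.+1].

Definition real_rational (f : sphere R -> sphere R) : Prop :=
  exists p q : {poly R}, coprimep p q /\
    f = ratmap (map_poly (real_complex R) p) (map_poly (real_complex R) q).

(* z |-> (a z + b) / (c z + d), extended to the sphere *)
Definition fractional_linear (l : sphere R -> sphere R) : Prop :=
  exists a b c d : C,
    a * d - b * c != 0 /\ l = ratmap (a *: 'X + b%:P) (c *: 'X + d%:P).

Definition equivalent (f1 f2 : sphere R -> sphere R) : Prop :=
  exists l, fractional_linear l /\ f1 = l \o f2.

(* Local parametrization of the sphere sending 0 to s: t |-> z + t at a finite
   point z, and t |-> 1 / t at infinity. *)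
Definition param (s : sphere R) (t : C^o) : sphere R :=
  match s with
  | Some z => Some (z + t)
  | None => if t == 0 then None else Some t^-1
  end.

(* Local coordinate of the sphere around s: z |-> z if s is finite, z |-> 1 / z if
   s is infinity.  The values at infinity in the first case and at 0 in the
   second are irrelevant, as those points lie outside the chart. *)
Definition chart (s u : sphere R) : C^o :=
  match s, u with
  | Some _, Some z => z
  | Some _, None => 0
  | None, Some z => z^-1
  | None, None => 0
  end.

(* The complex derivative of f, read in local coordinates at s and f s, is 0. *)
Definition critical_point (f : sphere R -> sphere R) (s : sphere R) : Prop :=
  is_derive (0 : C^o) (1 : C^o) (chart (f s) \o f \o param s) (0 : C^o).

Definition critical_points (f : sphere R -> sphere R) : set (sphere R) :=
  [set s | critical_point f s].

End RationalMaps.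

Definition catalan (d : nat) : nat := ('C(2 * d - 2, d - 1) %/ d)%N.

(* The division in [catalan] is exact. *)
Lemma mul_catalan (d : nat) : (0 < d)%N ->
  (d * catalan d)%N = 'C(2 * d - 2, d - 1).
Proof.
case: d => // k _; rewrite /catalan mulnS addKn subn1 /= mulnC divnK //.
have H := mul_bin_left (2 * k) k.
have E : (2 * k - k = k)%N by rewrite mul2n -addnn addnK.
rewrite E in H.
rewrite -(@Gauss_dvdr _ k) ?coprimeSn // -H; exact: dvdn_mulr.
Qed.

(* Main.v *)
Require Import Defs.
From mathcomp Require Import all_boot all_order all_fingroup all_algebra.
From mathcomp Require Import complex ring lra zify.
From mathcomp Require boolp.

Set Implicit Arguments.
Unset Strict Implicit.
Unset Printing Implicit Defensive.

Import Order.TTheory GRing.Theory Num.Theory.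

Local Open Scope ring_scope.

(** Put d = m + 1 and n = 2 m.  Up to equivalence, a rational function p / q of
    degree d with critical points x_1, ..., x_n is a plane V spanned by p and q,
    whose Wronskian is a multiple of w = \prod_i (X - x_i).  Such a plane is the
    space of solutions of an equation w u'' - w' u' + tau u = 0, and tau
    determines it.  So it suffices to produce catalan d distinct real polynomials
    tau for which this equation has two independent polynomial solutions.  They
    are the joint spectrum of a quantum integrable system, the Gaudin model.

    Let P_ij exchange the i-th and the j-th factor of the n-fold tensor power of
    a plane.  The operators H_i = \sum_(j != i) (1 - P_ij) / (x_i - x_j) are
    symmetric, they commute (gaudin_comm), and they preserve the space of
    singular vectors of weight m, whose dimension is at least
    C(n, m) - C(n, m - 1) = catalan d (rank_singular_mx).  Hence this space has
    an orthonormal basis of joint eigenvectors (sym_codiag).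

    A joint eigenvector psi with eigenvalues h_i gives
    tau = \sum_i h_i \prod_(k != i) (X - x_k), and the equation is solved
    explicitly: if Sym_X is the sum of the permutations of the factors in X, then
      \sum_X (t - t0)^(|X| + 1) / (|X| + 1)! \prod_(i notin X) (t0 - x_i) Sym_X
    maps psi to u(t) psi, where u is a solution that vanishes at t0
    (symmetrizer_identity, solution_poly_ode, eigen_solution).  This only uses
    that antisymmetrizing three factors of dimension two gives 0.  Two base
    points t0 and t1 yield two independent solutions, and reality is automatic.

    It remains to see that different eigenvectors have different eigenvalues, for
    all distinct real x_i (gaudin_simple).  Along the path x_i + s^(i + 1) the
    operators, rescaled, degenerate for large s to the Jucys-Murphy elements,
    whose joint spectrum is simple (jucys_murphy_simple).  So the spectrum is
    simple except for finitely many s, in particular for some arbitrarily small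
    s > 0 (simple_path).  Suppose now that two orthogonal eigenvectors at x share
    their eigenvalues, hence the plane V.  The eigenvalues of symmetric operators
    move at bounded speed (near_eigen), so moving x in any direction makes V
    follow at bounded speed (tracking): the differential of the Wronski map at V
    is onto.  Source and target have the same dimension, so it is also one to
    one, and planes close to V are determined by their Wronskians
    (bil_isolated).  But at a nearby point of simple spectrum the two
    eigenvectors lead to two different planes close to V with the same
    Wronskian, a contradiction. *)

(** * Commuting real symmetric matrices *)

Definition dot (R : pzRingType) N (u v : 'rV[R]_N) : R := (u *m v^T) 0 0.

Section Dot.
Variables (R : realFieldType) (N : nat).
Implicit Types u v w : 'rV[R]_N.

Lemma dotE u v : dot u v = \sum_i u 0 i * v 0 i.
Proof. by rewrite /dot mxE; apply: eq_bigr => i _; rewrite mxE. Qed.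

Lemma dotC u v : dot u v = dot v u.
Proof. by rewrite !dotE; apply: eq_bigr => i _; rewrite mulrC. Qed.

Lemma dotDl u v w : dot (u + v) w = dot u w + dot v w.
Proof. by rewrite /dot mulmxDl mxE. Qed.

Lemma dotZl a u v : dot (a *: u) v = a * dot u v.
Proof. by rewrite /dot -scalemxAl mxE. Qed.

Lemma dotDr u v w : dot u (v + w) = dot u v + dot u w.
Proof. by rewrite dotC dotDl !(dotC _ u). Qed.

Lemma dotZr a u v : dot u (a *: v) = a * dot u v.
Proof. by rewrite dotC dotZl dotC. Qed.

Lemma dot_ge0 u : 0 <= dot u u.
Proof. by rewrite dotE sumr_ge0 // => i _; rewrite -expr2 sqr_ge0. Qed.

Lemma dot_eq0 u : (dot u u == 0) = (u == 0).
Proof.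
apply/idP/eqP => [|->]; last by rewrite /dot mul0mx mxE.
rewrite dotE psumr_eq0 => [/allP H|i _]; last by rewrite -expr2 sqr_ge0.
apply/rowP => i; rewrite mxE; apply/eqP; move: (H i (mem_index_enum _)).
by rewrite mulf_eq0 orbb.
Qed.

Lemma dot_sym (A : 'M[R]_N) u v : A^T = A -> dot (u *m A) v = dot u (v *m A).
Proof. by move=> sA; rewrite /dot trmx_mul sA mulmxA. Qed.

Lemma dot_row m p (A : 'M[R]_(m, N)) (B : 'M[R]_(p, N)) i j :
  (A *m B^T) i j = dot (row i A) (row j B).
Proof. by rewrite mxE dotE; apply: eq_bigr => k _; rewrite !mxE. Qed.

End Dot.

Section Spectral.
Variable R : rcfType.
Local Notation C := R[i].
Local Notation toC := (real_complex R).

Lemma Re_mulr (z : C) (r : R) : complex.Re (z * r%:C)%C = complex.Re z * r.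
Proof. by case: z => a b /=; rewrite mulr0 subr0. Qed.
Lemma Im_mulr (z : C) (r : R) : complex.Im (z * r%:C)%C = complex.Im z * r.
Proof. by case: z => a b /=; rewrite mulr0 add0r. Qed.
Lemma Re_sum (I : Type) (r : seq I) (P : pred I) (F : I -> C) :
  complex.Re (\sum_(i <- r | P i) F i) = \sum_(i <- r | P i) complex.Re (F i).
Proof. by apply: (big_morph (@complex.Re R)) => // -[a b] [c d]. Qed.
Lemma Im_sum (I : Type) (r : seq I) (P : pred I) (F : I -> C) :
  complex.Im (\sum_(i <- r | P i) F i) = \sum_(i <- r | P i) complex.Im (F i).
Proof. by apply: (big_morph (@complex.Im R)) => // -[a b] [c d]. Qed.

Lemma Re_mulmx m n p (A : 'M[C]_(m, n)) (B : 'M[R]_(n, p)) :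
  map_mx (@complex.Re R) (A *m map_mx toC B) = map_mx (@complex.Re R) A *m B.
Proof.
by apply/matrixP => i j; rewrite !mxE Re_sum; apply: eq_bigr => k _; rewrite !mxE Re_mulr.
Qed.
Lemma Im_mulmx m n p (A : 'M[C]_(m, n)) (B : 'M[R]_(n, p)) :
  map_mx (@complex.Im R) (A *m map_mx toC B) = map_mx (@complex.Im R) A *m B.
Proof.
by apply/matrixP => i j; rewrite !mxE Im_sum; apply: eq_bigr => k _; rewrite !mxE Im_mulr.
Qed.

(** Comparing the products of a A with b and of a with b A, for z = a + i b, gives
    Im mu * (|a|^2 + |b|^2) = 0. *)
Lemma sym_real_eigen N (A : 'M[R]_N) (z : 'rV[C]_N) (mu : C) :
  A^T = A -> z != 0 -> z *m map_mx toC A = mu *: z ->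
  let a := map_mx (@complex.Re R) z in let b := map_mx (@complex.Im R) z in
  a *m A = complex.Re mu *: a /\ b *m A = complex.Re mu *: b.
Proof.
move=> sA z0 E a b; set p := complex.Re mu; set q := complex.Im mu.
have Ea : a *m A = p *: a - q *: b.
  by rewrite -Re_mulmx E; apply/rowP => j; rewrite !mxE /p /q; case: (mu) (z 0 j) => ? ? [].
have Eb : b *m A = q *: a + p *: b.
  rewrite -Im_mulmx E; apply/rowP => j; rewrite !mxE /p /q; case: (mu) (z 0 j) => ? ? [] ? ? /=.
  by rewrite addrC.
have q0 : q * (dot a a + dot b b) = 0.
  have := dot_sym a b sA; rewrite Ea Eb -scaleNr !dotDl !dotZl dotDr !dotZr => h.
  by lra.
have {q0} q0 : q = 0.
  move/eqP: q0; rewrite mulf_eq0 => /orP[/eqP //|].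
  rewrite paddr_eq0 ?dot_ge0 // !dot_eq0 => /andP[/eqP a0 /eqP b0].
  case/negP: z0; apply/eqP/rowP => j; rewrite mxE.
  have := congr1 (fun v : 'rV_N => v 0 j) a0; have := congr1 (fun v : 'rV_N => v 0 j) b0.
  by rewrite !mxE; case: (z 0 j) => ? ? /= -> ->.
by rewrite Ea Eb q0 !scale0r subr0 add0r.
Qed.

(** A common eigenvector exists over the complex numbers, and its real or its
    imaginary part is a nonzero real one. *)
Lemma sym_common_eigenvector (I : finType) N (A : I -> 'M[R]_N) (M : 'M[R]_N) :
  (forall i, (A i)^T = A i) -> (forall i j, A i *m A j = A j *m A i) ->
  (forall i, stablemx M (A i)) -> M != 0 ->
  exists2 v : 'rV[R]_N, v != 0 & (v <= M)%MS /\ forall i, exists h, v *m A i = h *: v.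
Proof.
move=> sA cA stA M0; pose B := row_base M.
have rB : map_mx toC B \in [pred X | row_free X] by rewrite inE row_free_map row_base_free.
pose As := [seq map_mx toC (restrictmx M (A i)) | i : I].
have [||v v0 /allP vA] := @common_eigenvector C (\rank M) As.
- by rewrite lt0n mxrank_eq0.
- move=> _ _ /mapP[i _ ->] /mapP[j _ ->]; rewrite /comm_mx -!map_mxM.
  by rewrite -!conjmxM ?inE ?stablemx_row_base //; congr (map_mx _ (conjmx _ _)); apply: cA.
pose z := v *m map_mx toC B.
have z0 : z != 0 by rewrite mulmx_free_eq0.
have zA i : exists mu, z *m map_mx toC (A i) = mu *: z.
  have /sub_rVP [mu E] : stablemx v (map_mx toC (restrictmx M (A i))).
    by apply: vA; apply/mapP; exists i; rewrite ?mem_enum.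
  exists mu; rewrite /z scalemxAl -E -!mulmxA -!map_mxM; congr (_ *m map_mx _ _).
  by rewrite /conjmx mulmxKpV // stablemx_row_base.
have aM : (map_mx (@complex.Re R) z <= M)%MS.
  by rewrite Re_mulmx (submx_trans (submxMl _ _)) // eq_row_base.
have bM : (map_mx (@complex.Im R) z <= M)%MS.
  by rewrite Im_mulmx (submx_trans (submxMl _ _)) // eq_row_base.
case: (eqVneq (map_mx (@complex.Re R) z) 0) => [a0|a0]; last first.
  exists (map_mx (@complex.Re R) z) => //; split => // i.
  have [mu E] := zA i; exists (complex.Re mu).
  by have [] := sym_real_eigen (sA i) z0 E.
exists (map_mx (@complex.Im R) z).
  apply: contraNneq z0 => b0; apply/eqP/rowP => j; rewrite mxE.
  have := congr1 (fun v : 'rV_N => v 0 j) a0; have := congr1 (fun v : 'rV_N => v 0 j) b0.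
  by rewrite !mxE; case: (\sum_(_ < _) _) => ? ? /= -> ->.
split => // i; have [mu E] := zA i; exists (complex.Re mu).
by have [] := sym_real_eigen (sA i) z0 E.
Qed.

(** Induction on the rank: the orthogonal complement of a common eigenvector in M
    is again stable. *)
Lemma sym_codiag (I : finType) N (A : I -> 'M[R]_N) (M : 'M[R]_N) :
  (forall i, (A i)^T = A i) -> (forall i j, A i *m A j = A j *m A i) ->
  (forall i, stablemx M (A i)) ->
  exists u (OB : 'M[R]_(u, N)), [/\ OB *m OB^T = 1%:M, (OB :=: M)%MS &
    forall i k, exists h, row k OB *m A i = h *: row k OB].
Proof.
move=> sA cA; have [k] := ubnP (\rank M); elim: k M => // k IH M Mk stM.
have [->|M0] := eqVneq M 0.
  exists 0%N, 0; split; first by apply/matrixP => -[].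
    by apply/eqmxP; rewrite !sub0mx.
  by move=> ? [].
have [w w0 [wM wA]] := sym_common_eigenvector sA cA stM M0.
have dw : 0 < dot w w by rewrite lt_def dot_eq0 w0 dot_ge0.
pose v := (Num.sqrt (dot w w))^-1 *: w.
have vv : v *m v^T = 1%:M.
  rewrite [LHS]mx11_scalar; congr (_%:M); rewrite -/(dot v v) dotZl dotZr mulrA -expr2 exprVn.
  by rewrite sqr_sqrtr ?dot_ge0 // mulVf // gt_eqF.
have vM : (v <= M)%MS by rewrite scalemx_sub.
have vA i : exists h, v *m A i = h *: v.
  by have [h E] := wA i; exists h; rewrite -scalemxAl E !scalerA mulrC.
pose M' := (M :&: kermx v^T)%MS.
have M'v : M' *m v^T = 0 by apply/sub_kermxP; rewrite capmxSr.
have stM' i : stablemx M' (A i).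
  rewrite sub_capmx (submx_trans (submxMr _ (capmxSl _ _)) (stM i)) /=.
  apply/sub_kermxP; have [h E] := vA i.
  by rewrite -mulmxA -{1}(sA i) -trmx_mul E linearZ -scalemxAr M'v scaler0.
have ltM' : (\rank M' < \rank M)%N.
  apply: rank_ltmx; rewrite /ltmx capmxSl /=; apply/negP => /(submx_trans vM).
  rewrite sub_capmx => /andP[_ /sub_kermxP]; rewrite vv => /matrixP/(_ 0 0).
  by rewrite !mxE /= => /eqP; rewrite oner_eq0.
have [u [OB [OO OM OA]]] := IH M' (leq_trans ltM' Mk) stM'.
have Ov : OB *m v^T = 0.
  by apply/sub_kermxP; rewrite OM capmxSr.
exists (1 + u)%N, (col_mx v OB); split.
- rewrite tr_col_mx mul_col_row. rewrite vv OO Ov -[v *m OB^T]trmxK trmx_mul trmxK Ov trmx0.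
  by rewrite scalar_mx_block.
- apply/eqmxP/andP; split; first by rewrite col_mx_sub vM OM capmxSl.
  rewrite -[M in (M <= _)%MS](subrK (M *m v^T *m v)) addmx_sub //.
    rewrite (submx_trans _ (_ : OB <= _)%MS) //.
      rewrite OM sub_capmx addmx_sub //= ?eqmx_opp ?(submx_trans (submxMl _ _) vM) //.
      by apply/sub_kermxP; rewrite mulmxBl -[_ *m v *m v^T]mulmxA vv mulmx1 subrr.
    by rewrite -addsmxE addsmxSr.
  by rewrite (submx_trans (submxMl _ _)) // -addsmxE addsmxSl.
- move=> i j; case: (split_ordP j) => j' ->.
    rewrite rowKu; have [h E] := vA i; exists h.
    by rewrite (_ : row j' v = v) //; apply/rowP => ?; rewrite mxE ord1.
  by rewrite rowKd; apply: OA.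
Qed.

End Spectral.

(** * Permutations of tensor factors *)

Section Perm.
Variables (R : realFieldType) (n : nat).
Local Notation T := {set 'I_n}.
Local Notation N := #|{set 'I_n}|.
Implicit Types (s t : {perm 'I_n}) (X : T) (v : 'rV[R]_N).

Definition setcoord v (S : T) : R := v 0 (enum_rank S).

(** A row vector indexed by the subsets of 'I_n is a tensor in the n-th tensor
    power of a plane with basis e0, e1: the subset S stands for the product of the
    basis vectors that has e1 exactly at the places in S. *)
Definition set_perm_mx s : 'M[R]_N := \matrix_(a, b) ((enum_val b : T) == s @: (enum_val a : T))%:R.
Definition swap_mx (i j : 'I_n) := set_perm_mx (tperm i j).

Lemma setcoord_inj v w : (forall S, setcoord v S = setcoord w S) -> v = w.
Proof. by move=> E; apply/rowP => a; have := E (enum_val a); rewrite /setcoord enum_valK. Qed.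

Lemma imset_permK s : cancel (fun S : T => s @: S) (fun S : T => (s^-1)%g @: S).
Proof. by move=> S; rewrite -imset_comp -[RHS]imset_id; apply: eq_imset => x /=; rewrite permK. Qed.

Lemma imset_permKV s : cancel (fun S : T => (s^-1)%g @: S) (fun S : T => s @: S).
Proof. by move=> S; rewrite -{1}(invgK s) imset_permK. Qed.

Lemma setcoord_set_perm v s S : setcoord (v *m set_perm_mx s) S = setcoord v ((s^-1)%g @: S).
Proof.
rewrite /setcoord mxE (bigD1 (enum_rank ((s^-1)%g @: S))) //= big1 ?addr0 => [|a ne].
  by rewrite mxE !enum_rankK imset_permKV eqxx mulr1.
rewrite mxE enum_rankK; case: eqP => [E|_]; last by rewrite mulr0.
by case/eqP: ne; rewrite E imset_permK enum_valK.
Qed.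

Lemma setcoord_swap v i j S : setcoord (v *m swap_mx i j) S = setcoord v (tperm i j @: S).
Proof. by rewrite setcoord_set_perm tpermV. Qed.

Lemma setcoord_mx_inj (A B : 'M[R]_N) :
  (forall v S, setcoord (v *m A) S = setcoord (v *m B) S) -> A = B.
Proof.
move=> E; apply/row_matrixP => a; rewrite !rowE.
by apply: setcoord_inj => S; apply: E.
Qed.

Lemma set_perm_mx1 : set_perm_mx 1%g = 1%:M.
Proof.
apply: setcoord_mx_inj => v S; rewrite setcoord_set_perm mulmx1 invg1; congr setcoord.
by rewrite -[RHS]imset_id; apply: eq_imset => x; rewrite perm1.
Qed.

Lemma set_perm_mxM s t : set_perm_mx (s * t)%g = set_perm_mx s *m set_perm_mx t.
Proof.
apply: setcoord_mx_inj => v S; rewrite mulmxA !setcoord_set_perm invMg; congr setcoord.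
by rewrite -imset_comp; apply: eq_imset => x /=; rewrite permM.
Qed.

Lemma tr_set_perm_mx s : (set_perm_mx s)^T = set_perm_mx (s^-1)%g.
Proof.
apply/matrixP => a b; rewrite !mxE; congr (_%:R); congr nat_of_bool.
apply/eqP/eqP => ->; first by rewrite imset_permK.
by rewrite imset_permKV.
Qed.

Lemma tr_swap_mx i j : (swap_mx i j)^T = swap_mx i j.
Proof. by rewrite tr_set_perm_mx tpermV. Qed.

Lemma swap_mxC i j : swap_mx i j = swap_mx j i.
Proof. by rewrite /swap_mx tpermC. Qed.

Lemma swap_mx_id i j : i = j -> swap_mx i j = 1%:M.
Proof. by move=> ->; rewrite /swap_mx tperm1 set_perm_mx1. Qed.

Lemma swap_mxK i j : swap_mx i j *m swap_mx i j = 1%:M.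
Proof. by rewrite -set_perm_mxM tperm2 set_perm_mx1. Qed.

Lemma tperm_imset_id i j (S : T) : (i \in S) = (j \in S) -> tperm i j @: S = S.
Proof.
move=> e; apply/setP => x; rewrite -{1}[x](tpermK i j) mem_imset; last exact: perm_inj.
by case: tpermP => [->|->|//].
Qed.

Lemma tperm_conj (i j k : 'I_n) : i != j -> i != k ->
  tperm i k = (tperm j k * tperm i j * tperm j k)%g.
Proof.
move=> ij ik; rewrite -{1}(tpermV j k) -mulgA -conjgE tpermJ tpermL.
by rewrite tpermD // eq_sym.
Qed.

Lemma imsetM s t (S : T) : (s * t)%g @: S = t @: (s @: S).
Proof. by rewrite -imset_comp; apply: eq_imset => x /=; rewrite permM. Qed.

(** The tensor factors have dimension two: among three places, two are both inside
    or both outside any given subset, so the antisymmetrizer of i, j, k, which is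
    the product below, kills every basis vector. *)
Lemma antisym3 i j k : i != j -> i != k -> j != k ->
  (1%:M - swap_mx j k) *m (1%:M - swap_mx i j - swap_mx i k) = 0.
Proof.
move=> ij ik jk; apply: setcoord_mx_inj => v S; rewrite mulmx0 mulmxA.
set w := v *m (1%:M - swap_mx j k).
have wE U : setcoord w U = setcoord v U - setcoord v (tperm j k @: U).
  by rewrite -setcoord_swap /setcoord /w mulmxBr mulmx1 !mxE.
have -> : setcoord (w *m (1%:M - swap_mx i j - swap_mx i k)) S
        = setcoord w S - setcoord w (tperm i j @: S) - setcoord w (tperm i k @: S).
  by rewrite -!setcoord_swap /setcoord !mulmxBr mulmx1 !mxE.
have -> : setcoord (0 : 'rV[R]_N) S = 0 by rewrite /setcoord mxE.
have w0 (U : T) : (j \in U) = (k \in U) -> setcoord w U = 0.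
  by move=> e; rewrite wE tperm_imset_id // subrr.
have mem_tp a b c (U : T) : (c \in tperm a b @: U) = (tperm a b c \in U).
  by rewrite -{1}[c](tpermK a b) mem_imset //; exact: perm_inj.
case: (eqVneq (j \in S) (k \in S)) => [jkS|].
  rewrite (w0 _ jkS) (tperm_conj ij ik) !imsetM (tperm_imset_id jkS) !wE.
  have K (U : T) : tperm j k @: (tperm j k @: U) = U.
    by rewrite -imsetM tperm2; rewrite -[RHS]imset_id; apply: eq_imset => x; rewrite perm1.
  by rewrite K; ring.
case: (eqVneq (i \in S) (j \in S)) => [ijS jkS|ijS jkS].
  rewrite (tperm_imset_id ijS) subrr sub0r w0 ?oppr0 //.
  by rewrite !mem_tp tpermR tpermD // eq_sym.
have ikS : (i \in S) = (k \in S) by move: ijS jkS; do 3!case: (_ \in S).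
rewrite (tperm_imset_id ikS) addrAC subrr sub0r w0 ?oppr0 //.
by rewrite !mem_tp tpermR tpermD // ikS.
Qed.

End Perm.

(** * Symmetrizers *)

Section Sym.
Variables (R : realFieldType) (n : nat).
Local Notation T := {set 'I_n}.
Local Notation N := #|{set 'I_n}|.
Implicit Types (s t : {perm 'I_n}) (X : T) (v : 'rV[R]_N).
Local Notation swap_mx := (@swap_mx R n).
Local Notation set_perm_mx := (@set_perm_mx R n).

Definition symmetrizer X : 'M[R]_N := \sum_(s | perm_on X s) set_perm_mx s.

Lemma perm_on_mulL X s t : perm_on X s -> perm_on X (s * t)%g = perm_on X t.
Proof.
move=> os; apply/idP/idP => [h|]; last exact: perm_onM.
have osV : perm_on X (s^-1)%g.
  apply/subsetP => x; rewrite !inE => ne; apply: (subsetP os); rewrite inE.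
  by apply: contraNneq ne => e; rewrite -{1}e permK.
by rewrite -(mulKg s t); apply: perm_onM.
Qed.

Lemma perm_on_tperm X i j : i \in X -> j \in X -> perm_on X (tperm i j).
Proof.
move=> iX jX; apply/subsetP => x; rewrite inE.
by case: tpermP => [->|->|]; rewrite ?eqxx.
Qed.

Lemma symmetrizer0 : symmetrizer set0 = 1%:M.
Proof.
rewrite /symmetrizer (big_pred1 1%g) ?set_perm_mx1 // => s /=.
apply/idP/eqP => [h|->]; last exact: perm_on1.
by apply/permP => x; rewrite (out_perm h) ?inE // perm1.
Qed.

Lemma swap_mx_symmetrizer X i j : i \in X -> j \in X -> swap_mx i j *m symmetrizer X = symmetrizer X.
Proof.
move=> iX jX; rewrite /symmetrizer mulmx_sumr.
rewrite (reindex_inj (mulgI (tperm i j))) /=; apply: eq_big => [s|s _].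
  by rewrite perm_on_mulL // perm_on_tperm.
by rewrite /swap_mx -set_perm_mxM mulgA tperm2 mul1g.
Qed.

(** Decomposition of the permutations of j |: X into cosets of those of X,
    according to the place that is sent to j. *)
Lemma symmetrizer_add X j : j \notin X -> symmetrizer (j |: X) = (1%:M + \sum_(i in X) swap_mx i j) *m symmetrizer X.
Proof.
move=> jX.
have -> : 1%:M + \sum_(i in X) swap_mx i j = \sum_(i in j |: X) swap_mx i j.
  by rewrite big_setU1 //= swap_mx_id.
rewrite mulmx_suml {1}/symmetrizer (partition_big (fun s => (s^-1)%g j) (mem (j |: X))) /=; last first.
  move=> s os; apply/negPn; apply/negP => nin.
  have := out_perm os nin; rewrite permKV => e.
  by move: nin; rewrite -e setU11.
apply: eq_bigr => i iX; rewrite /symmetrizer mulmx_sumr.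
rewrite (reindex_inj (mulgI (tperm i j))) /=; apply: eq_big => [s|s _]; last first.
  by rewrite /swap_mx -set_perm_mxM.
rewrite perm_on_mulL; last by rewrite perm_on_tperm // setU11.
rewrite invMg permM tpermV.
apply/andP/idP => [[os /eqP e]|os].
  have {}e : (s^-1)%g j = j by rewrite -[LHS](tpermK i j) e tpermL.
  apply/subsetP => x; rewrite inE => ne.
  have := subsetP os x; rewrite !inE => /(_ ne) /orP[/eqP xj|//].
  by case/eqP: ne; rewrite xj -{1}e permKV.
split; first by apply: subset_trans os (subsetU1 _ _).
have -> : (s^-1)%g j = j by rewrite -{1}(out_perm os jX) permK.
by rewrite tpermR.
Qed.

Lemma tr_symmetrizer X : (symmetrizer X)^T = symmetrizer X.
Proof.
rewrite /symmetrizer linear_sum /= (reindex_inj invg_inj) /=; apply: eq_big => [s|s _].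
  apply/idP/idP => os; apply/subsetP => x; rewrite inE => ne; apply: (subsetP os); rewrite inE.
    by apply: contraNneq ne => e; rewrite -{1}e permKV.
  by apply: contraNneq ne => e; rewrite -{1}e permK.
by rewrite tr_set_perm_mx invgK.
Qed.

End Sym.

(** * The symmetrizer identity *)

Section Swap.
Variables (I : finType) (V : nmodType).
Local Notation T := {set I}.

Lemma big_set_notin_del j (f : T -> V) :
  \sum_(X : T | j \notin X) f X = \sum_(X : T | j \in X) f (X :\ j).
Proof.
rewrite (reindex_onto (fun X => X :\ j) (fun X => j |: X)) /=; last first.
  by move=> X /setU1K.
apply: eq_bigl => X; rewrite !inE eqxx /=; apply/eqP/idP => [<-|/setD1K //].
by rewrite setU11.
Qed.

Lemma big_set_in_add j (f : T -> V) :
  \sum_(X : T | j \in X) f X = \sum_(X : T | j \notin X) f (j |: X).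
Proof.
rewrite (reindex_onto (fun X => j |: X) (fun X => X :\ j)) /=; last first.
  by move=> X /setD1K.
apply: eq_bigl => X; rewrite !inE eqxx /=; apply/eqP/idP => [<-|/setU1K //].
by rewrite !inE eqxx.
Qed.

(** Moving j from Y to X is a bijection on the triples (X, Y, j). *)
Lemma sum_swap (F : T -> T -> I -> V) :
  \sum_X \sum_Y \sum_(j in Y :\: X) F X Y j =
  \sum_X \sum_Y \sum_(j in X :\: Y) F (X :\ j) (j |: Y) j.
Proof.
have E (p : T -> T -> I -> bool) (scaled_sym : T -> T -> I -> V) :
    \sum_X \sum_Y \sum_(j | p X Y j) scaled_sym X Y j = \sum_j \sum_X \sum_(Y | p X Y j) scaled_sym X Y j.
  under eq_bigr => X _ do rewrite (exchange_big_dep predT) //=.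
  by rewrite exchange_big.
rewrite !E; apply: eq_bigr => j _.
transitivity (\sum_(X : T | j \notin X) \sum_(Y : T | j \in Y) F X Y j).
  rewrite [RHS]big_mkcond /=; apply: eq_bigr => X _.
  case: ifP => jX; last by rewrite big_pred0 // => Y; rewrite inE jX.
  by apply: eq_bigl => Y; rewrite inE jX.
rewrite big_set_notin_del [LHS]big_mkcond /=; apply: eq_bigr => X _.
case: ifP => jX; last by rewrite big_pred0 // => Y; rewrite inE jX andbF.
rewrite big_set_in_add; apply: eq_bigl => Y; by rewrite inE jX andbT.
Qed.
End Swap.

Section ODE.
Variables (R : realFieldType) (n : nat).
Local Notation T := {set 'I_n}.
Local Notation N := #|{set 'I_n}|.
Local Notation swap_mx := (@swap_mx R n).
Local Notation symmetrizer := (@symmetrizer R n).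

(** The average over the permutations of X, divided by |X| + 1.  This last factor
    comes from integrating s ^ |X|. *)
Definition scaled_sym (X : T) : 'M[R]_N := (#|X|.+1)`!%:R^-1 *: symmetrizer X.

Let natrS1 k : k.+1%:R = k%:R + 1 :> R.
Proof. by rewrite natr1. Qed.

Lemma scaled_sym_add (X : T) j : j \notin X ->
  (#|X|.+2)%:R *: scaled_sym (j |: X) = (1%:M + \sum_(i in X) swap_mx i j) *m scaled_sym X.
Proof.
move=> jX; rewrite /scaled_sym cardsU1 jX add1n symmetrizer_add // scalerA -scalemxAr; congr (_ *: _).
have h : (#|X|.+2)%:R != 0 :> R by rewrite pnatr_eq0.
by rewrite (factS #|X|.+1) natrM invfM mulrA mulfV ?mul1r.
Qed.

Lemma swap_mx_scaled_sym (X : T) i j : i \in X -> j \in X -> (1%:M - swap_mx i j) *m scaled_sym X = 0.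
Proof. by move=> iX jX; rewrite /scaled_sym -scalemxAr mulmxBl mul1mx swap_mx_symmetrizer // subrr scaler0. Qed.

Lemma scaled_sym_sum (X : T) j : j \notin X ->
  \sum_(i in X) (1%:M - swap_mx i j) *m scaled_sym X
  = (#|X|.+1)%:R *: scaled_sym X - (#|X|.+2)%:R *: scaled_sym (j |: X).
Proof.
move=> jX; rewrite scaled_sym_add // mulmxDl mul1mx mulmx_suml.
under eq_bigr => i _ do rewrite mulmxBl mul1mx.
by rewrite sumrB sumr_const -scaler_nat (natrS1 #|X|) scalerDl scale1r opprD addrA addrK.
Qed.

(** After scaled_sym_add the difference of the two sides is a sum over k in X of
    antisymmetrizers of i, j, k. *)
Lemma scaled_sym_antisym (X : T) i j : i != j -> i \notin X -> j \notin X ->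
  (1%:M - swap_mx i j) *m scaled_sym (i |: X) + (1%:M - swap_mx i j) *m scaled_sym (j |: X) = (1%:M - swap_mx i j) *m scaled_sym X.
Proof.
move=> ij iX jX.
have h : (#|X|.+2)%:R != 0 :> R by rewrite pnatr_eq0.
apply: (scalerI h); rewrite scalerDr !scalemxAr !scaled_sym_add //; move: (scaled_sym X) => g.
rewrite -mulmxDr -mulmxDl.
apply/eqP; rewrite -subr_eq0 -[_ *: g]mul1mx -scalemxAr scalemxAl.
rewrite -mulmxBr -mulmxBl mulmxA.
have -> : 1%:M + \sum_(k in X) swap_mx k i + (1%:M + \sum_(k in X) swap_mx k j) - (#|X|.+2)%:R *: 1%:M
        = - \sum_(k in X) (1%:M - swap_mx k i - swap_mx k j).
  rewrite !sumrB sumr_const -!scaler_nat.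
  rewrite (natrS1 #|X|.+1) (natrS1 #|X|) !scalerDl !scale1r.
  set a := \sum_(_ in _) _; set b := \sum_(_ in _) _; set c := _ *: _.
  by apply/matrixP => r s; rewrite !mxE; ring.
rewrite mulmxN mulmx_sumr big1 ?oppr0 ?mul0mx // => k kX.
by apply: antisym3 => //; [apply: contraNneq iX => <- | apply: contraNneq jX => <-].
Qed.

(** The equation w u'' - w' u' + tau u = 0 for the operator-valued polynomial
    u = \sum_X z^(~: X) s^(|X| + 1) scaled_sym X, read off coefficient by
    coefficient.  The weight mu stands for the extraction of one coefficient of a
    product indexed by (X, Y); only its invariance under moving an element from Y
    to X matters.

    In the double sum over i, j in Y, the pairs inside X contribute 0.  For a pair
    with i in X and j outside, scaled_sym_sum and the bijection sum_swap produce
    the first term with the opposite sign, up to the pairs with i in X but not in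
    Y.  A second use of sum_swap turns those into pairs outside X, which
    scaled_sym_antisym cancels against the remaining ones. *)
Lemma symmetrizer_identity (mu : T -> T -> R) :
  (forall (X Y : T) j, j \in Y -> j \notin X -> mu (j |: X) (Y :\ j) = mu X Y) ->
  \sum_X \sum_Y mu X Y *:
    ((2 * (#|X|%:R - #|Y|%:R) * (#|X|.+1)%:R) *: scaled_sym X +
     \sum_(i in Y) \sum_(j in Y | i != j) (1%:M - swap_mx i j) *m scaled_sym X) = 0.
Proof.
move=> muE.
pose Q (X : T) (i j : 'I_n) : 'M[R]_N := (1%:M - swap_mx i j) *m scaled_sym X.
have QC X i j : Q X i j = Q X j i by rewrite /Q swap_mxC.
have muE' (X Y : T) j : j \in X -> j \notin Y -> mu (X :\ j) (j |: Y) = mu X Y.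
  by move=> jX jY; rewrite -(muE (X :\ j) (j |: Y) j) ?setU11 ?setD11 // setD1K // setU1K.
pose D (X Y : T) := Y :\: X.
have split1 (X Y : T) : \sum_(i in Y) \sum_(j in Y | i != j) Q X i j =
    2 *: (\sum_(j in D X Y) \sum_(i in X) Q X i j) -
    2 *: (\sum_(j in D X Y) \sum_(i in X :\: Y) Q X i j) +
    \sum_(i in D X Y) \sum_(j in D X Y | i != j) Q X i j.
  have -> : \sum_(j in D X Y) \sum_(i in X) Q X i j =
      \sum_(j in D X Y) \sum_(i in X :&: Y) Q X i j +
      \sum_(j in D X Y) \sum_(i in X :\: Y) Q X i j.
    by rewrite -big_split; apply: eq_bigr => j _; rewrite (big_setID Y).
  rewrite scalerDr addrK (big_setID X) /= -/(D X Y).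
  rewrite [2 *: _](_ : _ = \sum_(j in D X Y) \sum_(i in X :&: Y) Q X i j + \sum_(j in D X Y) \sum_(i in X :&: Y) Q X i j); last first.
    by rewrite -mulr2n -scaler_nat.
  rewrite -addrA; congr (_ + _).
    rewrite [RHS]exchange_big setIC /=; apply: eq_bigr => i; rewrite inE => /andP[iX iY].
    rewrite (big_setIDcond _ Y X) /= big1 ?add0r => [|j]; last first.
      by rewrite inE => /andP[/andP[_ jX] _]; apply: swap_mx_scaled_sym.
    apply: eq_bigl => j; rewrite inE; case: eqVneq => [<-|_]; rewrite ?andbT ?andbF //.
    by rewrite iX.
  rewrite -big_split /=; apply: eq_bigr => i; rewrite inE => /andP[iX iY].
  rewrite (big_setIDcond _ Y X) /= -/(D X Y); congr (_ + _).
  rewrite setIC; apply: eq_big => [j|j _]; last exact: QC.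
  by rewrite inE; case: eqVneq => [<-|_]; rewrite ?andbT ?andbF // (negPf iX).
under eq_bigr => X _ do under eq_bigr => Y _ do rewrite split1 !scalerDr scalerN.
under eq_bigr => X _ do rewrite !big_split /= sumrN.
rewrite !big_split /= sumrN.
have A1 : \sum_X \sum_Y mu X Y *: (2 *: (\sum_(j in D X Y) \sum_(i in X) Q X i j)) =
   - \sum_X \sum_Y mu X Y *: ((2 * (#|X|%:R - #|Y|%:R) * (#|X|.+1)%:R) *: scaled_sym X).
  transitivity (\sum_X \sum_Y \sum_(j in D X Y) mu X Y *: ((2 * (#|X|.+1)%:R) *: scaled_sym X) -
    \sum_X \sum_Y \sum_(j in D X Y) mu X Y *: ((2 * (#|X|.+2)%:R) *: scaled_sym (j |: X))).
    rewrite -sumrB; apply: eq_bigr => X _; rewrite -sumrB; apply: eq_bigr => Y _.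
    rewrite -sumrB !scaler_sumr; apply: eq_bigr => j; rewrite inE => /andP[jX jY].
    by rewrite scaled_sym_sum // !scalerBr !scalerA !mulrA.
  rewrite (sum_swap (fun X Y j => mu X Y *: ((2 * (#|X|.+2)%:R) *: scaled_sym (j |: X)))) -sumrB -sumrN.
  apply: eq_bigr => X _; rewrite -sumrB -sumrN; apply: eq_bigr => Y _.
  rewrite [X in _ - X](eq_bigr (fun=> mu X Y *: ((2 * (#|X|.+1)%:R) *: scaled_sym X))); last first.
    move=> j; rewrite inE => /andP[jY jX]; rewrite muE' // setD1K //; congr (_ *: ((_ * _%:R) *: _)).
    by rewrite [in RHS](cardsD1 j) jX.
  rewrite !sumr_const -!scaler_nat !scalerA -scalerBl -scaleNr; congr (_ *: _).
  have cX := cardsID Y X; have cY := cardsID X Y; rewrite setIC in cY.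
  have -> : #|X|%:R - #|Y|%:R = #|X :\: Y|%:R - #|Y :\: X|%:R :> R.
    by rewrite -cX -cY !natrD; ring.
  by rewrite /D; ring.
have A2 : \sum_X \sum_Y mu X Y *: (2 *: (\sum_(j in D X Y) \sum_(i in X :\: Y) Q X i j)) =
  \sum_X \sum_Y mu X Y *: \sum_(i in D X Y) \sum_(j in D X Y | i != j) Q X i j.
  pose F (X Y : T) (i : 'I_n) := mu X Y *: (2 *: \sum_(j in D X Y | i != j) Q (i |: X) i j).
  transitivity (\sum_X \sum_Y \sum_(i in D X Y) F X Y i).
    rewrite sum_swap; apply: eq_bigr => X _; apply: eq_bigr => Y _.
    rewrite exchange_big !scaler_sumr /=; apply: eq_bigr => i; rewrite inE => /andP[iY iX].
    rewrite /F muE' // setD1K //; congr (_ *: (_ *: _)); apply: eq_bigl => j.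
    rewrite !inE; case: (eqVneq j i) => [->|ne]; first by rewrite iX ?eqxx ?andbF.
    by rewrite /= ?andbT.
  apply: eq_bigr => X _; apply: eq_bigr => Y _; rewrite /F -!scaler_sumr; congr (_ *: _).
  rewrite scaler_nat mulr2n.
  have E : \sum_(i in D X Y) \sum_(j in D X Y | i != j) Q (i |: X) i j =
           \sum_(i in D X Y) \sum_(j in D X Y | i != j) Q (j |: X) i j.
    rewrite (exchange_big_dep (mem (D X Y))) /= => [|i j _ /andP[]//].
    apply: eq_bigr => i iD; apply: eq_big => [j|j _]; last by rewrite QC.
    by rewrite eq_sym (_ : i \in D X Y).
  rewrite {2}E -big_split; apply: eq_bigr => i; rewrite inE => /andP[iX iY].
  rewrite -big_split; apply: eq_bigr => j; rewrite inE => /andP[/andP[jX jY] ij].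
  exact: scaled_sym_antisym.
by rewrite A1 A2 addrA addrA subrr sub0r addNr.
Qed.

End ODE.

(** * Polynomial solutions of a second-order equation *)

Section PolyODE.
Variable R : numFieldType.
Implicit Types w v tau p q : {poly R}.

Definition ode w tau v := w * v^`()^`() - w^`() * v^`() + tau * v.

Lemma coef_deriv2 v i : v^`()^`()`_i = v`_i.+2 *+ (i.+1 * i.+2).
Proof. by rewrite !coef_deriv -mulrnA mulnC. Qed.

(** The lowest coefficient of a solution is killed by its indicial equation
    k (k - 1) = 0. *)
Lemma ode_uniq w tau v : w`_0 != 0 -> v`_0 = 0 -> v`_1 = 0 -> ode w tau v = 0 -> v = 0.
Proof.
move=> w0 v0 v1 E; apply/polyP => k; rewrite coef0.
elim/ltn_ind: k => -[//|[//|k]] IH.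
have := congr1 (fun p : {poly R} => p`_k) E; rewrite /ode !coefD coefN !coefM coef0.
rewrite big_ord_recl /= subn0 coef_deriv2 big1 => [|i _]; last first.
  by rewrite coef_deriv2 IH ?mul0rn ?mulr0 //; rewrite /bump; have := ltn_ord i; lia.
rewrite [X in _ - X]big1 => [|i _]; last first.
  by rewrite [v^`()`_ _]coef_deriv IH ?mul0rn ?mulr0 //; have := ltn_ord i; lia.
rewrite [X in _ + X]big1 => [|i _]; last first.
  by rewrite IH ?mulr0 //; have := ltn_ord i; lia.
rewrite addr0 subr0 addr0 => /eqP; rewrite mulf_eq0 (negPf w0) /= mulrn_eq0 /= => /eqP.
by [].
Qed.

Lemma coefM_top p q a b : (size p <= a.+1)%N -> (size q <= b.+1)%N ->
  (p * q)`_(a + b) = p`_a * q`_b.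
Proof.
move=> sp sq; rewrite coefM (bigD1 (inord a)) //= inordK ?ltnS ?leq_addr //.
rewrite addKn big1 ?addr0 // => i ne.
have {ne} ne : (i : nat) != a.
  by apply: contraNneq ne => e; apply/eqP/val_inj; rewrite /= inordK ?ltnS ?leq_addr.
case: (ltnP i a) => h; last first.
  rewrite [p`_i]nth_default ?mul0r // (leq_trans sp) // ltn_neqAle h andbT eq_sym; exact: ne.
by rewrite [q`_ _]nth_default ?mulr0 // (leq_trans sq) //; lia.
Qed.

Lemma size_deriv_le p a : (size p <= a.+1)%N -> (size p^`() <= a)%N.
Proof.
by move=> sp; apply/leq_sizeP => j aj; rewrite coef_deriv nth_default ?mul0rn // (leq_trans sp).
Qed.

(** The leading coefficient of a solution of degree k satisfies
    k (k - 1) - 2 m k + m (m + 1) = (k - m) (k - m - 1) = 0. *)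
Lemma ode_size m w tau v : (0 < m)%N -> size w = (2 * m).+1 -> w \is monic ->
  (size tau <= (2 * m).-1)%N -> tau`_(2 * m - 2) = (m * m.+1)%:R ->
  ode w tau v = 0 -> (size v <= m.+2)%N.
Proof.
move=> m0 sw mw st ct E.
case: (leqP (size v) 2) => [h|h]; first by rewrite (leq_trans h) //; lia.
have [k sv] : exists k, size v = k.+3 by exists (size v - 3)%N; lia.
have w1 : w`_(2 * m) = 1 by move/monicP: mw; rewrite /lead_coef sw.
have c0 : v`_k.+2 != 0 by have := lead_coef_eq0 v; rewrite /lead_coef sv /= -size_poly_eq0 sv => ->.
have := congr1 (fun p : {poly R} => p`_(2 * m + k)) E.
rewrite /ode !coefD coefN coef0.
rewrite (@coefM_top w) ?sw //; last first.
  by do 2!apply: size_deriv_le; rewrite sv.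
rewrite (_ : 2 * m + k = (2 * m - 1) + k.+1)%N; last lia.
rewrite (@coefM_top w^`()); last 2 first.
- by apply: size_deriv_le; rewrite sw; lia.
- by apply: size_deriv_le; rewrite sv.
rewrite (_ : (2 * m - 1) + k.+1 = (2 * m - 2) + k.+2)%N; last lia.
rewrite (@coefM_top tau) ?sv //; last lia.
rewrite coef_deriv2 !coef_deriv ct (_ : (2 * m - 1).+1 = 2 * m)%N; last lia.
rewrite w1 mul1r -[v`_k.+2 *+ _]mulr_natr -[v`_k.+2 *+ _]mulr_natr => H.
have {H} : v`_k.+2 * ((k.+1 * k.+2)%:R - (2 * m)%:R * k.+2%:R + (m * m.+1)%:R) = 0.
  by rewrite -[RHS]H; ring.
move/eqP; rewrite mulf_eq0 (negPf c0) /= => /eqP H.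
have {}H : (k.+1 * k.+2 + m * m.+1 = 2 * m * k.+2)%N.
  apply/eqP; rewrite -(eqr_nat R) natrD natrM (natrM _ (2 * m)) -subr_eq0 -[X in _ == X]H.
  by apply/eqP; rewrite !natrM; ring.
rewrite ltnNge; apply/negP => hk.
have [e ke] : exists e, k = (m + e)%N by exists (k - m)%N; rewrite subnKC.
by move: H; rewrite ke; nia.
Qed.

End PolyODE.

(** * The equation attached to a joint eigenvector *)

Section Gaudin.
Variables (R : realFieldType) (n : nat).
Local Notation T := {set 'I_n}.
Local Notation N := #|{set 'I_n}|.
Local Notation swap_mx := (@swap_mx R n).
Local Notation scaled_sym := (@scaled_sym R n).
Implicit Types (x z h : 'I_n -> R) (X Y : T) (psi : 'rV[R]_N).

Definition gaudin x (i : 'I_n) : 'M[R]_N :=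
  \sum_(j | j != i) (x i - x j)^-1 *: (1%:M - swap_mx i j).

(** With z i = t0 - x i, this is \prod_i (X - x i) in the variable X - t0. *)
Definition shifted_roots z : {poly R} := \prod_i ('X + (z i)%:P).
Definition shifted_tau z h : {poly R} := \sum_i h i *: \prod_(k | k != i) ('X + (z k)%:P).
Definition compl_prod z Y : R := \prod_(i in ~: Y) z i.

(** The factors X on the left account for the places outside Q, so that all
    monomials on the right have the degree #|Y|. *)
Lemma prod_addX_expand z (Q : pred 'I_n) : \prod_(i | Q i) ('X + (z i)%:P) * \prod_(i | ~~ Q i) 'X =
  \sum_(Y : T | [forall i, ~~ Q i ==> (i \in Y)]) compl_prod z Y *: 'X^(#|Y|) :> {poly R}.
Proof.
transitivity (\prod_i ('X + (if Q i then (z i)%:P else 0))).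
  rewrite [RHS](bigID Q) /=; congr (_ * _); apply: eq_bigr => i; first by move=> ->.
  by move/negPf ->; rewrite addr0.
rewrite bigA_distr [RHS]big_mkcond /=; apply: eq_bigr => Y _.
case: ifP => [/forallP h|/negbT].
  rewrite (bigID (mem Y)) /= mulrC -mul_polyC /compl_prod rmorph_prod; congr (_ * _).
    apply: eq_big => [i|i /negPf iY]; first by rewrite inE.
    by rewrite iY; have := h i; rewrite iY implybF negbK => ->.
  under eq_bigr => i iY do rewrite iY.
  by rewrite prodr_const.
rewrite negb_forall => /existsP[k]; rewrite negb_imply => /andP[Qk kY].
by rewrite (bigD1 k) //= (negPf kY) (negPf Qk) mul0r.
Qed.

Lemma shifted_roots_expand z : shifted_roots z = \sum_(Y : T) compl_prod z Y *: 'X^(#|Y|).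
Proof.
have := prod_addX_expand z xpredT; rewrite /= big_pred0_eq mulr1 /shifted_roots => ->.
by apply: eq_bigl => Y; apply/forallP.
Qed.

Lemma pair_expand z (i j : 'I_n) : i != j ->
  'X^2 * \prod_(k | (k != i) && (k != j)) ('X + (z k)%:P) =
  \sum_(Y : T | (i \in Y) && (j \in Y)) compl_prod z Y *: 'X^(#|Y|).
Proof.
move=> ij; rewrite mulrC.
transitivity (\sum_(Y : T | [forall k, ~~ ((k != i) && (k != j)) ==> (k \in Y)]) compl_prod z Y *: 'X^(#|Y|) : {poly R}).
  rewrite -prod_addX_expand; congr (_ * _).
  rewrite (bigD1 i) ?eqxx //= (big_pred1 j) ?expr2 // => k.
  rewrite /= negb_and !negbK; case: (eqVneq k i) => [->|] /=; last by rewrite andbT.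
  by rewrite (negPf ij).
apply: eq_bigl => Y; apply/forallP/andP => [h|[iY jY] k].
  by have := h i; have := h j; rewrite !eqxx /= andbF /= => -> ->.
by rewrite negb_and !negbK; apply/implyP => /orP[]/eqP->.
Qed.

Lemma compl_prodD1 z X j : j \notin X -> compl_prod z X = z j * compl_prod z (j |: X).
Proof.
move=> jX; rewrite /compl_prod (bigD1 j) ?inE //=; congr (_ * _); apply: eq_bigl => i.
by rewrite !inE negb_or andbC.
Qed.

(** The coordinate b of psi times the operator-valued polynomial of the
    symmetrizer identity. *)
Definition solution_poly z psi (b : 'I_N) : {poly R} :=
  \sum_(X : T) (compl_prod z X * (psi *m scaled_sym X) 0 b) *: 'X^(#|X|.+1).

Section Eigen.
Variables (x h : 'I_n -> R) (t0 : R) (psi : 'rV[R]_N).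
Hypothesis x_inj : injective x.
Hypothesis psi_eigen : forall i, psi *m gaudin x i = h i *: psi.
Let z i := t0 - x i.

(** Antisymmetry of 1 / (x i - x j) combines the two terms of a pair: the
    difference of the factors X + z j and X + z i is x i - x j, which cancels the
    denominator. *)
Lemma tau_pairs : forall b, psi 0 b *: (2 *: shifted_tau z h) =
  \sum_i \sum_(j | i != j) ((psi *m (1%:M - swap_mx i j)) 0 b) *:
    \prod_(k | (k != i) && (k != j)) ('X + (z k)%:P).
Proof.
move=> b; pose Pi i j : {poly R} := \prod_(k | (k != i) && (k != j)) ('X + (z k)%:P).
pose q i j := (psi *m (1%:M - swap_mx i j)) 0 b.
have qC i j : q i j = q j i by rewrite /q swap_mxC.
have PiC i j : Pi i j = Pi j i by apply: eq_bigl => k; rewrite andbC.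
have E : psi 0 b *: shifted_tau z h =
    \sum_i \sum_(j | i != j) ((x i - x j)^-1 * q i j) *: (('X + (z j)%:P) * Pi i j).
  rewrite /shifted_tau scaler_sumr; apply: eq_bigr => i _; rewrite scalerA.
  have -> : psi 0 b * h i = \sum_(j | i != j) (x i - x j)^-1 * q i j.
    have := congr1 (fun u : 'rV_N => u 0 b) (psi_eigen i); rewrite [RHS]mxE mulrC => <-.
    rewrite /gaudin mulmx_sumr summxE; apply: eq_big => [j|j _]; first by rewrite eq_sym.
    by rewrite -scalemxAr mxE.
  rewrite scaler_suml; apply: eq_bigr => j ij; congr (_ *: _).
  by rewrite (bigD1 j) 1?eq_sym //=.
have E2 : psi 0 b *: shifted_tau z h =
    \sum_i \sum_(j | i != j) ((x i - x j)^-1 * q i j) *: ((- 'X - (z i)%:P) * Pi i j).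
  rewrite E (exchange_big_dep xpredT) //=; apply: eq_bigr => i _.
  apply: eq_big => [j|j ji]; first by rewrite eq_sym.
  rewrite qC PiC -opprB invrN mulNr scaleNr -scalerN -mulNr opprD //.
rewrite scalerA mulrC -scalerA -[2]/(1 + 1) scalerDl scale1r {1}E E2 -big_split.
apply: eq_bigr => i _; rewrite -big_split; apply: eq_bigr => j ij /=.
rewrite -scalerDr -mulrDl.
have -> : 'X + (z j)%:P + (- 'X - (z i)%:P) = (x i - x j)%:P.
  by rewrite addrACA subrr add0r -polyCB; congr (_%:P); rewrite /z; ring.
rewrite mul_polyC scalerA mulrAC mulVf ?mul1r // subr_eq0.
by apply: contraNneq ij => /x_inj ->.
Qed.

Let c b X := compl_prod z X * (psi *m scaled_sym X) 0 b.

Lemma derivs_solution_poly b :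
  (solution_poly z psi b)^`() = \sum_(X : T) (c b X * (#|X|.+1)%:R) *: 'X^(#|X|) /\
  'X * (solution_poly z psi b)^`()^`() = \sum_(X : T) (c b X * (#|X|.+1)%:R * #|X|%:R) *: 'X^(#|X|).
Proof.
have E : (solution_poly z psi b)^`() = \sum_(X : T) (c b X * (#|X|.+1)%:R) *: 'X^(#|X|).
  rewrite /solution_poly raddf_sum /=; apply: eq_bigr => X _.
  by rewrite derivZ derivXn /= -scaler_nat scalerA.
split=> //; rewrite E raddf_sum mulr_sumr; apply: eq_bigr => X _ /=.
rewrite derivZ derivXn -scaler_nat scalerA -scalerAr; case: (#|X|) => [|k] /=.
  by rewrite mulr0 !scale0r.
by rewrite exprS.
Qed.

Lemma deriv_shifted_roots : 'X * (shifted_roots z)^`() = \sum_(Y : T) (compl_prod z Y * #|Y|%:R) *: 'X^(#|Y|).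
Proof.
rewrite shifted_roots_expand raddf_sum mulr_sumr; apply: eq_bigr => X _ /=.
rewrite derivZ derivXn -scaler_nat scalerA -scalerAr; case: (#|X|) => [|k] /=.
  by rewrite mulr0 !scale0r.
by rewrite exprS.
Qed.

Lemma tau_solution_poly b : 2 *: ('X * (shifted_tau z h * solution_poly z psi b)) = \sum_(X : T) \sum_(Y : T)
  (compl_prod z X * compl_prod z Y * (\sum_(i in Y) \sum_(j in Y | i != j) (psi *m ((1%:M - swap_mx i j) *m scaled_sym X)) 0 b))
    *: 'X^(#|X| + #|Y|).
Proof.
rewrite /solution_poly !mulr_sumr scaler_sumr; apply: eq_bigr => X _.
have E : (psi *m scaled_sym X) 0 b *: (2 *: shifted_tau z h) = \sum_i \sum_(j | i != j)
    ((psi *m ((1%:M - swap_mx i j) *m scaled_sym X)) 0 b) *: \prod_(k | (k != i) && (k != j)) ('X + (z k)%:P).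
  transitivity (\sum_a scaled_sym X a b *: (psi 0 a *: (2 *: shifted_tau z h))).
    rewrite mxE scaler_suml; apply: eq_bigr => a _.
    by rewrite [in RHS]scalerA (mulrC (scaled_sym X a b)).
  under eq_bigr => a _ do rewrite tau_pairs scaler_sumr.
  rewrite exchange_big; apply: eq_bigr => i _ /=.
  under eq_bigr => a _ do rewrite scaler_sumr.
  rewrite exchange_big; apply: eq_bigr => j _ /=.
  rewrite mulmxA mxE scaler_suml; apply: eq_bigr => a _.
  by rewrite scalerA mulrC.
transitivity (compl_prod z X *: ('X^(#|X|) * ('X^2 * ((psi *m scaled_sym X) 0 b *: (2 *: shifted_tau z h))))).
  rewrite -!scalerAr !scalerA.
  have -> : 'X * (shifted_tau z h * 'X^(#|X|.+1)) = 'X^(#|X|) * ('X^2 * shifted_tau z h).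
    by rewrite exprS; ring.
  by congr (_ *: _); ring.
rewrite E mulr_sumr.
have E2 : \sum_i 'X^2 * (\sum_(j | i != j)
    ((psi *m ((1%:M - swap_mx i j) *m scaled_sym X)) 0 b) *: \prod_(k | (k != i) && (k != j)) ('X + (z k)%:P))
  = \sum_(Y : T) (compl_prod z Y * (\sum_(i in Y) \sum_(j in Y | i != j) (psi *m ((1%:M - swap_mx i j) *m scaled_sym X)) 0 b))
    *: 'X^(#|Y|).
  transitivity (\sum_i \sum_(j | i != j) \sum_(Y : T | (i \in Y) && (j \in Y))
     (compl_prod z Y * (psi *m ((1%:M - swap_mx i j) *m scaled_sym X)) 0 b) *: ('X^(#|Y|) : {poly R})).
    apply: eq_bigr => i _; rewrite mulr_sumr; apply: eq_bigr => j ij.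
    rewrite -scalerAr pair_expand // scaler_sumr; apply: eq_bigr => Y _.
    by rewrite scalerA mulrC.
  under eq_bigr => i _ do rewrite (exchange_big_dep (fun Y : T => i \in Y)) /= => [|j Y _ /andP[]//].
  rewrite (exchange_big_dep xpredT) //=; apply: eq_bigr => Y _.
  rewrite mulr_sumr scaler_suml; apply: eq_bigr => i iY.
  rewrite mulr_sumr scaler_suml; apply: eq_bigl => j.
  by rewrite iY andbC.
rewrite E2 mulr_sumr scaler_sumr; apply: eq_bigr => Y _.
by rewrite -scalerAr scalerA -exprD mulrA.
Qed.

(** Multiplied by 2 X, the equation is a sum over (X, Y) of monomials
    'X^(#|X| + #|Y|), each of whose coefficients is an instance of
    symmetrizer_identity. *)
Lemma solution_poly_ode b : ode (shifted_roots z) (shifted_tau z h) (solution_poly z psi b) = 0.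
Proof.
have [d1 d2] := derivs_solution_poly b; have dw := deriv_shifted_roots.
pose a (X Y : T) := (psi *m ((2 * (#|X|%:R - #|Y|%:R) * (#|X|.+1)%:R) *: scaled_sym X +
     \sum_(i in Y) \sum_(j in Y | i != j) (1%:M - swap_mx i j) *m scaled_sym X)) 0 b.
have E : 2 *: ('X * ode (shifted_roots z) (shifted_tau z h) (solution_poly z psi b)) =
   \sum_(X : T) \sum_(Y : T) (compl_prod z X * compl_prod z Y * a X Y) *: 'X^(#|X| + #|Y|).
  rewrite /ode mulrDr mulrBr scalerDr scalerBr tau_solution_poly.
  rewrite mulrCA d2 shifted_roots_expand -shifted_roots_expand (mulrA 'X) dw d1.
  rewrite shifted_roots_expand !mulr_suml !scaler_sumr.
  under [X in X - _ + _]eq_bigr => Y _ do rewrite mulr_sumr scaler_sumr.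
  under [X in _ - X + _]eq_bigr => Y _ do rewrite mulr_sumr scaler_sumr.
  rewrite exchange_big /= [X in _ - X + _]exchange_big /= -sumrB -big_split /=.
  apply: eq_bigr => X _; rewrite -sumrB -big_split /=; apply: eq_bigr => Y _.
  rewrite -!scalerAl -!scalerAr !scalerA -!exprD (addnC #|Y|) -scalerBl -scalerDl; congr (_ *: _).
  rewrite /a mulmxDr mxE -scalemxAr mxE mulmx_sumr summxE /c.
  under [in RHS]eq_bigr => i _ do rewrite mulmx_sumr summxE.
  by ring.
have Z : 'X * ode (shifted_roots z) (shifted_tau z h) (solution_poly z psi b) = 0.
  apply/eqP; have : 2 *: ('X * ode (shifted_roots z) (shifted_tau z h) (solution_poly z psi b)) == 0; last first.
    by rewrite scaler_eq0 pnatr_eq0.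
  rewrite E; apply/eqP/polyP => k; rewrite coef0 coef_sum.
  under eq_bigr => X _ do rewrite coef_sum.
  pose mu (X Y : T) : R := compl_prod z X * compl_prod z Y * (k == #|X| + #|Y|)%N%:R.
  have muE (X Y : T) j : j \in Y -> j \notin X -> mu (j |: X) (Y :\ j) = mu X Y.
    move=> jY jX; rewrite /mu (compl_prodD1 z jX) (@compl_prodD1 z (Y :\ j) j) ?setD11 // setD1K //.
    rewrite cardsU1 jX (cardsD1 j Y) jY add1n addSnnS add1n; ring.
  have E0 : (psi *m \sum_(X : T) \sum_(Y : T) mu X Y *:
    ((2 * (#|X|%:R - #|Y|%:R) * (#|X|.+1)%:R) *: scaled_sym X +
     \sum_(i in Y) \sum_(j in Y | i != j) (1%:M - swap_mx i j) *m scaled_sym X)) 0 b = 0.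
    by rewrite (symmetrizer_identity muE) mulmx0 mxE.
  transitivity (\sum_(X : T) \sum_(Y : T) mu X Y * a X Y).
    apply: eq_bigr => X _; apply: eq_bigr => Y _.
    by rewrite coefZ coefXn /mu; ring.
  rewrite -[RHS]E0 mulmx_sumr summxE; apply: eq_bigr => X _.
  rewrite mulmx_sumr summxE; apply: eq_bigr => Y _.
  by rewrite -scalemxAr mxE.
by apply/eqP; move/eqP: Z; rewrite mulf_eq0 polyX_eq0.
Qed.

End Eigen.
End Gaudin.

(** * Singular vectors and the behaviour at infinity *)

Section Singular.
Variables (R : realFieldType) (n : nat).
Local Notation T := {set 'I_n}.
Local Notation N := #|{set 'I_n}|.
Local Notation swap_mx := (@swap_mx R n).
Local Notation scaled_sym := (@scaled_sym R n).
Implicit Types (x z h : 'I_n -> R) (X Y S K : T) (v psi : 'rV[R]_N).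

(** The highest weight vectors of weight n - 2 m for the diagonal action of sl_2:
    they are supported on the subsets of size m, and the operator that erases one
    element of a subset kills them. *)
Definition singular (m : nat) v :=
  (forall S, #|S| != m -> setcoord v S = 0) /\
  (forall S, \sum_(i in ~: S) setcoord v (i |: S) = 0).

Lemma tperm_imset_swap S i j : i \in S -> j \notin S -> tperm i j @: S = j |: (S :\ i).
Proof.
move=> iS jS; apply/setP => k; rewrite -{1}[k](tpermK i j) mem_imset; last exact: perm_inj.
rewrite !inE; case: tpermP => [->|->|/eqP ki /eqP kj].
- by rewrite eqxx (negPf jS) orbF; apply/esym/negbTE; apply: contraNneq jS => <-.
- by rewrite eqxx iS.
- by rewrite (negPf ki) (negPf kj) orFb.
Qed.

(** Only pairs with one place in S and the other outside contribute.  For fixed i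
    in S, the vanishing of the lowered vector at S :\ i expresses the sum over j
    of the swapped coordinates through the coordinate at S itself. *)
Lemma casimir_local K v S :
  (forall i, i \in S :&: K -> \sum_(j in K :\: (S :\ i)) setcoord v (j |: (S :\ i)) = 0) ->
  \sum_(i in K) \sum_(j in K) (setcoord v S - setcoord v (tperm i j @: S)) =
  (2 * (#|S :&: K| * #|K :\: S|.+1))%:R * setcoord v S.
Proof.
move=> low; pose f i j := setcoord v S - setcoord v (tperm i j @: S).
have f0 i j : (i \in S) = (j \in S) -> f i j = 0.
  by move=> e; rewrite /f tperm_imset_id // subrr.
have fC i j : f i j = f j i by rewrite /f tpermC.
have E : \sum_(i in K) \sum_(j in K) f i j = 2 * \sum_(i in K :&: S) \sum_(j in K :\: S) f i j.
  rewrite (big_setID S) /= [2]/(1 + 1) mulrDl mul1r; congr (_ + _).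
    apply: eq_bigr => i; rewrite inE => /andP[_ iS]; rewrite (big_setID S) /= big1 ?add0r // => j.
    by rewrite inE => /andP[_ jS]; apply: f0; rewrite iS jS.
  rewrite [RHS]exchange_big /=; apply: eq_bigr => i; rewrite inE => /andP[iS _].
  rewrite (big_setID S) /= [X in _ + X]big1 ?addr0 => [|j].
    by apply: eq_bigr => j _; apply: fC.
  by rewrite inE => /andP[jS _]; apply: f0; rewrite (negPf iS) (negPf jS).
rewrite -/(f _) E natrM -mulrA; congr (_ * _).
rewrite (eq_bigr (fun=> (#|K :\: S|.+1)%:R * setcoord v S)) => [|i].
  by rewrite sumr_const natrM setIC -[LHS]mulr_natl mulrA.
rewrite inE => /andP[iK iS].
have := low i; rewrite !inE iS iK => /(_ isT).
rewrite (bigD1 i) ?inE ?eqxx ?iK //= setD1K // => /eqP; rewrite addr_eq0 => /eqP e.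
rewrite sumrB sumr_const -[_ *+ _]mulr_natl -natr1 mulrDl mul1r; congr (_ + _).
rewrite [RHS]e; congr (- _); apply: eq_big => [j|j].
  rewrite !inE; case: (eqVneq j i) => [->|_] /=; rewrite ?iS ?andbT ?andbF //.
by rewrite inE => /andP[jS jK]; rewrite tperm_imset_swap.
Qed.

Lemma size_prod_addXC z (Q : pred 'I_n) :
  size (\prod_(k | Q k) ('X + (z k)%:P)) = #|Q|.+1 /\
  \prod_(k | Q k) ('X + (z k)%:P) \is monic.
Proof.
have -> : \prod_(k | Q k) ('X + (z k)%:P) = \prod_(k <- enum Q) ('X - (- z k)%:P).
  by rewrite big_enum; apply: eq_bigr => k _; rewrite polyCN opprK.
by rewrite size_prod_XsubC monic_prod_XsubC cardE.
Qed.

Lemma odeB (w tau u v : {poly R}) : ode w tau (u - v) = ode w tau u - ode w tau v.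
Proof. by rewrite /ode !derivB; ring. Qed.
Lemma odeZ c (w tau u : {poly R}) : ode w tau (c *: u) = c *: ode w tau u.
Proof. by rewrite /ode !derivZ -!mul_polyC; ring. Qed.

Definition solution_mx z (k : nat) : 'M[R]_N := \sum_(X : T | #|X|.+1 == k) compl_prod z X *: scaled_sym X.

Lemma coef_solution_poly z psi b k : (solution_poly z psi b)`_k = (psi *m solution_mx z k) 0 b.
Proof.
rewrite /solution_poly coef_sum /solution_mx mulmx_sumr summxE [RHS]big_mkcond /=.
apply: eq_bigr => X _; rewrite coefZ coefXn eq_sym.
have -> : psi *m (compl_prod z X *: scaled_sym X) = compl_prod z X *: (psi *m scaled_sym X) by rewrite -scalemxAr.
by rewrite [X in _ = (if _ then X else _)]mxE; case: eqP => _; rewrite ?mulr1 ?mulr0.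
Qed.

Lemma solution_mx0 z : solution_mx z 0 = 0.
Proof. by rewrite /solution_mx big_pred0. Qed.
Lemma solution_mx1 z : solution_mx z 1 = ((shifted_roots z)`_0)%:M.
Proof.
rewrite /solution_mx (big_pred1 set0) => [|X]; last by rewrite eqSS cards_eq0.
rewrite /scaled_sym cards0 factS fact0 muln1 invr1 scale1r symmetrizer0 scalemx1; congr (_%:M).
rewrite -horner_coef0 /shifted_roots horner_prod /compl_prod setC0.
by apply: eq_big => [i|i _]; rewrite ?inE // !hornerE.
Qed.

Variable m : nat.
Hypothesis nm : n = (2 * m)%N.
Hypothesis m0 : (0 < m)%N.

Section Solution.
Variables (x h : 'I_n -> R) (psi : 'rV[R]_N).
Hypothesis x_inj : injective x.
Hypothesis psi_eigen : forall i, psi *m gaudin x i = h i *: psi.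
Hypothesis psi_sing : singular m psi.
Hypothesis psi0 : psi != 0.

(** The Casimir operator acts on a singular vector by a scalar. *)
Lemma casimir_singular :
  \sum_i \sum_(j | i != j) psi *m (1%:M - swap_mx i j) = (2 * (m * m.+1))%:R *: psi.
Proof.
have [supp low] := psi_sing.
apply: setcoord_inj => S; rewrite {1}/setcoord summxE.
transitivity (\sum_(i in [set: 'I_n]) \sum_(j in [set: 'I_n]) (setcoord psi S - setcoord psi (tperm i j @: S))).
  apply: eq_big => [i|i _]; first by rewrite inE.
  rewrite summxE big_mkcond /=; apply: eq_big => [j|j _]; first by rewrite inE.
  case: eqVneq => [<-|_] /=; first by rewrite tperm_imset_id ?subrr.
  by rewrite -setcoord_swap /setcoord mulmxBr mulmx1 !mxE.
rewrite casimir_local => [|i].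
  rewrite /setcoord [RHS]mxE -/(setcoord _ _) setIT setTD.
  case: (eqVneq #|S| m) => [e|/supp ->]; last by rewrite !mulr0.
  by rewrite e cardsCs setCK card_ord e (_ : n - m = m)%N //; lia.
by rewrite inE => /andP[iS _]; rewrite setTD low.
Qed.

(** By tau_pairs the two leading coefficients of tau are the sum of the h i, which
    vanishes, and half of the eigenvalue of the Casimir operator. *)
Lemma tau_top t0 : let tau := shifted_tau (fun i => t0 - x i) h in
  (size tau <= (2 * m).-1)%N /\ tau`_(2 * m - 2) = (m * m.+1)%:R.
Proof.
move=> tau; have [b pb] : exists b, psi 0 b != 0.
  by apply/existsP; apply: contraNT psi0; rewrite negb_exists => /forallP H;
     apply/eqP/rowP => b; rewrite mxE; apply/eqP; rewrite -[_ == _]negbK H.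
have E := tau_pairs t0 x_inj psi_eigen b; rewrite -/tau in E.
have card2 i j : i != j -> #|[pred k : 'I_n | (k != i) && (k != j)]| = (2 * m - 2)%N.
  move=> ij; have := cardC (pred2 i j); rewrite card2 ij card_ord; set c := #|_| => /= E2.
  have -> : (2 * m - 2 = c)%N by lia.
  by rewrite /c; apply: eq_card => k; rewrite !inE negb_or.
have sz i j : i != j ->
    size (\prod_(k | (k != i) && (k != j)) ('X + (t0 - x k)%:P)) = (2 * m).-1 /\
    (\prod_(k | (k != i) && (k != j)) ('X + (t0 - x k)%:P))`_(2 * m - 2) = 1.
  move=> ij; have [s /monicP] := size_prod_addXC (fun k => t0 - x k) [pred k | (k != i) && (k != j)].
  by rewrite /lead_coef s card2 // => ->; split => //; lia.
have c2 : psi 0 b * 2 != 0 by rewrite mulf_neq0 // pnatr_eq0.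
split.
  rewrite -(size_scale _ c2) -scalerA E.
  apply: (leq_trans (size_sum _ _ _)); apply/bigmax_leqP => i _.
  apply: (leq_trans (size_sum _ _ _)); apply/bigmax_leqP => j ij.
  by apply: (leq_trans (size_scale_leq _ _)); have [-> _] := sz _ _ ij.
have := congr1 (fun p : {poly R} => p`_(2 * m - 2)) E.
rewrite scalerA coefZ [in RHS]coef_sum.
have := congr1 (fun u : 'rV_N => u 0 b) casimir_singular; rewrite summxE [RHS]mxE => Ec.
rewrite [X in _ = X](eq_bigr (fun i => (\sum_(j | i != j) psi *m (1%:M - swap_mx i j)) 0 b)) => [|i _]; last first.
  rewrite coef_sum summxE; apply: eq_bigr => j ij; rewrite coefZ.
  by have [_ ->] := sz _ _ ij; rewrite mulr1.
rewrite Ec => H; apply: (mulfI c2); rewrite H natrM; ring.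
Qed.

(** All coordinates of the vector solution have proportional initial values at 0,
    hence are proportional by uniqueness: the operators solution_mx z k act on psi
    by scalars, the coefficients of u. *)
Lemma eigen_solution t0 : let z i := t0 - x i in (shifted_roots z)`_0 != 0 ->
  exists u : {poly R}, [/\ (size u <= m.+2)%N, u`_0 = 0, u`_1 = (shifted_roots z)`_0,
    ode (shifted_roots z) (shifted_tau z h) u = 0 & forall k, psi *m solution_mx z k = u`_k *: psi].
Proof.
move=> z w0; have [b pb] : exists b, psi 0 b != 0.
  by apply/existsP; apply: contraNT psi0; rewrite negb_exists => /forallP H;
     apply/eqP/rowP => b; rewrite mxE; apply/eqP; rewrite -[_ == _]negbK H.
pose u := (psi 0 b)^-1 *: solution_poly z psi b.
have E c : solution_poly z psi c = psi 0 c *: u.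
  apply/eqP; rewrite -subr_eq0; apply/eqP; apply: (ode_uniq w0 (tau := shifted_tau z h)).
  - by rewrite coefB !coefZ !coef_solution_poly solution_mx0 mulmx0 !mxE !mulr0 subrr.
  - rewrite coefB !coefZ !coef_solution_poly solution_mx1 mul_mx_scalar !mxE.
    by rewrite (mulrC (_^-1)) mulfK // mulrC subrr.
  - by rewrite odeB !odeZ !(solution_poly_ode t0 x_inj psi_eigen) !scaler0 subrr.
have [ts tt] := tau_top t0; have [ws wm] := size_prod_addXC z predT.
have ode0 : ode (shifted_roots z) (shifted_tau z h) u = 0.
  by rewrite odeZ (solution_poly_ode t0 x_inj psi_eigen) scaler0.
exists u; split => //.
- by apply: (@ode_size _ m (shifted_roots z) _ u) ode0; rewrite // /shifted_roots ws cardT size_enum_ord nm.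
- by rewrite coefZ coef_solution_poly solution_mx0 mulmx0 mxE mulr0.
- by rewrite coefZ coef_solution_poly solution_mx1 mul_mx_scalar mxE mulrC mulfK.
- by move=> k; apply/rowP => c; rewrite -coef_solution_poly E coefZ mxE mulrC.
Qed.

End Solution.
End Singular.

(** * Wronskians of solutions *)

Section Wronskian.
Variable R : numFieldType.
Implicit Types p q w tau f g y : {poly R}.

Definition wronskian p q := p * q^`() - p^`() * q.

(** Abel's identity. *)
Lemma wronskian_ode w tau f g : ode w tau f = 0 -> ode w tau g = 0 ->
  w * (wronskian f g)^`() = w^`() * wronskian f g.
Proof.
move=> Ef Eg; apply/eqP; rewrite -subr_eq0; apply/eqP.
transitivity (f * ode w tau g - g * ode w tau f); last by rewrite Ef Eg !mulr0 subrr.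
by rewrite /ode /wronskian derivB !derivM; ring.
Qed.

(** The multiplicity of a root t of y would have to be 0, as the lowest term of
    w y' - w' y at t shows. *)
Lemma linear_ode_uniq w y t : w.[t] != 0 -> w * y^`() = w^`() * y -> y.[t] = 0 -> y = 0.
Proof.
move=> wt E yt; apply/eqP; apply/negPn; apply/negP => y0.
have [[|k] [q qt Ey]] := multiplicity_XsubC y t.
  by move: qt yt; rewrite y0 Ey expr0 mulr1 /= /root => /negP h /eqP.
move: qt; rewrite y0 /= => qt.
have : w * (q *+ k.+1 + q^`() * ('X - t%:P)) = w^`() * q * ('X - t%:P).
  have X0 : ('X - t%:P) ^+ k != 0 by rewrite expf_neq0 // polyXsubC_eq0.
  apply: (mulIf X0); move: E; rewrite Ey derivM deriv_exp derivXsubC mul1r /= exprS.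
  by rewrite -[q *+ _]mulr_natr -[_ ^+ k *+ _]mulr_natr => E; transitivity (w^`() * (q * (('X - t%:P) * ('X - t%:P) ^+ k))); [rewrite -E|]; ring.
move=> /(congr1 (fun p => p.[t])); rewrite !hornerM hornerD hornerMn hornerM hornerXsubC subrr !mulr0 addr0.
by move/eqP; rewrite mulf_eq0 (negPf wt) mulrn_eq0 /= => qt0; rewrite /root qt0 in qt.
Qed.

End Wronskian.

Section Absolute.
Variables (R : realFieldType) (m : nat).
Local Notation n := (2 * m)%N.
Local Notation N := #|{set 'I_n}|.
Implicit Types (x h : 'I_n -> R) (psi : 'rV[R]_N) (t : R).

Definition roots_poly x : {poly R} := \prod_i ('X - (x i)%:P).
Definition tau_poly x h : {poly R} := \sum_i h i *: \prod_(k | k != i) ('X - (x k)%:P).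
Definition based_poly t (a : 'rV[R]_m.+1) : {poly R} := \sum_j a 0 j *: ('X - t%:P) ^+ j.+1.
Definition based_mx x t (j : 'I_m.+1) : 'M[R]_N := solution_mx (fun i => t - x i) j.+1.

Lemma comp_shift x t (Q : pred 'I_n) :
  (\prod_(k | Q k) ('X + (t - x k)%:P)) \Po ('X - t%:P) = \prod_(k | Q k) ('X - (x k)%:P).
Proof.
rewrite rmorph_prod /=; apply: eq_bigr => k _.
by rewrite comp_polyD comp_polyX comp_polyC polyCB addrA subrK.
Qed.

Lemma deriv_shift p t : (p \Po ('X - t%:P))^`() = p^`() \Po ('X - t%:P) :> {poly R}.
Proof. by rewrite deriv_comp derivXsubC mulr1. Qed.

Lemma shifted_roots0 x t : (shifted_roots (fun i => t - x i))`_0 = (roots_poly x).[t].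
Proof.
rewrite -horner_coef0 /shifted_roots /roots_poly !horner_prod; apply: eq_bigr => i _.
by rewrite hornerD hornerX hornerC add0r hornerXsubC.
Qed.

Lemma eigen_based_poly x h psi t : (0 < m)%N -> injective x ->
  (forall i, psi *m gaudin x i = h i *: psi) -> singular m psi -> psi != 0 -> (roots_poly x).[t] != 0 ->
  exists a : 'rV[R]_m.+1, [/\ forall j, psi *m based_mx x t j = a 0 j *: psi,
    ode (roots_poly x) (tau_poly x h) (based_poly t a) = 0 & a 0 ord0 = (roots_poly x).[t]].
Proof.
move=> m0 xi eig sing psi0 wt; pose z i := t - x i.
have [] := @eigen_solution R n m erefl m0 x h psi xi eig sing psi0 t; rewrite shifted_roots0 // => u [su u0 u1 ou uc].
exists (\row_j u`_j.+1); split; first by move=> j; rewrite /based_mx uc [in RHS]mxE.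
  have -> : based_poly t (\row_j u`_j.+1) = u \Po ('X - t%:P).
    have eu : u = \poly_(i < m.+2) u`_i.
      apply/polyP => i; rewrite coef_poly; case: ltnP => // mi.
      by rewrite nth_default // (leq_trans su).
    rewrite [in RHS]eu poly_def raddf_sum big_ord_recl /= u0 scale0r comp_poly0 add0r.
    apply: eq_bigr => j _; rewrite mxE linearZ /= rmorphXn /= comp_polyX.
    by rewrite /bump /= add1n.
  rewrite /ode !deriv_shift.
  have -> : roots_poly x = shifted_roots z \Po ('X - t%:P) by rewrite comp_shift.
  have -> : tau_poly x h = shifted_tau z h \Po ('X - t%:P).
    by rewrite raddf_sum; apply: eq_bigr => i _ /=; rewrite linearZ /= comp_shift.
  by rewrite deriv_shift -!rmorphM -rmorphB -rmorphD -/(ode _ _ _) ou rmorph0.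
by rewrite mxE.
Qed.

Lemma based_poly_at t a : (based_poly t a).[t] = 0.
Proof.
rewrite horner_sum big1 // => j _.
by rewrite hornerZ horner_exp hornerXsubC subrr expr0n mulr0.
Qed.

Lemma deriv_based_poly_at t a : (based_poly t a)^`().[t] = a 0 ord0.
Proof.
rewrite raddf_sum horner_sum big_ord_recl big1 ?addr0 => [|j _].
  by rewrite /= expr1 derivZ derivXsubC hornerZ hornerC mulr1.
rewrite /= derivZ deriv_exp derivXsubC mul1r hornerZ hornerMn horner_exp hornerXsubC subrr.
by rewrite expr0n mul0rn mulr0.
Qed.

(** By Abel's identity the Wronskian is a multiple of w, and the factor can be
    read at t1, where the second solution vanishes. *)
Lemma wronskian_based_poly x h t0 t1 a b : (roots_poly x).[t1] != 0 ->
  ode (roots_poly x) (tau_poly x h) (based_poly t0 a) = 0 -> ode (roots_poly x) (tau_poly x h) (based_poly t1 b) = 0 ->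
  b 0 ord0 = (roots_poly x).[t1] ->
  wronskian (based_poly t0 a) (based_poly t1 b) = (based_poly t0 a).[t1] *: roots_poly x.
Proof.
move=> wt of_ og b0; apply/eqP; rewrite -subr_eq0; apply/eqP.
apply: (linear_ode_uniq wt).
  by rewrite derivB derivZ mulrBr (wronskian_ode of_ og) [in RHS]mulrBr -!scalerAr [roots_poly x * _]mulrC.
by rewrite !hornerE based_poly_at deriv_based_poly_at b0 mulr0 subr0 subrr.
Qed.

(** One nonzero solution determines tau, and h i is proportional to tau at x i. *)
Lemma tau_poly_inj x h h' f : injective x -> f != 0 ->
  ode (roots_poly x) (tau_poly x h) f = 0 -> ode (roots_poly x) (tau_poly x h') f = 0 -> forall i, h i = h' i.
Proof.
move=> xi f0 E E' i.
have {E E'} E : tau_poly x h = tau_poly x h'.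
  by apply: (mulIf f0); apply: (addrI (roots_poly x * f^`()^`() - (roots_poly x)^`() * f^`())); rewrite -/(ode _ _ _) E -/(ode _ _ _) E'.
have ev g : (tau_poly x g).[x i] = g i * \prod_(k | k != i) (x i - x k).
  rewrite horner_sum (bigD1 i) //= [X in _ + X]big1 ?addr0 => [|k ki].
    by rewrite hornerZ horner_prod; congr (_ * _); apply: eq_bigr => k _; rewrite hornerXsubC.
  by rewrite hornerZ horner_prod (bigD1 i) 1?eq_sym //= hornerXsubC subrr mul0r mulr0.
have p0 : \prod_(k | k != i) (x i - x k) != 0.
  by apply/prodf_neq0 => k ki; rewrite subr_eq0; apply: contraNneq ki => /xi ->.
by apply: (mulIf p0); rewrite -!ev E.
Qed.

End Absolute.

(** * Local injectivity of a bilinear map *)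

Section Norm1.
Variable R : realFieldType.

Definition norm1 n (v : 'rV[R]_n) : R := \sum_j `|v 0 j|.

Lemma norm1_ge0 n (v : 'rV[R]_n) : 0 <= norm1 v.
Proof. exact: sumr_ge0. Qed.

Lemma norm1_eq0 n (v : 'rV[R]_n) : norm1 v <= 0 -> v = 0.
Proof.
move=> h; have /eqP : norm1 v = 0 by apply/eqP; rewrite eq_le h norm1_ge0.
rewrite psumr_eq0 // => /allP H; apply/rowP => j; rewrite mxE; apply/eqP.
by have := H j (mem_index_enum _); rewrite /= normr_eq0.
Qed.

Lemma norm1D n (u v : 'rV[R]_n) : norm1 (u + v) <= norm1 u + norm1 v.
Proof. by rewrite /norm1 -big_split ler_sum // => j _; rewrite mxE ler_normD. Qed.

Lemma norm1N n (v : 'rV[R]_n) : norm1 (- v) = norm1 v.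
Proof. by apply: eq_bigr => j _; rewrite mxE normrN. Qed.

Lemma norm1Z n c (v : 'rV[R]_n) : norm1 (c *: v) = `|c| * norm1 v.
Proof. by rewrite mulr_sumr; apply: eq_bigr => j _; rewrite mxE normrM. Qed.

Lemma norm1_coord n (v : 'rV[R]_n) j : `|v 0 j| <= norm1 v.
Proof. by rewrite /norm1 (bigD1 j) //= lerDl sumr_ge0. Qed.

Lemma norm1_row_mx p q (u : 'rV[R]_p) (v : 'rV[R]_q) : norm1 (row_mx u v) = norm1 u + norm1 v.
Proof.
rewrite /norm1 big_split_ord /=; congr (_ + _); apply: eq_bigr => j _.
  by rewrite row_mxEl.
by rewrite row_mxEr.
Qed.

Lemma norm1_sum n (I : finType) (F : I -> 'rV[R]_n) : norm1 (\sum_i F i) <= \sum_i norm1 (F i).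
Proof.
elim/big_ind2: _ => [|u a v b ha hb|//]; last by apply: le_trans (norm1D _ _) (lerD ha hb).
by rewrite /norm1 big1 // => j _; rewrite mxE normr0.
Qed.

Definition mxnorm1 m n (A : 'M[R]_(m, n)) : R := \sum_i norm1 (row i A).

Lemma mxnorm1_ge0 m n (A : 'M[R]_(m, n)) : 0 <= mxnorm1 A.
Proof. by apply: sumr_ge0 => i _; apply: norm1_ge0. Qed.

Lemma norm1_mulmx m n (v : 'rV[R]_m) (A : 'M[R]_(m, n)) : norm1 (v *m A) <= norm1 v * mxnorm1 A.
Proof.
rewrite mulmx_sum_row; apply: le_trans (norm1_sum _) _; rewrite /mxnorm1 mulr_sumr ler_sum // => i _.
by rewrite norm1Z ler_wpM2r ?norm1_ge0 ?norm1_coord.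
Qed.

Section Bilinear.
Variables (p q r : nat) (Bm : 'I_p -> 'M[R]_(q, r)).

Definition bil (a : 'rV[R]_p) (b : 'rV[R]_q) : 'rV[R]_r := \sum_i a 0 i *: (b *m Bm i).

Lemma bilDl a a' b : bil (a + a') b = bil a b + bil a' b.
Proof. by rewrite /bil -big_split; apply: eq_bigr => i _; rewrite mxE scalerDl. Qed.
Lemma bilDr a b b' : bil a (b + b') = bil a b + bil a b'.
Proof. by rewrite /bil -big_split; apply: eq_bigr => i _; rewrite mulmxDl scalerDr. Qed.
Lemma bilNl a b : bil (- a) b = - bil a b.
Proof. by rewrite /bil -sumrN; apply: eq_bigr => i _; rewrite mxE scaleNr. Qed.
Lemma bilNr a b : bil a (- b) = - bil a b.
Proof. by rewrite /bil -sumrN; apply: eq_bigr => i _; rewrite mulNmx scalerN. Qed.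
Lemma bilZr c a b : bil a (c *: b) = c *: bil a b.
Proof.
by rewrite /bil scaler_sumr; apply: eq_bigr => i _; rewrite -scalemxAl !scalerA mulrC.
Qed.

Lemma bil_bound : exists2 K, 0 <= K & forall a b, norm1 (bil a b) <= K * (norm1 a * norm1 b).
Proof.
exists (\sum_i mxnorm1 (Bm i)) => [|a b]; first by apply: sumr_ge0 => i _; apply: mxnorm1_ge0.
apply: le_trans (norm1_sum _) _; rewrite mulr_suml ler_sum // => i _.
rewrite norm1Z; apply: le_trans (_ : norm1 a * (norm1 b * mxnorm1 (Bm i)) <= _); last by rewrite mulrA mulrC.
by rewrite ler_pM ?norm1_ge0 ?norm1_coord ?norm1_mulmx.
Qed.

Lemma small_eq0 (c K d : R) : 0 < d -> (forall s, 0 < s -> s <= d -> `|c| <= K * s) -> c = 0.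
Proof.
move=> d0 H; apply/eqP; rewrite -normr_le0 leNgt; apply/negP => c0.
have K0 : 0 < K by have := H d d0 (lexx _); rewrite -(pmulr_lgt0 _ d0); apply: lt_le_trans.
have := H (Num.min d (`|c| / (2 * K))); rewrite lt_min d0 divr_gt0 ?mulr_gt0 //= ge_min lexx.
move=> /(_ isT isT) h; have : K * (`|c| / (2 * K)) = `|c| / 2 by field; rewrite gt_eqF.
have : K * Num.min d (`|c| / (2 * K)) <= K * (`|c| / (2 * K)) by rewrite ler_pM2l // ge_min lexx orbT.
by lra.
Qed.

Variables (a0 : 'rV[R]_p) (b0 : 'rV[R]_q) (j0 : 'I_p) (I : finType) (dir : I -> 'rV[R]_r).
Hypothesis dims : (p + q)%N = r.+1.
Hypothesis a0j0 : a0 0 j0 != 0.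
Hypothesis span : forall l : 'cV[R]_r, bil a0 b0 *m l = 0 -> (forall i, dir i *m l = 0) -> l = 0.
Hypothesis curves : forall i, exists C d, 0 < d /\ forall s, 0 < s -> s <= d ->
  exists a b, [/\ norm1 (a - a0) <= C * s, norm1 (b - b0) <= C * s & bil a b = bil a0 b0 + s *: dir i].

Let D1 : 'M[R]_(p, r) := \matrix_i (b0 *m Bm i).
Let D2 : 'M[R]_(q, r) := \sum_i a0 0 i *: Bm i.
Let D := col_mx D1 D2.

Let D1E a : a *m D1 = bil a b0.
Proof. by rewrite mulmx_sum_row; apply: eq_bigr => i _; rewrite rowK. Qed.
Let D2E b : b *m D2 = bil a0 b.
Proof. by rewrite mulmx_sumr; apply: eq_bigr => i _; rewrite -scalemxAr. Qed.
Let DE a b : row_mx a b *m D = bil a b0 + bil a0 b.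
Proof. by rewrite mul_row_col D1E D2E. Qed.

(** The differential of bil at (a0, b0) is onto.  A linear form l that kills its
    image vanishes to second order along the curves, whereas it grows linearly in
    s unless it kills dir i; and it kills bil a0 b0, which is half of the image of
    (a0, b0) itself. *)
Lemma bil_full : row_full D.
Proof.
rewrite -cokermx_eq0; apply/eqP/matrixP => i j; rewrite [RHS]mxE.
suff /(congr1 (fun l : 'cV_r => l i 0)) : col j (cokermx D) = 0 by rewrite !mxE.
set l := col j _; have Dl : D *m l = 0 by rewrite /l colE mulmxA mulmx_coker mul0mx.
have [D1l D2l] : D1 *m l = 0 /\ D2 *m l = 0.
  by move: Dl; rewrite mul_col_mx -col_mx0 => /eq_col_mx.
apply: span => [|k]; first by rewrite -D1E -mulmxA D1l mulmx0.
have [C [d [d0 H]]] := curves k; have [K K0 HK] := bil_bound.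
apply/matrixP => u v; rewrite !ord1 [RHS]mxE.
apply: (@small_eq0 _ (K * (C * C) * mxnorm1 l) d) => // s s0 sd.
have [a [b [ha hb Eab]]] := H s s0 sd.
have : s *: (dir k *m l) = bil (a - a0) (b - b0) *m l.
  have -> : bil (a - a0) (b - b0) = s *: dir k - bil (a - a0) b0 - bil a0 (b - b0).
    rewrite !(bilDl, bilDr, bilNl, bilNr) Eab.
    by apply/rowP => z; rewrite !mxE; ring.
  by rewrite !mulmxBl -D1E -D2E -!mulmxA D1l D2l !mulmx0 !subr0 scalemxAl.
move=> E; have h1 : `|(s *: (dir k *m l)) 0 0| <= K * (C * s * (C * s)) * mxnorm1 l.
  rewrite E; apply: le_trans (norm1_coord _ _) _; apply: le_trans (norm1_mulmx _ _) _.
  rewrite ler_wpM2r ?mxnorm1_ge0 //; apply: le_trans (HK _ _) _.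
  by rewrite ler_wpM2l // ler_pM ?norm1_ge0.
rewrite mxE normrM gtr0_norm // in h1.
rewrite -(ler_pM2l s0); apply: le_trans h1 _; rewrite le_eqVlt; apply/orP; left; apply/eqP; ring.
Qed.

Let E := row_mx D (col_mx (delta_mx j0 0) 0 : 'cV[R]_(p + q)).

(** By bil_full and the dimensions the kernel of the differential is the line
    spanned by (a0, - b0), on which the coordinate j0 of a is injective. *)
Lemma bil_free : row_free E.
Proof.
rewrite -kermx_eq0; apply/rowV0P => v /sub_kermxP; rewrite /E mul_mx_row -row_mx0 => /eq_row_mx[vD vj].
pose k := row_mx a0 (- b0).
have kD : (k <= kermx D)%MS by apply/sub_kermxP; rewrite /k DE bilNr subrr.
have k0 : k != 0.
  apply: contraNneq a0j0 => /(congr1 (fun u : 'rV_(p+q) => u 0 (lshift q j0))).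
  by rewrite row_mxEl mxE => ->.
have rk : \rank (kermx D) = 1%N by rewrite mxrank_ker (eqP bil_full) dims subSnn.
have : (kermx D <= k)%MS.
  by rewrite -(geq_leqif (mxrank_leqif_sup kD)) rk lt0n mxrank_eq0.
move: vD => /sub_kermxP vD /(submx_trans vD) /sub_rVP[c vk].
have : c * a0 0 j0 = 0.
  have := congr1 (fun u : 'M_1 => u 0 0) vj; rewrite vk /k scale_row_mx mul_row_col mulmx0 addr0.
  by rewrite -scalemxAl -colE !mxE.
by move/eqP; rewrite mulf_eq0 (negPf a0j0) orbF vk => /eqP->; rewrite scale0r.
Qed.

(** Near (a0, b0) the map is a small perturbation of its differential, which is
    injective once the coordinate j0 is fixed. *)
Lemma bil_isolated : exists2 rho, 0 < rho & forall a b a' b',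
  norm1 (a - a0) <= rho -> norm1 (b - b0) <= rho -> norm1 (a' - a0) <= rho -> norm1 (b' - b0) <= rho ->
  bil a b = bil a' b' -> a 0 j0 = a' 0 j0 -> a = a'.
Proof.
have /row_freeP[F EF] := bil_free; have [K K0 HK] := bil_bound.
pose L := mxnorm1 F * K; have L0 : 0 <= L by rewrite mulr_ge0 ?mxnorm1_ge0.
have L1 : 0 < L + 1 by lra.
exists (L + 1)^-1 => [|a b a' b' ha hb ha' hb' EB ej]; first by rewrite invr_gt0.
pose u := a' - a; pose v := b' - b.
have Z : row_mx u v *m E = row_mx (- bil u (b' - b0) - bil (a - a0) v) 0.
  rewrite mul_mx_row DE; congr row_mx.
    have : bil u b' + bil a v = 0.
      by rewrite /u /v !(bilDl, bilDr, bilNl, bilNr) EB; apply/rowP => z; rewrite !mxE; ring.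
    rewrite !(bilDl, bilDr, bilNl, bilNr) => e.
    by apply/rowP => z; have := congr1 (fun w : 'rV_r => w 0 z) e; rewrite !mxE => h; lra.
  rewrite mul_row_col mulmx0 addr0 -colE; apply/rowP => z.
  by rewrite ord1 !mxE ej subrr.
have N1 : norm1 (row_mx u v) <= L * (L + 1)^-1 * norm1 (row_mx u v).
  rewrite -{1}[row_mx u v]mulmx1 -EF mulmxA Z.
  apply: le_trans (norm1_mulmx _ _) _; rewrite norm1_row_mx.
  have -> : norm1 (0 : 'rV[R]_1) = 0 by rewrite /norm1 big1 // => ? _; rewrite mxE normr0.
  rewrite addr0 mulrC /L -!mulrA ler_wpM2l ?mxnorm1_ge0 //.
  apply: le_trans (norm1D _ _) _; rewrite !norm1N norm1_row_mx.
  apply: le_trans (lerD (HK _ _) (HK _ _)) _; rewrite -mulrDr ler_wpM2l // mulrDr [X in X + _]mulrC.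
  by rewrite lerD // ler_wpM2r ?norm1_ge0.
have [x0] : row_mx u v = 0.
  apply: norm1_eq0; have x1 : L * (L + 1)^-1 < 1 by rewrite ltr_pdivrMr //; lra.
  have := norm1_ge0 (row_mx u v); nra.
move: x0; rewrite -row_mx0 => /eq_row_mx[u0 _].
by apply/eqP; rewrite eq_sym -subr_eq0; apply/eqP.
Qed.

End Bilinear.
End Norm1.

(** * Joint spectrum of the Jucys-Murphy elements *)

Section JM.
Variables (R : realFieldType) (n : nat).
Local Notation T := {set 'I_n}.
Local Notation N := #|{set 'I_n}|.
Local Notation swap_mx := (@swap_mx R n).

(** On functions on the mu-element subsets of K, let E erase an element and F be
    its adjoint.  Then E F - F E = |K| - 2 mu, so a function f with E f = 0
    satisfies |F f|^2 = (|K| - 2 mu) |f|^2. *)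
Lemma lowering_inj (K : T) (mu : nat) (f : T -> R) :
  (forall S, f S != 0 -> (S \subset K) /\ #|S| = mu) ->
  (forall S, \sum_(i in K :\: S) f (i |: S) = 0) ->
  (#|K| < 2 * mu)%N -> forall S, f S = 0.
Proof.
move=> supp low km.
pose g (U : T) := \sum_(i in U | i \in K) f (U :\ i).
have E S : f S * (\sum_(i in K :\: S) g (i |: S)) = (#|K|%:R - 2 * mu%:R) * (f S * f S).
  case: (eqVneq (f S) 0) => [->|/supp[SK cS]]; first by rewrite !mul0r mulr0.
  suff -> : \sum_(i in K :\: S) g (i |: S) = (#|K|%:R - 2 * mu%:R) * f S by ring.
  have -> : \sum_(i in K :\: S) g (i |: S) =
      \sum_(i in K :\: S) (f S + \sum_(j in S) f (i |: (S :\ j))).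
    apply: eq_bigr => i; rewrite inE => /andP[iS iK].
    rewrite /g (bigD1 i) ?setU11 //= setU1K //; congr (_ + _); apply: eq_big => [j|j].
      rewrite !inE; case: (eqVneq j i) => [->|_] /=; first by rewrite andbF (negPf iS).
      by rewrite andbT andb_idr // => jS; apply: (subsetP SK).
    move=> /andP[/andP[_ _] ji]; congr f; apply/setP => k; rewrite !inE.
    by case: (eqVneq k i) => [->|] //=; rewrite eq_sym ji.
  rewrite big_split /= sumr_const exchange_big /=.
  rewrite (eq_bigr (fun=> - f S)) => [|j jS].
    rewrite sumr_const mulNrn -[f S *+ _]mulr_natl -[f S *+ #|S|]mulr_natl cS.
    have := cardsD K S; rewrite (setIidPr SK) cS => ->.
    by rewrite natrB -?cS ?subset_leq_card //; ring.
  have jK := subsetP SK _ jS.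
  have := low (S :\ j); rewrite (bigD1 j) ?inE ?eqxx ?jK //= setD1K // => /eqP.
  rewrite addrC addr_eq0 => /eqP <-; apply: eq_bigl => i; rewrite !inE.
  by case: (eqVneq i j) => [->|_] /=; rewrite ?jS ?andbT ?andbF.
have Q : \sum_U g U * g U = (#|K|%:R - 2 * mu%:R) * \sum_S f S * f S.
  rewrite mulr_sumr; under [RHS]eq_bigr => S _ do rewrite -E mulr_sumr.
  rewrite (eq_bigr (fun U : T => \sum_(i in U | i \in K) f (U :\ i) * g U)) => [|U _]; last first.
    by rewrite -mulr_suml.
  rewrite (exchange_big_dep (mem K)) /= => [|U i _ /andP[] //].
  rewrite [RHS](exchange_big_dep (mem K)) /= => [|U i _]; last by rewrite inE => /andP[].
  apply: eq_bigr => i iK.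
  rewrite (eq_bigl (fun U : T => i \in U)) => [|U]; last by rewrite iK andbT.
  rewrite big_set_in_add /=; apply: eq_big => [S|S iS]; first by rewrite inE iK andbT.
  by rewrite setU1K.
have F0 : 0 <= \sum_S f S * f S by apply: sumr_ge0 => S _; rewrite -expr2 sqr_ge0.
have Q0 : 0 <= \sum_U g U * g U by apply: sumr_ge0 => S _; rewrite -expr2 sqr_ge0.
have neg : #|K|%:R - 2 * mu%:R <= -1 :> R.
  by move: km; rewrite -(ler_nat R) -natr1 natrM; lra.
have {F0 Q0 Q neg} : \sum_S f S * f S = 0 by rewrite Q in Q0; nra.
move/eqP; rewrite psumr_eq0 => [/allP H S|S _]; last by rewrite -expr2 sqr_ge0.
by have := H S (mem_index_enum _); rewrite /= mulf_eq0 orbb => /eqP.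
Qed.

Lemma casimir_weights_neq (a q : nat) : (0 < a)%N -> (2 * a <= q)%N ->
  (a.-1 * (q - a.-1).+1)%N <> (a * (q - a).+1)%N.
Proof.
case: a => // a _ /subnK <-; move: (q - _)%N => r /=.
rewrite (_ : r + 2 * a.+1 - a = r + a + 2)%N; last lia.
by rewrite (_ : r + 2 * a.+1 - a.+1 = r + a + 1)%N; [nia | lia].
Qed.

(** The Jucys-Murphy element of i, subtracted from the number of j < i. *)
Definition jucys_murphy (i : 'I_n) : 'M[R]_N := \sum_(j : 'I_n | (j < i)%N) (1%:M - swap_mx i j).

Section MultFree.
Variables (m : nat) (kappa : 'I_n -> R).
Let E (v : 'rV[R]_N) := singular m v /\ forall i, v *m jucys_murphy i = kappa i *: v.
Let lv (k : nat) : T := [set i : 'I_n | (i < k)%N].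

Let lvS (i : 'I_n) : lv i.+1 = i |: lv i.
Proof. by apply/setP => j; rewrite !inE ltnS leq_eqVlt. Qed.

Let card_lv k : (k <= n)%N -> #|lv k| = k.
Proof.
elim: k => [|k IH] kn; first by apply: eq_card0 => i; rewrite inE.
by rewrite (lvS (Ordinal kn)) cardsU1 inE ltnn IH // ltnW.
Qed.

(** The Casimir operator of the first k places is twice the sum of the first k of
    the operators jucys_murphy i. *)
Lemma jucys_murphy_casimir v k S : (forall i, v *m jucys_murphy i = kappa i *: v) ->
  \sum_(i in lv k) \sum_(j in lv k) (setcoord v S - setcoord v (tperm i j @: S)) =
  2 * (\sum_(i in lv k) kappa i) * setcoord v S.
Proof.
move=> Ev; pose f (i j : 'I_n) := setcoord v S - setcoord v (tperm i j @: S).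
have fC i j : f i j = f j i by rewrite /f tpermC.
have E1 (i : 'I_n) : \sum_(j : 'I_n | (j < i)%N) f i j = kappa i * setcoord v S.
  have := congr1 (fun u : 'rV_N => setcoord u S) (Ev i); rewrite [X in _ = X]mxE -/(setcoord v S) => <-.
  rewrite /jucys_murphy mulmx_sumr {1}/setcoord summxE; apply: eq_bigr => j _.
  by rewrite /f -setcoord_swap /setcoord mulmxBr mulmx1 !mxE.
rewrite -mulrA mulr_suml.
have E2 : \sum_(i in lv k) kappa i * setcoord v S = \sum_(i in lv k) \sum_(j in lv k | (j < i)%N) f i j.
  apply: eq_bigr => i; rewrite inE => ik; rewrite -E1; apply: eq_bigl => j; rewrite inE.
  by case: ltnP => [ji|_]; rewrite ?andbF // (ltn_trans ji ik).
have E3 : \sum_(i in lv k) kappa i * setcoord v S = \sum_(i in lv k) \sum_(j in lv k | (i < j)%N) f i j.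
  rewrite E2 (exchange_big_dep (mem (lv k))) /= => [|i j _ /andP[]//].
  apply: eq_bigr => i ik; apply: eq_big => [j|j _]; last exact: fC.
  by rewrite (_ : i \in lv k).
rewrite -[2]/(1 + 1) mulrDl mul1r {1}E2 E3 -big_split /=; apply: eq_bigr => i ik.
rewrite (bigID (fun j : 'I_n => (j < i)%N)) /=; congr (_ + _).
rewrite (bigID (fun j : 'I_n => (i < j)%N)) /= [X in _ + X]big1 ?addr0 => [|j].
  by apply: eq_bigl => j; rewrite -andbA; congr (_ && _); lia.
move=> h; have -> : i = j by apply: val_inj => /=; lia.
by rewrite tperm1 (_ : _ @: S = S) ?subrr // -[RHS]imset_id; apply: eq_imset => u; rewrite perm1.
Qed.

(** The joint eigenspaces have dimension at most one: a coordinate is injective on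
    each of them.  The subset T0 is found by removing the places q = n - 1, ..., 0
    one by one.  At each step the vectors of the eigenspace, restricted to subsets
    of the first q places and completed by T0, stay singular of some weight mk and
    determine the vector.  Either all of them vanish on the sets that contain q,
    or q is added to T0.  In the second case a vector that vanishes on all sets
    containing q would be singular of weight mk on the first q places, another one
    of weight mk - 1, and the two eigenvalues of the Casimir operator differ
    since 2 mk <= q by lowering_inj. *)
Lemma jucys_murphy_functional : exists T0 : T, forall v, E v -> setcoord v T0 = 0 -> v = 0.
Proof.
pose inv (k : nat) (T0 : T) (mk : nat) := [/\ [disjoint T0 & lv k],
  forall v (S : T), E v -> S \subset lv k -> #|S| != mk -> setcoord v (S :|: T0) = 0,
  forall v (S : T), E v -> S \subset lv k -> \sum_(i in lv k :\: S) setcoord v (i |: (S :|: T0)) = 0 &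
  forall v, E v -> (forall S : T, S \subset lv k -> setcoord v (S :|: T0) = 0) -> v = 0].
have casi k (T0 : T) mk v (S : T) : (k <= n)%N -> [disjoint T0 & lv k] ->
    (forall S : T, S \subset lv k -> #|S| != mk -> setcoord v (S :|: T0) = 0) ->
    (forall S : T, S \subset lv k -> \sum_(i in lv k :\: S) setcoord v (i |: (S :|: T0)) = 0) ->
    E v -> S \subset lv k -> setcoord v (S :|: T0) != 0 ->
    #|S| = mk /\ \sum_(i in lv k) kappa i = (mk * (k - mk).+1)%:R.
  move=> kn dis supp low Ev Sk vS.
  have cS : #|S| = mk by apply/eqP; apply: contraNT vS => h; rewrite supp.
  split=> //; have := jucys_murphy_casimir k (S :|: T0) Ev.2.
  have ST : (S :|: T0) :&: lv k = S.
    by rewrite setIUl (setIidPl Sk) (disjoint_setI0 dis) setU0.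
  rewrite casimir_local => [|i].
    rewrite ST setDUr (setDidPl _ : lv k :\: T0 = lv k) 1?disjoint_sym //.
    rewrite (setIidPl (subsetDl _ _)) cardsD (setIidPr Sk) card_lv // cS.
    move=> H; apply: (mulfI (_ : 2 != 0 :> R)); first by rewrite pnatr_eq0.
    by apply: (mulIf vS); rewrite -H natrM.
  rewrite ST => iS; have ik := subsetP Sk _ iS.
  have iT : i \notin T0 by apply/negP => iT; have := disjointFr dis iT; rewrite ik.
  have -> : (S :|: T0) :\ i = (S :\ i) :|: T0.
    apply/setP => j; rewrite !inE; case: (eqVneq j i) => [->|] //=; by rewrite (negPf iT).
  rewrite -[RHS](low (S :\ i)) ?(subset_trans (subsetDl _ _)) //.
  apply: eq_bigl => j; rewrite !inE; case: (boolP (j \in T0)) => jT; last by rewrite orbF.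
  have := disjointFr dis jT; rewrite inE => ->; by rewrite !andbF.
suff H k : (k <= n)%N -> exists T0 mk, inv (n - k)%N T0 mk.
  have [T0 [mk [_ _ _ H0]]] := H n (leqnn n).
  exists T0 => v Ev v0; apply: H0 => // S; rewrite subnn => Sk.
  suff -> : S = set0 by rewrite set0U.
  by apply/eqP; rewrite -subset0; apply: subset_trans Sk _; apply/subsetP => i; rewrite inE.
elim: k => [|k IH] kn.
  exists set0, m; rewrite subn0; have lvT : lv n = setT by apply/setP => i; rewrite !inE ltn_ord.
  rewrite /inv lvT; split; first by rewrite -setI_eq0 set0I.
  - by move=> v S [[supp _] _] _ cS; rewrite setU0 supp.
  - by move=> v S [[_ low] _] _; rewrite setU0 setTD low.
  - move=> v [[_ _] _] H; apply: setcoord_inj => S.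
    by have := H S (subsetT _); rewrite setU0 => ->; rewrite /setcoord mxE.
have [T0 [mk Hinv]] := IH (ltnW kn).
have [q nk] : exists q : 'I_n, (n - k)%N = q.+1.
  have h : (n - k.+1 < n)%N by lia.
  by exists (Ordinal h) => /=; lia.
have -> : (n - k.+1)%N = q by lia.
rewrite nk in Hinv; have [dis supp low inj] := Hinv; rewrite lvS in dis supp low inj.
have qlv : q \notin lv q by rewrite inE ltnn.
have qT : q \notin T0 by apply/negP => h; have := disjointFr dis h; rewrite setU11.
have subU (S : T) : S \subset lv q -> S \subset q |: lv q.
  by move=> h; apply: subset_trans h (subsetU1 _ _).
have swapU S : S :|: (q |: T0) = (q |: S) :|: T0 by rewrite setUCA setUA.
have lowq v (S : T) : E v -> S \subset lv q -> setcoord v (q |: (S :|: T0)) = 0 ->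
    \sum_(i in lv q :\: S) setcoord v (i |: (S :|: T0)) = 0.
  move=> Ev Sq vq; rewrite -[RHS](low v S Ev (subU S Sq)) [RHS](bigD1 q) /=; last first.
    by rewrite !inE eqxx /= andbT; apply: contra qlv; apply: (subsetP Sq).
  rewrite vq add0r; apply: eq_bigl => i; rewrite !inE.
  by case: (eqVneq i q) => [->|_]; rewrite ?ltnn ?andbF ?andbT.
have disq : [disjoint T0 & lv q] by apply: disjointWr dis; exact: subsetU1.
have qn : (q <= n)%N by rewrite ltnW.
have [[v1 [S1 [Ev1 Sq1 vS1]]]|none] := boolp.pselect (exists v (S : T), [/\ E v, S \subset lv q & setcoord v (S :|: (q |: T0)) != 0]); last first.
  have none' v (S : T) : E v -> S \subset lv q -> setcoord v (S :|: (q |: T0)) = 0.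
    by move=> Ev Sq; apply/eqP/negPn/negP => h; apply: none; exists v, S.
  exists T0, mk; split=> //.
  - by move=> v S Ev /subU; apply: supp.
  - by move=> v S Ev Sq; apply: lowq => //; rewrite setUA -swapU none'.
  - move=> v Ev H; apply: inj => // S Sq; case: (boolP (q \in S)) => qS; last first.
      apply: H; apply/subsetP => i iS; have := subsetP Sq i iS; rewrite !inE.
      by case: (eqVneq i q) => [e|] //=; rewrite -e iS in qS.
    rewrite -(setD1K qS) -swapU none' //; apply/subsetP => i; rewrite !inE => /andP[iq iS].
    by have := subsetP Sq i iS; rewrite !inE (negPf iq).
have cqS (S : T) : S \subset lv q -> #|q |: S| = #|S|.+1.
  by move=> Sq; rewrite cardsU1 (_ : q \notin S) //; apply: contra qlv; apply: (subsetP Sq).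
have subqS (S : T) : S \subset lv q -> q |: S \subset q |: lv q by apply: setUS.
have mk1 : (0 < mk)%N /\ #|S1| = mk.-1.
  suff <- : #|q |: S1| = mk by rewrite cqS.
  by apply/eqP; apply: contraNT vS1 => h; rewrite swapU supp // subqS.
have dis' : [disjoint q |: T0 & lv q].
  by rewrite -setI_eq0 setIUl (disjoint_setI0 disq) setU0 setI_eq0 disjoints1.
have supp' v (S : T) : E v -> S \subset lv q -> #|S| != mk.-1 -> setcoord v (S :|: (q |: T0)) = 0.
  move=> Ev Sq cS; rewrite swapU supp ?subqS // cqS //; apply: contraNneq cS => <-.
  by [].
have low' v (S : T) : E v -> S \subset lv q -> \sum_(i in lv q :\: S) setcoord v (i |: (S :|: (q |: T0))) = 0.
  move=> Ev Sq; rewrite -[RHS](low v (q |: S) Ev (subqS _ Sq)); apply: eq_big => [i|i _]; last by rewrite swapU.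
  rewrite !inE; case: (eqVneq i q) => [->|_] //=; by rewrite ltnn andbF.
exists (q |: T0), mk.-1; split=> // v Ev H.
apply: inj => // S Sq; case: (boolP (q \in S)) => qS.
  rewrite -(setD1K qS) -swapU H //; apply/subsetP => i; rewrite !inE => /andP[iq iS].
  by have := subsetP Sq i iS; rewrite !inE (negPf iq).
have {}Sq : S \subset lv q.
  apply/subsetP => i iS; have := subsetP Sq i iS; rewrite !inE.
  by case: (eqVneq i q) => [e|] //=; rewrite -e iS in qS.
apply/eqP/negPn/negP => vS.
have suppq (S' : T) : S' \subset lv q -> #|S'| != mk -> setcoord v (S' :|: T0) = 0.
  by move=> h; apply: supp => //; apply: subU.
have lowq' (S' : T) : S' \subset lv q -> \sum_(i in lv q :\: S') setcoord v (i |: (S' :|: T0)) = 0.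
  by move=> h; apply: lowq => //; rewrite setUA -swapU H.
have [cS c1] := casi q T0 mk v S qn disq suppq lowq' Ev Sq vS.
have [_ c2] := casi q _ _ v1 S1 qn dis' (supp' v1 ^~ Ev1) (low' v1 ^~ Ev1) Ev1 Sq1 vS1.
have q2 : (2 * mk <= q)%N.
  rewrite leqNgt; apply/negP => lt.
  pose f (S' : T) := if S' \subset lv q then setcoord v (S' :|: T0) else 0.
  have := @lowering_inj (lv q) mk f _ _ _ S; rewrite /f Sq card_lv // => f0.
  move/eqP: vS; apply; apply: f0 => // [S'|S'].
    case: ifP => [Sq'|_]; last by rewrite eqxx.
    by move=> h; split=> //; apply/eqP; apply: contraNT h => h; rewrite suppq.
  case: (boolP (S' \subset lv q)) => Sq'.
    rewrite -[RHS](lowq' S' Sq'); apply: eq_bigr => i; rewrite inE => /andP[_ iq].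
    by rewrite setUA subUset sub1set iq Sq'.
  by rewrite big1 // => i _; rewrite subUset (negPf Sq') andbF.
by move/eqP: c1; rewrite c2 eqr_nat => /eqP; apply: casimir_weights_neq; case: mk1.
Qed.
End MultFree.
End JM.

(** * Commutation relations and the number of singular vectors *)

Section Commute.
Variables (R : realFieldType) (n : nat).
Local Notation T := {set 'I_n}.
Local Notation N := #|{set 'I_n}|.
Local Notation swap_mx := (@swap_mx R n).

Definition exchange_mx (g : 'I_n -> 'I_n -> R) (i : 'I_n) : 'M[R]_N :=
  \sum_(j | j != i) g i j *: (1%:M - swap_mx i j).

Lemma tr_exchange_mx g i : (exchange_mx g i)^T = exchange_mx g i.
Proof.
rewrite /exchange_mx linear_sum /=; apply: eq_bigr => j _.
by rewrite linearZ linearB /= trmx1 tr_swap_mx.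
Qed.

(** Conjugation of a transposition by another. *)
Lemma swap_mx_cycle (i j k : 'I_n) : k != i -> k != j -> swap_mx i j *m swap_mx j k = swap_mx k i *m swap_mx i j.
Proof.
move=> ki kj; rewrite (swap_mxC _ i j) (swap_mxC _ j k) /swap_mx (tperm_conj kj ki) !set_perm_mxM -!mulmxA.
by rewrite [X in _ = _ *m (_ *m X)]swap_mxK mulmx1.
Qed.

Lemma swap_mx_disjoint (i j k l : 'I_n) : i != k -> i != l -> j != k -> j != l -> swap_mx i j *m swap_mx k l = swap_mx k l *m swap_mx i j.
Proof.
move=> ik il jk jl; rewrite -!set_perm_mxM; congr set_perm_mx; apply/permP => x; rewrite !permM.
case: (tpermP i j x) => [->|->|/eqP xi /eqP xj].
- by rewrite [tperm k l j]tpermD 1?eq_sym // [tperm k l i]tpermD 1?eq_sym // tpermL.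
- by rewrite [tperm k l i]tpermD 1?eq_sym // [tperm k l j]tpermD 1?eq_sym // tpermR.
- case: (tpermP k l x) => [_|_|_ _]; rewrite [RHS]tpermD //.
  + by rewrite eq_sym.
  + by rewrite eq_sym.
Qed.

Let Q i j : 'M[R]_N := 1%:M - swap_mx i j.
Let br (A B : 'M[R]_N) := A *m B - B *m A.

Let brDl A B C : br (A + B) C = br A C + br B C.
Proof. by rewrite /br mulmxDl mulmxDr opprD addrACA. Qed.
Let brC A B : br A B = - br B A.
Proof. by rewrite /br opprB. Qed.
Let brDr A B C : br A (B + C) = br A B + br A C.
Proof. by rewrite brC brDl opprD -!brC. Qed.
Let brZl a A B : br (a *: A) B = a *: br A B.
Proof. by rewrite /br -scalemxAl -scalemxAr scalerBr. Qed.
Let brZr a A B : br A (a *: B) = a *: br A B.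
Proof. by rewrite brC brZl -scalerN -brC. Qed.
Let br_suml (K : pred 'I_n) F B : br (\sum_(k | K k) F k) B = \sum_(k | K k) br (F k) B.
Proof. by rewrite /br mulmx_suml mulmx_sumr sumrB. Qed.
Let br_sumr (K : pred 'I_n) F B : br B (\sum_(k | K k) F k) = \sum_(k | K k) br B (F k).
Proof. by rewrite brC br_suml -sumrN; apply: eq_bigr => k _; rewrite -brC. Qed.

Let brQ i j k l : br (Q i j) (Q k l) = br (swap_mx i j) (swap_mx k l).
Proof.
rewrite /br /Q !mulmxBl !mulmxBr !mulmx1 !mul1mx.
by apply/matrixP => a b; rewrite !mxE; ring.
Qed.

Lemma sum_add3 (V : nmodType) (I : finType) (K : pred I) (A B C : I -> V) :
  \sum_(k | K k) (A k + (B k + C k)) =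
  \sum_(k | K k) A k + (\sum_(k | K k) B k + \sum_(k | K k) C k).
Proof. by rewrite !big_split. Qed.

(** The commutator of exchange_mx g i and exchange_mx g j is a sum over the third
    index k of multiples of the difference of the two 3-cycles on i, j, k; the
    hypothesis is the vanishing of their coefficients (classical Yang-Baxter
    equation). *)
Lemma exchange_mx_comm (g : 'I_n -> 'I_n -> R) :
  (forall i j k, i != j -> i != k -> j != k ->
     g i j * g j k + g i k * g j i - g i k * g j k = 0) ->
  forall i j, exchange_mx g i *m exchange_mx g j = exchange_mx g j *m exchange_mx g i.
Proof.
move=> yb i j; case: (eqVneq i j) => [-> //|ij].
have ji : j != i by rewrite eq_sym.
apply/eqP; rewrite -subr_eq0; apply/eqP; rewrite -/(br _ _).
pose K := [pred k : 'I_n | (k != i) && (k != j)].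
have Ei : exchange_mx g i = g i j *: Q i j + \sum_(k | K k) g i k *: Q i k.
  by rewrite /exchange_mx (bigD1 j).
have Ej : exchange_mx g j = g j i *: Q i j + \sum_(k | K k) g j k *: Q j k.
  rewrite /exchange_mx (bigD1 i ij) (swap_mxC R j i); congr (_ + _); apply: eq_bigl => k.
  exact: andbC.
have t0 : br (Q i j) (Q i j) = 0 by rewrite /br subrr.
have t1 : br (Q i j) (\sum_(k | K k) g j k *: Q j k) = \sum_(k | K k) g j k *: br (swap_mx i j) (swap_mx j k).
  by rewrite br_sumr; apply: eq_bigr => k _; rewrite brZr brQ.
have t2 : br (\sum_(k | K k) g i k *: Q i k) (Q i j) = \sum_(k | K k) g i k *: br (swap_mx i k) (swap_mx i j).
  by rewrite br_suml; apply: eq_bigr => k _; rewrite brZl brQ.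
have t3 : br (\sum_(k | K k) g i k *: Q i k) (\sum_(k | K k) g j k *: Q j k) =
    \sum_(k | K k) (g i k * g j k) *: br (swap_mx i k) (swap_mx j k).
  rewrite br_suml; apply: eq_bigr => k /andP[ki kj]; rewrite br_sumr (bigD1 k) ?inE ?ki ?kj //=.
  rewrite big1 ?addr0 => [|l /andP[/andP[li lj] lk]]; first by rewrite brZl brZr brQ scalerA.
  by rewrite brZl brZr brQ /br swap_mx_disjoint ?subrr ?scaler0 // eq_sym.
rewrite Ei Ej !brDl !brDr !brZl !brZr t0 t1 t2 t3 !scaler0 add0r !scaler_sumr.
rewrite -sum_add3; apply: big1 => k /andP[ki kj].
have ik : i != k by rewrite eq_sym. have jk : j != k by rewrite eq_sym.
(* the six products of two of the three transpositions are the two 3-cycles *)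
have c1 : swap_mx i j *m swap_mx j k = swap_mx i k *m swap_mx i j by rewrite (swap_mx_cycle ki kj) (swap_mxC _ k i).
have c2 : swap_mx i j *m swap_mx j k = swap_mx j k *m swap_mx i k by rewrite (swap_mxC _ i k) (swap_mx_cycle ij ik).
have c3 : swap_mx j k *m swap_mx i j = swap_mx i j *m swap_mx i k.
  by have := swap_mx_cycle kj ki; rewrite (swap_mxC _ j i) (swap_mxC _ k j) => ->.
have c4 : swap_mx j k *m swap_mx i j = swap_mx i k *m swap_mx j k.
  by have := swap_mx_cycle ik ij; rewrite (swap_mxC _ j i) (swap_mxC _ k j).
have E1 : br (swap_mx i k) (swap_mx i j) = br (swap_mx i j) (swap_mx j k) by rewrite /br -c1 c3.
have E2 : br (swap_mx i k) (swap_mx j k) = - br (swap_mx i j) (swap_mx j k) by rewrite /br -c4 -c2 opprB.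
rewrite E1 E2 scalerN -scaleNr !scalerA -!scalerDl.
by rewrite (_ : _ + _ = 0) ?scale0r // -[RHS](yb i j k ij ik jk); ring.
Qed.

Lemma tr_gaudin x i : (gaudin x i)^T = gaudin x i :> 'M[R]_N.
Proof. exact: (tr_exchange_mx (fun i j => (x i - x j)^-1)). Qed.

Lemma gaudin_comm x : injective x ->
  forall i j, gaudin x i *m gaudin x j = gaudin x j *m gaudin x i :> 'M[R]_N.
Proof.
move=> xi; apply: (@exchange_mx_comm (fun i j => (x i - x j)^-1)) => i j k ij ik jk.
have E a b : a != b -> x a - x b != 0 by move=> ab; rewrite subr_eq0; apply: contraNneq ab => /xi ->.
have := E _ _ ij; have := E _ _ ik; have := E _ _ jk => h1 h2 h3.
rewrite -(opprB (x i) (x j)) invrN; field.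
by rewrite h1 h2 h3.
Qed.

Lemma jucys_murphyE i : jucys_murphy R i = exchange_mx (fun i j => (j < i)%N%:R) i.
Proof.
rewrite /jucys_murphy /exchange_mx [LHS]big_mkcond [RHS]big_mkcond /=; apply: eq_bigr => j _.
case: (ltnP j i) => h; last by rewrite scale0r if_same.
by rewrite scale1r ifT //; apply: contraTneq h => ->; rewrite ltnn.
Qed.

Lemma tr_jucys_murphy i : (jucys_murphy R i)^T = jucys_murphy R i :> 'M[R]_N.
Proof. by rewrite jucys_murphyE tr_exchange_mx. Qed.

Lemma jucys_murphy_comm (i j : 'I_n) : jucys_murphy R i *m jucys_murphy R j = jucys_murphy R j *m jucys_murphy R i.
Proof.
rewrite !jucys_murphyE; apply: exchange_mx_comm => {}i {}j k ij ik jk.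
have neq (a b : 'I_n) : a != b -> (a : nat) != b by [].
move: (neq _ _ ij) (neq _ _ ik) (neq _ _ jk).
case: (ltngtP i j) => // h1 _; case: (ltngtP i k) => // h2 _; case: (ltngtP j k) => // h3 _;
  first [by exfalso; lia | rewrite /=; ring].
Qed.

End Commute.

Section Singular.
Variables (R : realFieldType) (n : nat).
Local Notation T := {set 'I_n}.
Local Notation N := #|{set 'I_n}|.
Local Notation swap_mx := (@swap_mx R n).
Variable m : nat.

Lemma singularD (u v : 'rV[R]_N) : singular m u -> singular m v -> singular m (u + v).
Proof.
move=> [su lu] [sv lv]; split=> S => [cS|].
  by rewrite /setcoord mxE -!/(setcoord _ _) su // sv // addr0.
rewrite (eq_bigr (fun i => setcoord u (i |: S) + setcoord v (i |: S))) => [|i _]; last by rewrite /setcoord mxE.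
by rewrite big_split /= lu lv addr0.
Qed.

Lemma singularZ c (v : 'rV[R]_N) : singular m v -> singular m (c *: v).
Proof.
move=> [sv lv]; split=> S => [cS|].
  by rewrite /setcoord mxE -!/(setcoord _ _) sv // mulr0.
rewrite (eq_bigr (fun i => c * setcoord v (i |: S))) => [|i _]; last by rewrite /setcoord mxE.
by rewrite -mulr_sumr lv mulr0.
Qed.

Lemma singular0 : singular m (0 : 'rV[R]_N).
Proof. by split=> [S _|S]; rewrite ?big1 // /setcoord => *; rewrite ?mxE. Qed.

Lemma singular_sum (I : finType) (Q : pred I) (F : I -> 'rV[R]_N) :
  (forall i, Q i -> singular m (F i)) -> singular m (\sum_(i | Q i) F i).
Proof. by move=> H; elim/big_ind: _ => //; [exact: singular0|exact: singularD]. Qed.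

Lemma singular_swap (v : 'rV[R]_N) i j : singular m v -> singular m (v *m swap_mx i j).
Proof.
move=> [sv lv]; split=> S => [cS|].
  by rewrite setcoord_swap sv // card_imset //; exact: perm_inj.
rewrite -[RHS](lv (tperm i j @: S)) [RHS](reindex_inj (@perm_inj _ (tperm i j))) /=.
apply: eq_big => [k|k _].
  by rewrite !inE mem_imset //; exact: perm_inj.
by rewrite setcoord_swap imsetU1.
Qed.

Lemma singular_exchange_mx (v : 'rV[R]_N) g i : singular m v -> singular m (v *m exchange_mx g i).
Proof.
move=> sv; rewrite /exchange_mx mulmx_sumr; apply: singular_sum => j _.
rewrite -scalemxAr; apply: singularZ; rewrite mulmxBr mulmx1 -scaleN1r.
by apply: singularD => //; apply: singularZ; apply: singular_swap.
Qed.

Let A : {set T} := [set a : T | #|a| != m].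
Let B : {set T} := [set b : T | #|b| == m.-1].

(** The two blocks express the two conditions of singular; lowering only has to be
    tested on the subsets of size m - 1, which gives the count in
    rank_singular_mx. *)
Definition singular_mx : 'M[R]_N := kermx (row_mx
  (\matrix_(a < N, c < #|A|) ((enum_val a : T) == enum_val c)%:R)
  (\matrix_(a < N, c < #|B|) \sum_(i in ~: (enum_val c : T)) ((enum_val a : T) == i |: enum_val c)%:R)).

Lemma sum_setcoord (v : 'rV[R]_N) S : \sum_a v 0 a * ((enum_val a : T) == S)%:R = setcoord v S.
Proof.
rewrite (bigD1 (enum_rank S)) //= enum_rankK eqxx mulr1 big1 ?addr0 // => a ne.
case: eqP => [e|]; last by rewrite mulr0.
by case/eqP: ne; rewrite -e enum_valK.
Qed.

Lemma singular_mxP (v : 'rV[R]_N) : (0 < m)%N -> reflect (singular m v) (v <= singular_mx)%MS.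
Proof.
move=> m0; apply: (iffP sub_kermxP).
  rewrite mul_mx_row -row_mx0 => /eq_row_mx[E1 E2]; have supp (S : T) : #|S| != m -> setcoord v S = 0.
    move=> cS; have SA : S \in A by rewrite inE.
    have := congr1 (fun u : 'rV_ #|A| => u 0 (enum_rank_in SA S)) E1; rewrite !mxE => <-.
    rewrite -[LHS]sum_setcoord; apply: eq_bigr => a _; rewrite mxE enum_rankK_in //.
  split=> // S; case: (eqVneq #|S| m.-1) => [cS|cS]; last first.
    apply: big1 => i; rewrite inE => iS; apply: supp; rewrite cardsU1 iS; apply: contraNneq cS => <-.
    by [].
  have SB : S \in B by rewrite inE cS.
  have := congr1 (fun u : 'rV_ #|B| => u 0 (enum_rank_in SB S)) E2; rewrite !mxE => E3; rewrite -[RHS]E3 {E3}.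
  under [RHS]eq_bigr => a _ do rewrite mxE enum_rankK_in // mulr_sumr.
  rewrite exchange_big; apply: eq_bigr => i iS /=; by rewrite sum_setcoord.
move=> [supp low]; rewrite mul_mx_row -row_mx0; congr row_mx; apply/rowP => c; rewrite [RHS]mxE mxE.
  under eq_bigr => a _ do rewrite mxE.
  by rewrite sum_setcoord supp //; have := enum_valP c; rewrite inE.
under eq_bigr => a _ do rewrite mxE mulr_sumr.
rewrite exchange_big /= -[RHS](low (enum_val c)); apply: eq_bigr => i _.
by rewrite sum_setcoord.
Qed.

Lemma rank_singular_mx : ('C(n, m) - 'C(n, m.-1) <= \rank singular_mx)%N.
Proof.
rewrite mxrank_ker.
have cT : (#|T| = 'C(n, m) + #|A|)%N.
  have <- : #|~: A| = 'C(n, m).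
    transitivity #|[set a : T | #|a| == m]|; last by rewrite card_draws card_ord.
    by apply: eq_card => a; rewrite !inE negbK.
  by rewrite addnC cardsC.
have cB : #|B| = 'C(n, m.-1) by rewrite /B card_draws card_ord.
have := rank_leq_col (row_mx
  (\matrix_(a < N, c < #|A|) ((enum_val a : T) == enum_val c)%:R : 'M[R]_(N, _))
  (\matrix_(a < N, c < #|B|) \sum_(i in ~: (enum_val c : T)) ((enum_val a : T) == i |: enum_val c)%:R)).
by move: (\rank _) => r; rewrite cT cB; lia.
Qed.

End Singular.

(** * Polynomial families and perturbation of eigenvectors *)

Section PolyFun.
Variable R : realFieldType.
Implicit Types F : R -> R.

Definition polyfun F := exists p : {poly R}, forall s, F s = p.[s].

Lemma polyfun_ext F F' : F =1 F' -> polyfun F -> polyfun F'.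
Proof. by move=> E [p H]; exists p => s; rewrite -E. Qed.
Lemma polyfun_cst c : polyfun (fun=> c).
Proof. by exists c%:P => s; rewrite hornerC. Qed.
Lemma polyfun_id : polyfun id.
Proof. by exists 'X => s; rewrite hornerX. Qed.
Lemma polyfunD F F' : polyfun F -> polyfun F' -> polyfun (fun s => F s + F' s).
Proof. by move=> [p H] [q H']; exists (p + q) => s; rewrite hornerD H H'. Qed.
Lemma polyfunN F : polyfun F -> polyfun (fun s => - F s).
Proof. by move=> [p H]; exists (- p) => s; rewrite hornerN H. Qed.
Lemma polyfunB F F' : polyfun F -> polyfun F' -> polyfun (fun s => F s - F' s).
Proof. by move=> pF pF'; apply: polyfunD => //; apply: polyfunN. Qed.
Lemma polyfunM F F' : polyfun F -> polyfun F' -> polyfun (fun s => F s * F' s).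
Proof. by move=> [p H] [q H']; exists (p * q) => s; rewrite hornerM H H'. Qed.
Lemma polyfunX F k : polyfun F -> polyfun (fun s => F s ^+ k).
Proof. by move=> [p H]; exists (p ^+ k) => s; rewrite horner_exp H. Qed.
Lemma polyfun_sum (I : Type) (r : seq I) (Q : pred I) (F : I -> R -> R) :
  (forall i, polyfun (F i)) -> polyfun (fun s => \sum_(i <- r | Q i) F i s).
Proof.
move=> H; elim: r => [|i r IH]; first by apply: (polyfun_ext _ (polyfun_cst 0)) => s; rewrite big_nil.
case: (boolP (Q i)) => Qi; last by apply: polyfun_ext IH => s; rewrite big_cons (negPf Qi).
by apply: (polyfun_ext _ (polyfunD (H i) IH)) => s; rewrite big_cons Qi.
Qed.
Lemma polyfun_prod (I : Type) (r : seq I) (Q : pred I) (F : I -> R -> R) :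
  (forall i, polyfun (F i)) -> polyfun (fun s => \prod_(i <- r | Q i) F i s).
Proof.
move=> H; elim: r => [|i r IH]; first by apply: (polyfun_ext _ (polyfun_cst 1)) => s; rewrite big_nil.
case: (boolP (Q i)) => Qi; last by apply: polyfun_ext IH => s; rewrite big_cons (negPf Qi).
by apply: (polyfun_ext _ (polyfunM (H i) IH)) => s; rewrite big_cons Qi.
Qed.

Lemma poly_bounded (p : {poly R}) : exists2 C, 0 <= C & forall s, `|s| <= 1 -> `|p.[s]| <= C.
Proof.
exists (\sum_(i < size p) `|p`_i|) => [|s s1]; first exact: sumr_ge0.
rewrite horner_coef; apply: le_trans (ler_norm_sum _ _ _) _; apply: ler_sum => i _.
by rewrite normrM normrX ler_piMr // exprn_ile1.
Qed.

Lemma polyfun_lip F : polyfun F ->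
  exists2 C, 0 <= C & forall s, `|s| <= 1 -> `|F s - F 0| <= C * `|s|.
Proof.
move=> [p H]; have [q Eq] : exists q, p - p.[0]%:P = q * ('X - 0%:P).
  by apply/factor_theorem; rewrite /root !hornerE subrr.
have [C C0 HC] := poly_bounded q; exists C => // s s1.
have -> : F s - F 0 = q.[s] * s.
  have := congr1 (fun p => p.[s]) Eq; rewrite !H hornerD hornerN hornerC => ->.
  by rewrite hornerM hornerXsubC subr0.
by rewrite normrM ler_wpM2r // HC.
Qed.

Lemma polyfun_near F : polyfun F -> F 0 != 0 ->
  exists2 d, 0 < d <= 1 & forall s, `|s| <= d -> `|F 0| / 2 <= `|F s|.
Proof.
move=> /polyfun_lip [C C0 HC] F0; have f0 : 0 < `|F 0| by rewrite normr_gt0.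
exists (Num.min 1 (`|F 0| / (2 * (C + 1)))) => [|s].
  by rewrite lt_min ltr01 divr_gt0 ?mulr_gt0 ?ltr_wpDl //= ge_min lexx.
rewrite le_min => /andP[s1 s2].
have h := HC s s1; have C1 : 0 < 2 * (C + 1) by lra.
rewrite ler_pdivlMr // in s2.
have : `|F 0| <= `|F s| + `|F s - F 0| by rewrite -{1}(subKr (F s) (F 0)) ler_normB.
have : 0 <= `|s| by []. nra.
Qed.

Definition mxpolyfun p q (A : R -> 'M[R]_(p, q)) := forall i j, polyfun (fun s => A s i j).

Lemma mxpolyfun_cst p q (A : 'M[R]_(p, q)) : mxpolyfun (fun=> A).
Proof. by move=> i j; apply: polyfun_cst. Qed.
Lemma mxpolyfunD p q (A B : R -> 'M[R]_(p, q)) :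
  mxpolyfun A -> mxpolyfun B -> mxpolyfun (fun s => A s + B s).
Proof. by move=> HA HB i j; apply: (polyfun_ext _ (polyfunD (HA i j) (HB i j))) => s; rewrite mxE. Qed.
Lemma mxpolyfunZ p q F (A : R -> 'M[R]_(p, q)) :
  polyfun F -> mxpolyfun A -> mxpolyfun (fun s => F s *: A s).
Proof. by move=> HF HA i j; apply: (polyfun_ext _ (polyfunM HF (HA i j))) => s; rewrite mxE. Qed.
Lemma mxpolyfunM p q r (A : R -> 'M[R]_(p, q)) (B : R -> 'M[R]_(q, r)) :
  mxpolyfun A -> mxpolyfun B -> mxpolyfun (fun s => A s *m B s).
Proof.
move=> HA HB i j; apply: (polyfun_ext (F := fun s => \sum_k A s i k * B s k j)) => [s|].
  by rewrite mxE.
by apply: polyfun_sum => k; apply: polyfunM.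
Qed.
Lemma mxpolyfun_sum (I : finType) (Q : pred I) p q (A : I -> R -> 'M[R]_(p, q)) :
  (forall i, mxpolyfun (A i)) -> mxpolyfun (fun s => \sum_(k | Q k) A k s).
Proof.
move=> H i j; apply: (polyfun_ext (F := fun s => \sum_(k | Q k) A k s i j)) => [s|].
  by rewrite summxE.
by apply: polyfun_sum => k; apply: H.
Qed.
Lemma polyfun_det p (A : R -> 'M[R]_p) : mxpolyfun A -> polyfun (fun s => \det (A s)).
Proof.
move=> HA; rewrite /determinant; apply: polyfun_sum => s.
by apply: polyfunM; [apply: polyfun_cst | apply: polyfun_prod].
Qed.

Lemma mxpolyfun_lip p q (A : R -> 'M[R]_(p, q)) : mxpolyfun A ->
  exists2 C, 0 <= C & forall s, `|s| <= 1 -> mxnorm1 (A s - A 0) <= C * `|s|.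
Proof.
move=> HA.
have H i j : {C | 0 <= C & forall s, `|s| <= 1 -> `|A s i j - A 0 i j| <= C * `|s|}.
  by apply: boolp.cid2; apply: polyfun_lip (HA i j).
exists (\sum_i \sum_j s2val (H i j)) => [|s s1].
  by apply: sumr_ge0 => i _; apply: sumr_ge0 => j _; case: (H i j).
rewrite /mxnorm1 /norm1 mulr_suml; apply: ler_sum => i _; rewrite mulr_suml; apply: ler_sum => j _.
by rewrite !mxE; case: (H i j) => C /= _; apply.
Qed.

End PolyFun.

Section Near.
Variables (R : realFieldType) (N : nat).

Lemma row_orthonormal u (OB : 'M[R]_(u, N)) k l : OB *m OB^T = 1%:M ->
  dot (row k OB) (row l OB) = (k == l)%:R.
Proof. by move=> OO; rewrite -dot_row OO mxE. Qed.

Lemma orthonormal_expand u (OB : 'M[R]_(u, N)) (v : 'rV[R]_N) : OB *m OB^T = 1%:M -> (v <= OB)%MS ->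
  v = \sum_k dot v (row k OB) *: row k OB.
Proof.
move=> OO /submxP[D ->]; rewrite {1}mulmx_sum_row; apply: eq_bigr => k _; congr (_ *: _).
by rewrite mulmx_sum_row -[LHS](_ : (\sum_l D 0 l * (l == k)%:R) = _);
   [rewrite /dot mulmx_suml summxE; apply: eq_bigr => l _; rewrite -scalemxAl mxE -(row_orthonormal l k OO)
   |rewrite (bigD1 k) //= eqxx mulr1 big1 ?addr0 // => l /negPf->; rewrite mulr0].
Qed.

Lemma orthonormal_entry u (OB : 'M[R]_(u, N)) k j : OB *m OB^T = 1%:M -> `|OB k j| <= 1.
Proof.
move=> OO; have := row_orthonormal k k OO; rewrite eqxx dotE (bigD1 j) //= mxE -expr2 => E.
rewrite -(@ler_pXn2r _ 2) ?nnegrE // expr1n real_normK ?num_real // -[leRHS]E lerDl.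
by apply: sumr_ge0 => i _; rewrite -expr2 sqr_ge0.
Qed.

(** Perturbation of an eigenvector: choosing for k the largest component of psi
    makes the same k work for all matrices Z simultaneously.  The component k of
    psi (Z - Z0) is (beta - alpha) times that of psi. *)
Lemma near_eigen u (OB : 'M[R]_(u, N)) (psi : 'rV[R]_N) :
  OB *m OB^T = 1%:M -> (psi <= OB)%MS -> psi != 0 ->
  exists k, dot psi (row k OB) != 0 /\ forall (Z Z0 : 'M[R]_N) alpha beta,
    Z^T = Z -> psi *m Z0 = alpha *: psi -> row k OB *m Z = beta *: row k OB ->
    `|beta - alpha| <= (N * N)%:R * mxnorm1 (Z - Z0).
Proof.
move=> OO psiO psi0; pose c k := dot psi (row k OB).
have Epsi := orthonormal_expand OO psiO.
have [k0 ck0] : exists k, c k != 0.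
  apply/existsP; apply: contraNT psi0; rewrite negb_exists => /forallP H.
  by rewrite Epsi big1 // => k _; have := H k; rewrite negbK => /eqP; rewrite /c => ->; rewrite scale0r.
have [k _ kmax] := @arg_maxP _ _ _ k0 predT (fun k => `|c k|) isT.
have ck : c k != 0 by rewrite -normr_gt0 (lt_le_trans _ (kmax k0 isT)) // normr_gt0.
exists k; split=> // Z Z0 alpha beta sZ E0 E.
have uN : (u <= N)%N.
  have : row_free OB by apply/row_freeP; exists OB^T.
  by move=> /eqP <-; apply: rank_leq_col.
have npsi : norm1 psi <= (N * N)%:R * `|c k|.
  rewrite Epsi; apply: le_trans (norm1_sum _) _.
  apply: (@le_trans _ _ (\sum_(l < u) N%:R * `|c k|)).
    apply: ler_sum => l _; rewrite norm1Z mulrC ler_pM ?norm1_ge0 //; last exact: kmax.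
    rewrite /norm1 -[leRHS](_ : \sum_(j < N) 1 = _); last by rewrite sumr_const card_ord.
    by apply: ler_sum => j _; rewrite mxE orthonormal_entry.
  by rewrite sumr_const card_ord -[leLHS]mulr_natl mulrA -natrM ler_wpM2r // ler_nat leq_mul2r uN orbT.
have : (beta - alpha) * c k = dot (psi *m (Z - Z0)) (row k OB).
  rewrite mulmxBr E0 -scaleNr dotDl dotZl (dot_sym _ _ sZ) E dotZr /c; ring.
move=> /(congr1 Num.norm); rewrite normrM => Ed.
have d1 : `|dot (psi *m (Z - Z0)) (row k OB)| <= norm1 (psi *m (Z - Z0)).
  rewrite dotE; apply: le_trans (ler_norm_sum _ _ _) _; apply: ler_sum => j _.
  by rewrite normrM ler_piMr // mxE orthonormal_entry.
rewrite -(ler_pM2r (_ : 0 < `|c k|)) ?normr_gt0 // Ed.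
apply: le_trans d1 _; apply: le_trans (norm1_mulmx _ _) _.
apply: le_trans (ler_wpM2r (mxnorm1_ge0 _) npsi) _.
by rewrite mulrAC.
Qed.

End Near.

(** * Simplicity for generic parameters *)

Section Simple.
Variables (R : rcfType) (n m : nat).
Hypothesis m0 : (0 < m)%N.
Local Notation N := #|{set 'I_n}|.
Implicit Types (x : 'I_n -> R).

Definition eigenbasis (K : 'I_n -> 'M[R]_N) u (OB : 'M[R]_(u, N)) :=
  [/\ OB *m OB^T = 1%:M, (OB :=: singular_mx R n m)%MS &
    forall i k, exists h, row k OB *m K i = h *: row k OB].

(** In a joint eigenbasis of the singular vectors, two members are always told
    apart by some K i. *)
Definition simple_spectrum (K : 'I_n -> 'M[R]_N) := forall u (OB : 'M[R]_(u, N)), eigenbasis K OB ->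
  forall k l, k != l -> exists i h, row k OB *m K i = h *: row k OB /\ row l OB *m K i <> h *: row l OB.

Lemma exchange_mx_stable g i : stablemx (singular_mx R n m) (exchange_mx g i).
Proof.
apply/row_subP => k; rewrite row_mul; apply/singular_mxP => //; apply: singular_exchange_mx.
by apply/singular_mxP => //; apply: row_sub.
Qed.

Lemma eigenbasis_gaudin x : injective x -> exists u (OB : 'M[R]_(u, N)), eigenbasis (gaudin x) OB.
Proof.
move=> xi; apply: (@sym_codiag R _ N (gaudin x) (singular_mx R n m)) => [i|i j|i].
- exact: tr_gaudin.
- exact: gaudin_comm.
- exact: (exchange_mx_stable (fun i j => (x i - x j)^-1)).
Qed.

Lemma eigenbasis_jucys_murphy : exists u (OB : 'M[R]_(u, N)), eigenbasis (@jucys_murphy R n) OB.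
Proof.
apply: (@sym_codiag R _ N (@jucys_murphy R n) (singular_mx R n m)) => [i|i j|i].
- exact: tr_jucys_murphy.
- exact: jucys_murphy_comm.
- by rewrite jucys_murphyE; apply: exchange_mx_stable.
Qed.

Lemma eigenbasis_rowP K u (OB : 'M[R]_(u, N)) k : eigenbasis K OB -> singular m (row k OB) /\ row k OB != 0.
Proof.
move=> [OO OM _]; split; first by apply/singular_mxP => //; rewrite -OM row_sub.
apply: contra_eqN (row_orthonormal k k OO) => /eqP->.
by rewrite eqxx /dot mul0mx mxE eq_sym oner_eq0.
Qed.

Lemma jucys_murphy_simple : simple_spectrum (@jucys_murphy R n).
Proof.
move=> u OB bO k l kl; have [OO OM Oe] := bO.
have [all_eq|] := boolp.pselect (forall i h, row k OB *m jucys_murphy R i = h *: row k OB -> row l OB *m jucys_murphy R i = h *: row l OB); last first.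
  by move=> /boolp.existsNP[j] /boolp.existsNP[h] /boolp.not_implyP[e ne]; exists j, h.
exfalso; pose kap i := projT1 (boolp.cid (Oe i k)).
have kE i : row k OB *m jucys_murphy R i = kap i *: row k OB by apply: (projT2 (boolp.cid (Oe i k))).
have [T0 HT] := jucys_murphy_functional m kap.
pose a := setcoord (row k OB) T0; pose b := setcoord (row l OB) T0.
have [sk k0] := eigenbasis_rowP k bO; have [sl l0] := eigenbasis_rowP l bO.
have Z : b *: row k OB + (- a) *: row l OB = 0.
  apply: HT; last by rewrite /a /b /setcoord !mxE; ring.
  split; first by apply: singularD; apply: singularZ.
  move=> i; rewrite mulmxDl -!scalemxAl kE (all_eq _ _ (kE i)) scalerDr !scalerA.
  by rewrite !(mulrC (kap i)).
have a0 : a = 0.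
  have := congr1 (fun v => dot v (row l OB)) Z; rewrite dotDl !dotZl !row_orthonormal // eqxx (negPf kl).
  by rewrite /dot mul0mx mxE mulr0 add0r mulr1 => /eqP; rewrite oppr_eq0 => /eqP.
case/eqP: k0; apply: HT => //; split=> // i; exact: kE.
Qed.

Lemma dot_suml (I : finType) (F : I -> 'rV[R]_N) (w : 'rV[R]_N) :
  dot (\sum_i F i) w = \sum_i dot (F i) w.
Proof. by rewrite /dot mulmx_suml summxE. Qed.

Definition mxprod (Fs : seq 'M[R]_N) : 'M[R]_N := foldr mulmx 1%:M Fs.

Lemma dot_mxprod (I : Type) (r : seq I) (F : I -> 'M[R]_N) (c : I -> R) v phi :
  (forall i, (F i)^T = F i) -> (forall i, phi *m F i = c i *: phi) ->
  dot (v *m mxprod [seq F i | i <- r]) phi = (\prod_(i <- r) c i) * dot v phi.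
Proof.
move=> sF eF; elim: r v => [|i r IH] v /=; first by rewrite big_nil mulmx1 mul1r.
by rewrite mulmxA IH (dot_sym _ _ (sF i)) eF dotZr big_cons mulrCA mulrA.
Qed.

Lemma mxpolyfun_prod (I : Type) (r : seq I) (F : I -> R -> 'M[R]_N) :
  (forall i, mxpolyfun (F i)) -> mxpolyfun (fun s => mxprod [seq F i s | i <- r]).
Proof.
move=> H; elim: r => [|i r IH] /=; first exact: mxpolyfun_cst.
exact: mxpolyfunM.
Qed.

(** The sum v of the eigenvectors of the Jucys-Murphy elements is a cyclic vector:
    suitable products F of the K 0 i, shifted by eigenvalues, map it to nonzero
    multiples of each of them.  That the same products of the K s i map v to a
    spanning family is the nonvanishing of a determinant polynomial in s.  When it
    holds, a joint eigenvector orthogonal to v is orthogonal to everything, so no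
    eigenspace can have dimension two. *)
Lemma simple_eventually (K : R -> 'I_n -> 'M[R]_N) :
  (forall i, mxpolyfun (fun s => K s i)) -> (forall s i, (K s i)^T = K s i) ->
  K 0 =1 @jucys_murphy R n ->
  exists2 p : {poly R}, p != 0 & forall s, p.[s] != 0 -> simple_spectrum (K s).
Proof.
move=> pK sK K0; have [u [OB bO]] := eigenbasis_jucys_murphy; have [OO OM Oe] := bO.
pose kap a i := projT1 (boolp.cid (Oe i a)).
have kE a i : row a OB *m jucys_murphy R i = kap a i *: row a OB by apply: (projT2 (boolp.cid (Oe i a))).
have sep b c : {i : option 'I_n | b != c -> exists2 i', i = Some i' & kap b i' != kap c i'}.
  apply: boolp.cid; case: (eqVneq b c) => [_|bc]; first by exists None.
  have [i [h [e ne]]] := jucys_murphy_simple bO bc; exists (Some i) => _; exists i => //.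
  apply: contra_notN ne => /eqP e'.
  have [sb b0] := eigenbasis_rowP b bO.
  have -> : h = kap b i.
    have := e; rewrite kE => /eqP; rewrite -subr_eq0 -scalerBl scaler_eq0 (negPf b0) orbF subr_eq0.
    by move=> /eqP.
  by rewrite kE e'.
(* at s = 0 the factor F b s c kills row c, and multiplies row b by a nonzero number *)
pose F b s c := if sval (sep b c) is Some i then K s i - (kap c i)%:M else 1%:M.
pose cs b := [seq c <- enum 'I_u | c != b].
pose v := \sum_a row a OB.
pose G s : 'M[R]_u := \matrix_(a, b) dot (v *m mxprod [seq F b s c | c <- cs b]) (row a OB).
have sF b s c : (F b s c)^T = F b s c.
  by rewrite /F; case: (sval _) => [i|]; rewrite ?trmx1 // linearB /= sK tr_scalar_mx.
have vrow a : dot v (row a OB) = 1.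
  rewrite /v /dot mulmx_suml summxE (bigD1 a) //= big1 ?addr0 => [|b ba].
    by rewrite -/(dot _ _) row_orthonormal // eqxx.
  by rewrite -/(dot _ _) row_orthonormal // (negPf ba).
have [p Hp] : polyfun (fun s => \det (G s)).
  apply: polyfun_det => a b.
  have H : mxpolyfun (fun s => (v *m mxprod [seq F b s c | c <- cs b]) *m (row a OB)^T).
    apply: mxpolyfunM; last exact: mxpolyfun_cst.
    apply: mxpolyfunM; first exact: mxpolyfun_cst.
    apply: mxpolyfun_prod => c; rewrite /F; case: (sval _) => [i|]; last exact: mxpolyfun_cst.
    by apply: mxpolyfunD => //; apply: mxpolyfun_cst.
  by apply: polyfun_ext (H 0 0) => s; rewrite [G s a b]mxE.
have G0 : \det (G 0) != 0.
  pose e b a c := if sval (sep b c) is Some i then kap a i - kap c i else 1.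
  have E a b : G 0 a b = \prod_(c <- cs b) e b a c.
    rewrite mxE (@dot_mxprod _ _ _ (e b a)) ?vrow ?mulr1 // => c.
    rewrite /F /e; case: (sval _) => [i|]; last by rewrite mulmx1 scale1r.
    by rewrite mulmxBr K0 kE mul_mx_scalar -scalerBl.
  have -> : G 0 = diag_mx (\row_b G 0 b b).
    apply/matrixP => a b; rewrite [RHS]mxE [X in _ = X *+ _]mxE.
    case: (eqVneq a b) => [->|ab]; rewrite ?mulr1n ?mulr0n // E.
    have ac : a \in cs b by rewrite mem_filter ab mem_enum.
    rewrite (big_rem a) //= /e; case: (sep b a) => i /= H.
    have ba : b != a by rewrite eq_sym.
    by have [i' -> _] := H ba; rewrite subrr mul0r.
  rewrite det_diag; apply/prodf_neq0 => b _; rewrite [X in X != 0]mxE E prodf_seq_neq0; apply/allP => c.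
  rewrite mem_filter => /andP[cb _] /=; rewrite /e; case: (sep b c) => i /= H.
  have bc : b != c by rewrite eq_sym.
  by have [i' -> h] := H bc; rewrite subr_eq0.
exists p => [|s]; first by apply: contraNneq G0 => p0; rewrite Hp p0 horner0.
rewrite -Hp => Gs w Q bQ k l kl; have [QQ QM Qe] := bQ.
have [all_eq|] := boolp.pselect (forall i h, row k Q *m K s i = h *: row k Q -> row l Q *m K s i = h *: row l Q); last first.
  by move=> /boolp.existsNP[j] /boolp.existsNP[h] /boolp.not_implyP[e ne]; exists j, h.
exfalso; pose hh i := projT1 (boolp.cid (Qe i k)).
have hE i : row k Q *m K s i = hh i *: row k Q by apply: (projT2 (boolp.cid (Qe i k))).
have cyclic phi : (phi <= singular_mx R n m)%MS -> dot v phi = 0 ->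
    (forall i, phi *m K s i = hh i *: phi) -> phi = 0.
  move=> phiM phiv phiK.
  have phiO : (phi <= OB)%MS by rewrite OM.
  pose al : 'rV[R]_u := \row_a dot phi (row a OB).
  have phiE : phi = al *m OB.
    by rewrite {1}(orthonormal_expand OO phiO) mulmx_sum_row; apply: eq_bigr => a _; rewrite mxE.
  have alG : al *m G s = 0.
    apply/rowP => b; rewrite [RHS]mxE mxE.
    transitivity (dot (v *m mxprod [seq F b s c | c <- cs b]) phi).
      rewrite {1}(orthonormal_expand OO phiO) dotC dot_suml; apply: eq_bigr => a _.
      by rewrite dotZl [al 0 a]mxE [G s a b]mxE; congr (_ * _); apply: dotC.
    rewrite (@dot_mxprod _ _ _ (fun c => if sval (sep b c) is Some i then hh i - kap c i else 1)) ?phiv ?mulr0 // => c.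
    rewrite /F; case: (sval _) => [i|]; last by rewrite mulmx1 scale1r.
    by rewrite mulmxBr phiK mul_mx_scalar -scalerBl.
  have al0 : al = 0.
    have uG : G s \in unitmx by rewrite unitmxE unitfE.
    by rewrite -(mulmxK uG al) alG mul0mx.
  by rewrite phiE al0 mul0mx.
have rowQ a : (row a Q <= singular_mx R n m)%MS by rewrite -QM row_sub.
have lE i : row l Q *m K s i = hh i *: row l Q by apply: all_eq.
pose phi := dot v (row l Q) *: row k Q + (- dot v (row k Q)) *: row l Q.
have phi0 : phi = 0.
  apply: cyclic => [||i]; first by rewrite addmx_sub // scalemx_sub.
    by rewrite dotDr !dotZr; ring.
  by rewrite mulmxDl -!scalemxAl hE lE scalerDr !scalerA !(mulrC (hh i)).
have vk : dot v (row k Q) = 0.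
  have := congr1 (fun z => dot z (row l Q)) phi0; rewrite dotDl !dotZl !row_orthonormal // eqxx.
  rewrite (negPf kl) mulr0 add0r mulr1 [dot 0 _](_ : _ = 0); last by rewrite /dot mul0mx mxE.
  by move=> /eqP; rewrite oppr_eq0 => /eqP.
have [_ /eqP[]] := eigenbasis_rowP k bQ.
by apply: cyclic => // i; apply: hE.
Qed.

End Simple.

(** * A path towards the Jucys-Murphy elements *)

Section Path.
Variables (R : rcfType) (n m : nat).
Hypothesis m0 : (0 < m)%N.
Local Notation N := #|{set 'I_n}|.
Variable x0 : 'I_n -> R.
Hypothesis x0_inj : injective x0.

Lemma poly_nonroot (p : {poly R}) (M : R) : p != 0 -> exists2 e, M < e & p.[e] != 0.
Proof.
move=> p0; pose rs := [seq M + k.+1%:R | k <- iota 0 (size p)].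
have [/hasP[e /mapP[k _ ->] pe]|] := boolP (has (fun e => p.[e] != 0) rs).
  by exists (M + k.+1%:R) => //; rewrite ltrDl ltr0n.
rewrite -all_predC => al.
have ur : uniq rs.
  by rewrite map_inj_uniq ?iota_uniq // => a b /addrI /eqP; rewrite eqr_nat eqSS => /eqP.
have ar : all (root p) rs by apply: sub_all al => e /=; rewrite negbK.
by have := max_poly_roots p0 ar ur; rewrite size_map size_iota ltnn.
Qed.

Lemma simple_scale (K K' : 'I_n -> 'M[R]_N) (c : 'I_n -> R) :
  (forall i, c i != 0) -> (forall i, K i = c i *: K' i) ->
  simple_spectrum m K -> simple_spectrum m K'.
Proof.
move=> c0 E sK u O [OO OM Oe] k l kl.
have bK : eigenbasis m K O.
  by split=> // i k'; have [h e] := Oe i k'; exists (c i * h); rewrite E -scalemxAr e scalerA.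
have [i [h [e ne]]] := sK u O bK k l kl; exists i, ((c i)^-1 * h).
have E' : K' i = (c i)^-1 *: K i by rewrite E scalerA mulVf ?scale1r.
rewrite E' -!scalemxAr e -!scalerA; split=> // /(scalerI (_ : (c i)^-1 != 0)) h'.
by apply: ne; apply: h'; rewrite invr_eq0.
Qed.

(** For large s the points are more and more widely spaced: the i-th one is
    negligible with respect to the j-th one for i < j.  The exponent i + 1, not i,
    makes the path start at x0. *)
Definition path (s : R) (i : 'I_n) : R := x0 i + s ^+ i.+1.

Lemma polyfun_path i : polyfun (path ^~ i).
Proof. by apply: polyfunD; [apply: polyfun_cst|apply: polyfunX; apply: polyfun_id]. Qed.

Lemma path0 i : path 0 i = x0 i.
Proof. by rewrite /path expr0n addr0. Qed.

(** This is e ^+ i.+1 * (path e^-1 i - path e^-1 j) when j < i: a polynomial in e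
    with the value 1 at 0. *)
Let d (e : R) (i j : 'I_n) : R := 1 - e ^+ (i - j) + e ^+ i.+1 * (x0 i - x0 j).
Let lowpair (q : 'I_n * 'I_n) := (q.2 < q.1)%N.
Let Dall e := \prod_(q | lowpair q) d e q.1 q.2.
Let Drest e i j := \prod_(q | lowpair q && (q != (i, j))) d e q.1 q.2.
(** The coefficients of gaudin (path e^-1) i, divided by e ^+ i.+1 and multiplied
    by the product of all the d e i j, so that no denominator is left. *)
Let g e (i j : 'I_n) : R := if (j < i)%N then Drest e i j else - (e ^+ (j - i) * Drest e j i).

Let DallE e (i j : 'I_n) : (j < i)%N -> Dall e = d e i j * Drest e i j.
Proof. by move=> ji; rewrite /Dall (bigD1 (i, j)). Qed.

Let pd i j : polyfun (fun e => d e i j).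
Proof.
apply: polyfunD; first apply: polyfunB; first exact: polyfun_cst.
  by apply: polyfunX; apply: polyfun_id.
apply: polyfunM; last exact: polyfun_cst.
by apply: polyfunX; apply: polyfun_id.
Qed.

Let pg i j : polyfun (fun e => g e i j).
Proof.
have pD a b : polyfun (fun e => Drest e a b) by apply: polyfun_prod => q; apply: pd.
have [h|h] := boolP (j < i)%N.
  by apply: (polyfun_ext _ (pD i j)) => e; rewrite /g h.
apply: (polyfun_ext _ (polyfunN (polyfunM (polyfunX (j - i) (polyfun_id R)) (pD j i)))) => e.
by rewrite /g (negPf h).
Qed.

Let d0 (i j : 'I_n) : (j < i)%N -> d 0 i j = 1.
Proof. by move=> ji; rewrite /d !expr0n subn_eq0 leqNgt ji mul0r addr0 subr0. Qed.

Let Drest0 i j : Drest 0 i j = 1.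
Proof. by rewrite /Drest big1 // => q /andP[h _]; apply: d0. Qed.

Let g0 (i j : 'I_n) : i != j -> g 0 i j = (j < i)%N%:R.
Proof.
move=> ij; rewrite /g Drest0; case: ltnP => // h.
have ne : (i : nat) != j by [].
by rewrite Drest0 expr0n subn_eq0 leqNgt (_ : (i < j)%N) ?mul0r ?oppr0 // ltn_neqAle ne.
Qed.

Let dE e (i j : 'I_n) : e != 0 -> (j < i)%N -> d e i j = e ^+ i.+1 * (path e^-1 i - path e^-1 j).
Proof.
move=> e0 ji; rewrite /d /path.
have [k ik] : exists k, (i : nat) = (j + k)%N by exists (i - j)%N; rewrite subnKC // ltnW.
rewrite ik addKn -addSn exprD; have ej : e ^+ j.+1 != 0 by rewrite expf_neq0.
have ek : e ^+ k != 0 by rewrite expf_neq0.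
rewrite !exprVn exprD; field.
by rewrite ej ek.
Qed.

(** With e = 1 / s, the operators gaudin (path s) i multiplied by
    s ^ i.+1 and by a common denominator depend polynomially on e, and become the
    Jucys-Murphy elements at e = 0.  By simple_eventually the spectrum is simple
    except at finitely many e, so for some arbitrarily large e. *)
Lemma simple_path : forall delta, 0 < delta -> exists s, [/\ 0 < s, s <= delta & simple_spectrum m (gaudin (path s))].
Proof.
have [p p0 Hp] : exists2 p : {poly R}, p != 0 & forall s, p.[s] != 0 -> simple_spectrum m (exchange_mx (g s)).
  apply: simple_eventually => //.
  - move=> i; apply: mxpolyfun_sum => j; apply: mxpolyfunZ; [exact: pg|exact: mxpolyfun_cst].
  - by move=> s i; apply: tr_exchange_mx.
  - by move=> i; rewrite jucys_murphyE; apply: eq_bigr => j ji; rewrite g0 // eq_sym.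
have [del [del0 injd]] : exists del, 0 < del /\ forall s, `|s| <= del -> injective (path s).
  pose F s := \prod_(q : 'I_n * 'I_n | q.1 != q.2) (path s q.1 - path s q.2).
  have pF : polyfun F by apply: polyfun_prod => q; apply: polyfunB; apply: polyfun_path.
  have F0 : F 0 != 0.
    apply/prodf_neq0 => -[i j] /= ij; rewrite !path0 subr_eq0.
    by apply: contraNneq ij => /x0_inj ->.
  have [dl /andP[dl0 _] Hd] := polyfun_near pF F0; exists dl; split=> // s /Hd h i j e.
  apply/eqP/negPn/negP => ij; have : F s = 0 by rewrite /F (bigD1 (i, j)) //= e subrr mul0r.
  by move=> Fs; move: h; rewrite Fs normr0 leNgt divr_gt0 ?normr_gt0.
move=> delta delta0.
have [e Me pe] := poly_nonroot (Num.max del^-1 delta^-1) p0.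
move: Me; rewrite gt_max => /andP[e1 e2].
have e0 : 0 < e by apply: lt_trans e1; rewrite invr_gt0.
exists e^-1; split; first by rewrite invr_gt0.
  by rewrite invf_ple ?posrE ?ltW.
have xi : injective (path e^-1).
  by apply: injd; rewrite gtr0_norm ?invr_gt0 // invf_ple ?posrE ?ltW.
have en : e != 0 by rewrite gt_eqF.
have dn (i j : 'I_n) : (j < i)%N -> d e i j != 0.
  move=> ji; rewrite dE // mulf_neq0 ?expf_neq0 // subr_eq0.
  by apply/eqP => /xi ij; rewrite ij ltnn in ji.
have Dn : Dall e != 0 by apply/prodf_neq0 => q; apply: dn.
apply: (@simple_scale (exchange_mx (g e)) _ (fun i => Dall e / e ^+ i.+1)); last exact: Hp.
  by move=> i; rewrite mulf_neq0 // invr_eq0 expf_neq0.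
move=> i; rewrite /exchange_mx /gaudin scaler_sumr; apply: eq_bigr => j ji; rewrite scalerA; congr (_ *: _).
have key (a b : 'I_n) : (b < a)%N -> path e^-1 a - path e^-1 b = d e a b / e ^+ a.+1.
  by move=> ba; rewrite dE // mulrC mulKf // expf_neq0.
rewrite /g; case: ltnP => h.
  rewrite (DallE _ h) (key _ _ h); field.
  by rewrite dn // expf_neq0.
have ij : (i < j)%N by rewrite ltn_neqAle h andbT; rewrite eq_sym in ji.
rewrite (DallE _ ij) -opprB (key _ _ ij).
have [k jk] : exists k, (j : nat) = (i + k)%N by exists (j - i)%N; rewrite subnKC // ltnW.
rewrite jk addKn -addSn exprD; field.
by rewrite dn // !expf_neq0.
Qed.

End Path.

(** * Following a plane of solutions along a path *)

Section Track.
Variables (R : rcfType) (m : nat).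
Hypothesis m0 : (0 < m)%N.
Local Notation n := (2 * m)%N.
Local Notation N := #|{set 'I_n}|.
Implicit Types (x : 'I_n -> R).

Definition roots_row x : 'rV[R]_n.+1 := \row_k (roots_poly x)`_k.
Definition wronskian_mx (t0 t1 : R) (i : 'I_m.+1) : 'M[R]_(m.+1, n.+1) :=
  \matrix_(j, k) (wronskian (('X - t0%:P) ^+ i.+1) (('X - t1%:P) ^+ j.+1))`_k.

Lemma wronskian_bil t0 t1 (a b : 'rV[R]_m.+1) :
  bil (wronskian_mx t0 t1) a b = \row_k (wronskian (based_poly t0 a) (based_poly t1 b))`_k.
Proof.
have E : wronskian (based_poly t0 a) (based_poly t1 b) = \sum_i \sum_j
    (a 0 i * b 0 j) *: wronskian (('X - t0%:P) ^+ i.+1) (('X - t1%:P) ^+ j.+1).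
  rewrite /wronskian /based_poly !raddf_sum /= !mulr_suml -sumrB; apply: eq_bigr => i _.
  rewrite !mulr_sumr -sumrB; apply: eq_bigr => j _.
  by rewrite !derivZ scalerBr -!scalerAl -!scalerAr !scalerA.
apply/rowP => k; rewrite [RHS]mxE E coef_sum /bil summxE; apply: eq_bigr => i _.
rewrite mxE [X in _ * X]mxE coef_sum mulr_sumr; apply: eq_bigr => j _.
by rewrite coefZ mxE mulrA.
Qed.

Lemma roots_poly_neq0 x : roots_poly x != 0.
Proof. by apply/prodf_neq0 => i _; rewrite polyXsubC_eq0. Qed.

Lemma roots_poly_root x i : (roots_poly x).[x i] = 0.
Proof. by rewrite horner_prod (bigD1 i) //= hornerXsubC subrr mul0r. Qed.

Definition deleted_row x i : 'rV[R]_n.+1 := \row_k (\prod_(l | l != i) ('X - (x l)%:P))`_k.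

Lemma size_prod_pred x (Q : pred 'I_n) : (size (\prod_(l | Q l) ('X - (x l)%:P)%R)%R <= n.+1)%N.
Proof.
rewrite -big_filter size_prod_XsubC ltnS size_filter (leq_trans (count_size _ _)) //.
by rewrite -[index_enum _]enumT size_enum_ord.
Qed.

(** Evaluation at the x i shows that w and the products deleting one factor are
    linearly independent; there are as many of them as coefficients. *)
Lemma rows_span x (l : 'cV[R]_n.+1) : injective x -> roots_row x *m l = 0 ->
  (forall i, deleted_row x i *m l = 0) -> l = 0.
Proof.
move=> xi wl rl; pose M : 'M[R]_n.+1 := col_mx (roots_row x) (\matrix_i deleted_row x i : 'M_(n, n.+1)).
have Ml : M *m l = 0.
  have rl0 : (\matrix_i deleted_row x i : 'M_(n, n.+1)) *m l = 0.
    by apply/row_matrixP => i; rewrite row_mul rowK rl row0.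
  by rewrite (mul_col_mx (roots_row x)) wl rl0 col_mx0.
have Mf : row_free M.
  rewrite -kermx_eq0; apply/rowV0P => v /sub_kermxP vM.
  pose v1 := lsubmx (v : 'rV_(1 + n)); pose v2 := rsubmx (v : 'rV_(1 + n)).
  have Ev : v = row_mx v1 v2 by rewrite hsubmxK.
  rewrite Ev (mul_row_col v1) in vM.
  have P0 : v1 0 0 *: roots_poly x + \sum_i v2 0 i *: \prod_(l | l != i) ('X - (x l)%:P) = 0.
    apply/polyP => k; rewrite coef0; case: (ltnP k n.+1) => kn; last first.
      rewrite nth_default //; apply: leq_trans kn; apply: leq_trans (size_polyD _ _) _.
      rewrite geq_max (leq_trans (size_scale_leq _ _)) ?(size_prod_pred x predT) //=.
      apply: leq_trans (size_sum _ _ _) _; apply/bigmax_leqP => i _.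
      by rewrite (leq_trans (size_scale_leq _ _)) ?size_prod_pred.
    have := congr1 (fun z : 'rV_n.+1 => z 0 (Ordinal kn)) vM.
    rewrite [RHS]mxE => e0; rewrite -[RHS]e0 coefD coefZ coef_sum [RHS]mxE; congr (_ + _).
      by rewrite [RHS]mxE big_ord1 [roots_row x _ _]mxE.
    by rewrite [RHS]mxE; apply: eq_bigr => i _; rewrite coefZ; congr (_ * _); rewrite !mxE.
  have v20 : v2 = 0.
    apply/rowP => i; rewrite [RHS]mxE; have := congr1 (fun p : {poly R} => p.[x i]) P0.
    rewrite hornerD hornerZ roots_poly_root mulr0 add0r horner_sum horner0 (bigD1 i) //=.
    rewrite [X in _ + X]big1 ?addr0 => [|j ji]; last first.
      rewrite hornerZ horner_prod (bigD1 i) 1?eq_sym //= hornerXsubC subrr mul0r mulr0 //.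
    rewrite hornerZ => /eqP; rewrite mulf_eq0 => /orP[/eqP //|].
    rewrite horner_prod; case/prodf_eq0 => j ji; rewrite hornerXsubC subr_eq0 => /eqP /xi ij.
    by rewrite ij eqxx in ji.
  have v10 : v1 = 0.
    move/eqP: P0; rewrite v20 big1 ?addr0 => [|i _]; last by rewrite mxE scale0r.
    rewrite scaler_eq0 (negPf (roots_poly_neq0 x)) orbF => /eqP e.
    by apply/rowP => j; rewrite ord1 e mxE.
  by rewrite Ev v10 v20 row_mx0.
have uM : M \in unitmx by rewrite -row_free_unit.
by rewrite -(mulKmx uM l) Ml mulmx0.
Qed.

Lemma half_norm (c c0 K s : R) : 0 <= K -> 0 <= s -> s * (2 * (K + 1)) <= `|c0| ->
  `|c - c0| <= K * s -> `|c0| / 2 <= `|c|.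
Proof.
move=> K0 s0 h1 h2; have : `|c0| <= `|c| + `|c - c0| by rewrite -{1}(subKr c c0) ler_normB.
by move: (`|c|) (`|c - c0|) h1 h2 => u v; nra.
Qed.

Section Tracking.
Variables (x0 : 'I_n -> R) (xs : R -> 'I_n -> R).
Hypothesis x0_inj : injective x0.
Hypothesis xs_poly : forall i, polyfun (xs ^~ i).
Hypothesis xs0 : xs 0 = x0.
Variables (t0 t1 : R) (a0 b0 : 'rV[R]_m.+1).
Hypothesis wt0 : (roots_poly x0).[t0] != 0.
Hypothesis wt1 : (roots_poly x0).[t1] != 0.
Variable c0 : R.
Hypothesis c0E : c0 = (based_poly t0 a0).[t1].
Hypothesis c00 : c0 != 0.

Lemma mxpolyfun_based_mx t j : mxpolyfun (fun s => based_mx (xs s) t j).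
Proof.
apply: mxpolyfun_sum => X; apply: mxpolyfunZ; last exact: mxpolyfun_cst.
by apply: polyfun_prod => i; apply: polyfunB => //; apply: polyfun_cst.
Qed.

Lemma based_mx_lip t : exists2 C, 0 <= C & forall s, `|s| <= 1 ->
  \sum_j mxnorm1 (based_mx (xs s) t j - based_mx x0 t j) <= C * `|s|.
Proof.
have H j : {C | 0 <= C & forall s, `|s| <= 1 -> mxnorm1 (based_mx (xs s) t j - based_mx x0 t j) <= C * `|s|}.
  by apply: boolp.cid2; have := mxpolyfun_lip (mxpolyfun_based_mx t j); rewrite xs0.
exists (\sum_j s2val (H j)) => [|s s1]; first by apply: sumr_ge0 => j _; case: (H j).
by rewrite mulr_suml; apply: ler_sum => j _; case: (H j) => C /= _; apply.
Qed.

Lemma based_poly_lip : exists2 L, 0 <= L & forall a, `|(based_poly t0 a).[t1] - c0| <= L * norm1 (a - a0).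
Proof.
exists (\sum_(j < m.+1) `|t1 - t0| ^+ j.+1) => [|a]; first by apply: sumr_ge0 => j _; rewrite exprn_ge0.
rewrite c0E /based_poly !horner_sum -sumrB mulr_suml.
apply: le_trans (ler_norm_sum _ _ _) _; apply: ler_sum => j _.
rewrite !hornerZ !horner_exp !hornerXsubC -mulrBl normrM normrX mulrC ler_wpM2l ?exprn_ge0 //.
by have := norm1_coord (a - a0) j; rewrite !mxE.
Qed.

(** For small s an eigenvector at xs s, chosen by near_eigen, has eigenvalues at
    distance O(s) from those of psi.  These eigenvalues are the coefficients of
    its two solutions, and dividing the second one by the value c of the first at
    t1 normalizes the Wronskian to w. *)
Lemma tracking : exists C del, [/\ 0 <= C, 0 < del & forall s, 0 < s -> s <= del ->
  injective (xs s) /\ forall u (OB : 'M[R]_(u, N)), eigenbasis m (gaudin (xs s)) OB ->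
  forall psi : 'rV[R]_N, singular m psi -> psi != 0 ->
  (forall j, psi *m based_mx x0 t0 j = a0 0 j *: psi) ->
  (forall j, psi *m based_mx x0 t1 j = b0 0 j *: psi) ->
  exists k a b h, [/\ dot psi (row k OB) != 0,
    forall i, row k OB *m gaudin (xs s) i = h i *: row k OB,
    ode (roots_poly (xs s)) (tau_poly (xs s) h) (based_poly t0 a) = 0,
    a 0 ord0 = (roots_poly (xs s)).[t0] &
    [/\ (roots_poly (xs s)).[t0] != 0, norm1 (a - a0) <= C * s, norm1 (b - c0^-1 *: b0) <= C * s &
    bil (wronskian_mx t0 t1) a b = roots_row (xs s)]]].
Proof.
have [d1 [d10 injd]] : exists del, 0 < del /\ forall s, `|s| <= del -> injective (xs s).
  pose F s := \prod_(q : 'I_n * 'I_n | q.1 != q.2) (xs s q.1 - xs s q.2).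
  have pF : polyfun F by apply: polyfun_prod => q; apply: polyfunB; apply: xs_poly.
  have F0 : F 0 != 0.
    apply/prodf_neq0 => -[i j] /= ij; rewrite xs0 subr_eq0.
    by apply: contraNneq ij => /x0_inj ->.
  have [dl /andP[dl0 _] Hd] := polyfun_near pF F0; exists dl; split=> // s /Hd h i j e.
  apply/eqP/negPn/negP => ij; have : F s = 0 by rewrite /F (bigD1 (i, j)) //= e subrr mul0r.
  by move=> Fs; move: h; rewrite Fs normr0 leNgt divr_gt0 ?normr_gt0.
have wnear t : (roots_poly x0).[t] != 0 -> exists del, 0 < del /\ forall s, `|s| <= del -> (roots_poly (xs s)).[t] != 0.
  move=> wt; pose F s := (roots_poly (xs s)).[t].
  have pF : polyfun F.
    apply: (polyfun_ext (F := fun s => \prod_i (t - xs s i))) => [s|].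
      by rewrite /F horner_prod; apply: eq_bigr => i _; rewrite hornerXsubC.
    by apply: polyfun_prod => i; apply: polyfunB => //; apply: polyfun_cst.
  have F0 : F 0 != 0 by rewrite /F xs0.
  have [dl /andP[dl0 _] Hd] := polyfun_near pF F0; exists dl; split=> // s /Hd h.
  by rewrite -normr_gt0; apply: lt_le_trans h; rewrite divr_gt0 ?normr_gt0.
have [d2 [d20 w0d]] := wnear _ wt0; have [d3 [d30 w1d]] := wnear _ wt1.
have [CA CA0 HA] := based_mx_lip t0; have [CB CB0 HB] := based_mx_lip t1; have [L L0 HL] := based_poly_lip.
have [K EK] : exists K : R, K = (N * N)%:R by exists (N * N)%:R.
have K0 : 0 <= K by rewrite EK ler0n.
have k0 : 0 < `|c0| by rewrite normr_gt0.
have [C1 EC1] : exists C1, C1 = K * CA by exists (K * CA).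
have C10 : 0 <= C1 by rewrite EC1 mulr_ge0.
have [d4 Ed4] : exists d4, d4 = `|c0| / (2 * (L * C1 + 1)) by eexists.
have LC : 0 <= L * C1 by rewrite mulr_ge0.
have d40 : 0 < d4 by rewrite Ed4 divr_gt0 // mulr_gt0 // ltr_wpDl.
have [C2 EC2] : exists C2, C2 = K * CB * (2 / `|c0|) + norm1 b0 * (L * C1) * (2 / (`|c0| * `|c0|)) by eexists.
have C20 : 0 <= C2.
  by rewrite EC2 addr_ge0 // ?mulr_ge0 ?norm1_ge0 ?invr_ge0 ?mulr_ge0.
exists (C1 + C2), (Num.min (Num.min d1 d2) (Num.min d3 (Num.min d4 1))); split.
- by rewrite addr_ge0.
- by rewrite !lt_min d10 d20 d30 d40 ltr01.
move=> s s0; rewrite !le_min => /andP[/andP[sd1 sd2] /andP[sd3 /andP[sd4 s1]]].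
have as_ : `|s| = s by rewrite gtr0_norm.
have xi : injective (xs s) by apply: injd; rewrite as_.
have w0 : (roots_poly (xs s)).[t0] != 0 by apply: w0d; rewrite as_.
have w1 : (roots_poly (xs s)).[t1] != 0 by apply: w1d; rewrite as_.
split=> // u OB bO psi spsi psi0 Ea Eb; have [OO OM Oe] := bO.
have psiO : (psi <= OB)%MS by rewrite OM; apply/singular_mxP.
have [k [dk Hk]] := near_eigen OO psiO psi0.
have [sk nk] := eigenbasis_rowP m0 k bO.
pose h i := projT1 (boolp.cid (Oe i k)).
have hE i : row k OB *m gaudin (xs s) i = h i *: row k OB by apply: (projT2 (boolp.cid (Oe i k))).
have [a [aE aO aw]] := eigen_based_poly m0 xi hE sk nk w0.
have [b [bE bO' bw]] := eigen_based_poly m0 xi hE sk nk w1.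
have trA t j : (based_mx (xs s) t j)^T = based_mx (xs s) t j.
  rewrite /based_mx /solution_mx linear_sum /=; apply: eq_bigr => X _.
  by rewrite linearZ /= /scaled_sym linearZ /= tr_symmetrizer.
have ha : norm1 (a - a0) <= C1 * s.
  rewrite EC1 -mulrA; apply: le_trans (_ : K * (\sum_j mxnorm1 (based_mx (xs s) t0 j - based_mx x0 t0 j)) <= _).
    rewrite mulr_sumr; apply: ler_sum => j _; rewrite !mxE.
    rewrite EK; exact: (Hk _ _ _ _ (trA t0 j) (Ea j) (aE j)).
  by rewrite ler_wpM2l // -[in leRHS]as_ HA // as_.
have hb : norm1 (b - b0) <= K * CB * s.
  rewrite -mulrA; apply: le_trans (_ : K * (\sum_j mxnorm1 (based_mx (xs s) t1 j - based_mx x0 t1 j)) <= _).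
    rewrite mulr_sumr; apply: ler_sum => j _; rewrite !mxE.
    rewrite EK; exact: (Hk _ _ _ _ (trA t1 j) (Eb j) (bE j)).
  by rewrite ler_wpM2l // -[in leRHS]as_ HB // as_.
pose c := (based_poly t0 a).[t1].
have hc : `|c - c0| <= L * C1 * s.
  by apply: le_trans (HL a) _; rewrite -mulrA ler_wpM2l.
have c2 : `|c0| / 2 <= `|c|.
  apply: (@half_norm _ _ (L * C1) s) => //; first exact: ltW.
  by move: sd4; rewrite Ed4 ler_pdivlMr // mulr_gt0 // ltr_wpDl.
have cp : 0 < `|c| by apply: lt_le_trans c2; rewrite divr_gt0.
have cn : c != 0 by rewrite -normr_gt0.
exists k, a, (c^-1 *: b), h; split=> //; split=> //.
- by apply: le_trans ha (ler_wpM2r (ltW s0) _); rewrite lerDl.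
- have ci : `|c|^-1 <= 2 / `|c0|.
    by rewrite -[2 / _]invrK invf_div lef_pV2 ?posrE // divr_gt0.
  have -> : c^-1 *: b - c0^-1 *: b0 = c^-1 *: (b - b0) + (- ((c - c0) * (c^-1 * c0^-1))) *: b0.
    by apply/rowP => j; rewrite !mxE; field; rewrite cn c00.
  have t1_le : norm1 (c^-1 *: (b - b0)) <= 2 / `|c0| * (K * CB * s).
    by rewrite norm1Z normfV ler_pM ?norm1_ge0 ?invr_ge0.
  have t2_le : norm1 (- ((c - c0) * (c^-1 * c0^-1)) *: b0) <=
      L * C1 * s * (2 / `|c0| * `|c0|^-1) * norm1 b0.
    rewrite norm1Z normrN !normrM !normfV ler_wpM2r ?norm1_ge0 //.
    by rewrite ler_pM ?mulr_ge0 ?invr_ge0 // ler_wpM2r ?invr_ge0.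
  apply: le_trans (norm1D _ _) _; apply: le_trans (lerD t1_le t2_le) _.
  have -> : 2 / `|c0| * (K * CB * s) + L * C1 * s * (2 / `|c0| * `|c0|^-1) * norm1 b0 = C2 * s.
    by rewrite EC2; field; rewrite gt_eqF.
  by apply: (ler_wpM2r (ltW s0)); rewrite lerDr.
- rewrite bilZr wronskian_bil (wronskian_based_poly w1 aO bO' bw) -/c.
  by apply/rowP => j; rewrite !mxE coefZ mulKf.
Qed.

End Tracking.
End Track.

(** * Simplicity for all distinct real parameters *)

Section SimpleAll.
Variables (R : rcfType) (m : nat).
Hypothesis m0 : (0 < m)%N.
Local Notation n := (2 * m)%N.
Local Notation N := #|{set 'I_n}|.
Implicit Types (x : 'I_n -> R).

(** The directions in which one root moves at unit speed; the roots polynomial is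
    then affine in s. *)
Definition shift_path x (i : 'I_n) (s : R) (k : 'I_n) : R := x k - (k == i)%:R * s.

Lemma roots_row_shift x i s : roots_row (shift_path x i s) = roots_row x + s *: deleted_row x i.
Proof.
apply/rowP => k; rewrite !mxE -coefZ -coefD; congr (_`_k).
rewrite /roots_poly (bigD1 i) //= [in RHS](bigD1 i) //= /shift_path eqxx mul1r.
rewrite (eq_bigr (fun j => 'X - (x j)%:P)) => [|j ji]; last by rewrite (negPf ji) mul0r subr0.
by rewrite -mul_polyC -mulrDl polyCB opprB addrA addrAC.
Qed.

(** If two eigenvectors of an orthonormal basis share their eigenvalues, every
    vector psi of the plane they span has the same solutions.  Applying tracking
    along the curves shift_path shows that these solutions are isolated among
    those with the same Wronskian.  Along path, at a parameter of simple spectrum,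
    tracking is applied to one vector of the plane, then to a vector orthogonal to
    the eigenvector that was found; the two eigenvectors obtained differ, but
    their solutions have to coincide. *)
Theorem gaudin_simple x : injective x -> simple_spectrum m (gaudin x).
Proof.
move=> xi u OB bO k l kl; have [OO OM Oe] := bO.
have [all_eq|] := boolp.pselect (forall i h, row k OB *m gaudin x i = h *: row k OB ->
    row l OB *m gaudin x i = h *: row l OB); last first.
  by move=> /boolp.existsNP[j] /boolp.existsNP[h] /boolp.not_implyP[e ne]; exists j, h.
exfalso; pose h0 i := projT1 (boolp.cid (Oe i k)).
have kE i : row k OB *m gaudin x i = h0 i *: row k OB by apply: (projT2 (boolp.cid (Oe i k))).
have lE i : row l OB *m gaudin x i = h0 i *: row l OB by apply: all_eq.
have [sk nk] := eigenbasis_rowP m0 k bO; have [sl nl] := eigenbasis_rowP m0 l bO.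
pose psi0 := row k OB + row l OB.
have eE i : psi0 *m gaudin x i = h0 i *: psi0 by rewrite mulmxDl kE lE scalerDr.
have spsi : singular m psi0 by apply: singularD.
have dk : dot psi0 (row k OB) = 1.
  by rewrite dotDl !row_orthonormal // eqxx eq_sym (negPf kl) addr0.
have npsi : psi0 != 0.
  by apply: contra_eqN dk => /eqP ->; rewrite /dot mul0mx mxE eq_sym oner_eq0.
have [t0 _ wt0] := poly_nonroot 0 (roots_poly_neq0 x).
have [a0 [aE aO aw]] := eigen_based_poly m0 xi eE spsi npsi wt0.
have f0 : based_poly t0 a0 != 0.
  apply: contraNneq wt0 => e; rewrite -aw -(deriv_based_poly_at t0) e.
  by rewrite derivC horner0.
have [t1 _] := poly_nonroot 0 (mulf_neq0 (roots_poly_neq0 x) f0).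
rewrite hornerM mulf_eq0 negb_or => /andP[wt1 c00].
have [b0 [bE bO' bw]] := eigen_based_poly m0 xi eE spsi npsi wt1.
set c0 := (based_poly t0 a0).[t1] in c00.
(* the eigenvalues on psi0 are shared by the whole plane spanned by the two rows *)
have share t (a : 'rV[R]_m.+1) : (roots_poly x).[t] != 0 -> (forall j, psi0 *m based_mx x t j = a 0 j *: psi0) ->
    forall j, row k OB *m based_mx x t j = a 0 j *: row k OB /\ row l OB *m based_mx x t j = a 0 j *: row l OB.
  move=> wt Ea j.
  have [ak [akE _ _]] := eigen_based_poly m0 xi kE sk nk wt.
  have [al [alE _ _]] := eigen_based_poly m0 xi lE sl nl wt.
  have E := Ea j; rewrite mulmxDl akE alE scalerDr in E.
  have := congr1 (fun v => dot v (row k OB)) E; have := congr1 (fun v => dot v (row l OB)) E.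
  rewrite !dotDl !dotZl !row_orthonormal // !eqxx (negPf kl) eq_sym (negPf kl) !mulr0 !mulr1 !addr0 !add0r.
  by rewrite akE alE => -> ->.
have wrow0 : bil (wronskian_mx t0 t1) a0 (c0^-1 *: b0) = roots_row x.
  rewrite bilZr wronskian_bil (wronskian_based_poly wt1 aO bO' bw) -/c0.
  by apply/rowP => j; rewrite !mxE coefZ mulKf.
have [||||rho rho0 Hrho] := @bil_isolated R m.+1 m.+1 n.+1 (wronskian_mx t0 t1) a0 (c0^-1 *: b0) ord0 _ (deleted_row x).
- by rewrite mul2n -addnn addSn addnS.
- by rewrite aw.
- by move=> v; rewrite wrow0; apply: rows_span.
- move=> i; have [||C [del [C0 del0 H]]] := @tracking R m m0 x (shift_path x i) xi _ _ t0 t1 a0 b0 wt0 wt1 c0 erefl c00.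
  + move=> j; apply: polyfunB; first exact: polyfun_cst.
    by apply: polyfunM; [exact: polyfun_cst | exact: polyfun_id].
  + by apply: boolp.funext => j; rewrite /shift_path mulr0 subr0.
  exists C, del; split=> // s s0 sd; have [xsi Hs] := H s s0 sd.
  have [w [Q bQ]] := eigenbasis_gaudin m0 xsi.
  have [k' [a [b [h [_ _ _ _ [_ ha hb hw]]]]]] := Hs w Q bQ psi0 spsi npsi aE bE.
  by exists a, b; split=> //; rewrite hw wrow0 roots_row_shift.
have [||C [del [C0 del0 H]]] := @tracking R m m0 x (path x) xi _ _ t0 t1 a0 b0 wt0 wt1 c0 erefl c00.
- by move=> j; apply: polyfun_path.
- by apply: boolp.funext => j; apply: path0.
have [|s [s0 sd simp]] := @simple_path R n m m0 x xi (Num.min del (rho / (C + 1))).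
  by rewrite lt_min del0 divr_gt0 // ltr_wpDl.
move: sd; rewrite le_min => /andP[sd sr].
have Cs : C * s <= rho.
  apply: (@le_trans _ _ (s * (C + 1))); last by rewrite -ler_pdivlMr // ltr_wpDl.
  by rewrite mulrC ler_wpM2l ?lerDl // ltW.
have [xsi Hs] := H s s0 sd.
have [w [Q bQ]] := eigenbasis_gaudin m0 xsi; have [QQ QM Qe] := bQ.
have [k1 [a1 [b1 [h1 [dk1 E1 o1 w1 [wn ha1 hb1 hw1]]]]]] :=
  Hs w Q bQ (row k OB) sk nk (fun j => (share t0 a0 wt0 aE j).1) (fun j => (share t1 b0 wt1 bE j).1).
pose psi2 := dot (row l OB) (row k1 Q) *: row k OB + (- dot (row k OB) (row k1 Q)) *: row l OB.
have psi2Q : dot psi2 (row k1 Q) = 0 by rewrite dotDl !dotZl; ring.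
have npsi2 : psi2 != 0.
  have : dot psi2 (row l OB) != 0.
    rewrite dotDl !dotZl !row_orthonormal // eqxx (negPf kl) mulr0 add0r mulr1 oppr_eq0 //.
  by apply: contraNneq => ->; rewrite /dot mul0mx mxE.
have spsi2 : singular m psi2 by apply: singularD; apply: singularZ.
have share2 t (a : 'rV[R]_m.+1) : (roots_poly x).[t] != 0 -> (forall j, psi0 *m based_mx x t j = a 0 j *: psi0) ->
    forall j, psi2 *m based_mx x t j = a 0 j *: psi2.
  move=> wt Ea j; have [e1 e2] := share t a wt Ea j.
  by rewrite mulmxDl -!scalemxAl e1 e2 scalerDr !scalerA !(mulrC (a 0 j)).
have [k2 [a2 [b2 [h2 [dk2 E2 o2 w2 [_ ha2 hb2 hw2]]]]]] :=
  Hs w Q bQ psi2 spsi2 npsi2 (share2 t0 a0 wt0 aE) (share2 t1 b0 wt1 bE).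
have k12 : k1 != k2 by apply: contraNneq dk2 => <-; rewrite psi2Q.
have a12 : a1 = a2.
  apply: (Hrho a1 b1 a2 b2); rewrite ?w1 ?w2 ?hw1 ?hw2 //; apply: le_trans Cs; assumption.
have fn : based_poly t0 a1 != 0.
  by apply: contraNneq wn => e; rewrite -w1 -(deriv_based_poly_at t0) e derivC horner0.
rewrite -a12 in o2; have h12 := tau_poly_inj xsi fn o1 o2.
have [i [h [e ne]]] := simp w Q bQ k1 k2 k12; apply: ne.
have [_ nq1] := eigenbasis_rowP m0 k1 bQ.
rewrite E2 -h12; congr (_ *: _); apply/eqP; rewrite -subr_eq0.
have := e; rewrite E1 => /eqP; rewrite -subr_eq0 -scalerBl scaler_eq0 (negPf nq1) orbF //.
Qed.

End SimpleAll.

(** * Real planes with a prescribed Wronskian *)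

Lemma catalanE m : (0 < m)%N -> catalan m.+1 = ('C(2 * m, m) - 'C(2 * m, m.-1))%N.
Proof.
case: m => // k _; apply/eqP; rewrite -(eqn_pmul2l (isT : (0 < k.+2)%N)) mul_catalan //.
have -> : (2 * k.+2 - 2 = 2 * k.+1)%N by lia.
rewrite (_ : k.+2 - 1 = k.+1)%N // mulnBr; have := mul_bin_left (2 * k.+1) k.
rewrite (_ : 2 * k.+1 - k = k.+2)%N; last lia.
by move=> /= <-; rewrite -mulnBl subSnn mul1n.
Qed.

Lemma size_based_poly (R : realFieldType) m t (a : 'rV[R]_m.+1) : (size (based_poly t a) <= m.+2)%N.
Proof.
apply: leq_trans (size_sum _ _ _) _; apply/bigmax_leqP => j _.
by rewrite (leq_trans (size_scale_leq _ _)) // size_exp_XsubC ltnS ltn_ord.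
Qed.

(** One plane for each vector of a joint eigenbasis, distinguished by tau. *)
Lemma real_pairs (R : rcfType) (n m : nat) (x : 'I_n -> R) : (0 < m)%N -> n = (2 * m)%N -> injective x ->
  let w := \prod_i ('X - (x i)%:P) in
  exists p q tau : 'I_(catalan m.+1) -> {poly R},
    (forall i, [/\ (size (p i) <= m.+2)%N, (size (q i) <= m.+2)%N,
       exists2 c, c != 0 & wronskian (p i) (q i) = c *: w,
       ode w (tau i) (p i) = 0 & ode w (tau i) (q i) = 0]) /\
    (forall i j, tau i = tau j -> i = j).
Proof.
move=> m0 nm; subst n => xi w.
have [u [OB bO]] := eigenbasis_gaudin m0 xi; have [OO OM Oe] := bO.
have cu : (catalan m.+1 <= u)%N.
  rewrite catalanE //; apply: leq_trans (rank_singular_mx R (2 * m) m) _.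
  by rewrite -OM rank_leq_row.
pose h k i := projT1 (boolp.cid (Oe i k)).
have hE k i : row k OB *m gaudin x i = h k i *: row k OB by apply: (projT2 (boolp.cid (Oe i k))).
have H k : exists pq : {poly R} * {poly R}, [/\ (size pq.1 <= m.+2)%N, (size pq.2 <= m.+2)%N,
       exists2 c, c != 0 & wronskian pq.1 pq.2 = c *: w,
       ode w (tau_poly x (h k)) pq.1 = 0 & ode w (tau_poly x (h k)) pq.2 = 0].
  have [sk nk] := eigenbasis_rowP m0 k bO.
  have [t0 _ wt0] := poly_nonroot 0 (roots_poly_neq0 x).
  have [a0 [_ aO aw]] := eigen_based_poly m0 xi (hE k) sk nk wt0.
  have f0 : based_poly t0 a0 != 0.
    apply: contraNneq wt0 => e; rewrite -aw -(deriv_based_poly_at t0) e.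
    by rewrite derivC horner0.
  have [t1 _] := poly_nonroot 0 (mulf_neq0 (roots_poly_neq0 x) f0).
  rewrite hornerM mulf_eq0 negb_or => /andP[wt1 c00].
  have [b0 [_ bO' bw]] := eigen_based_poly m0 xi (hE k) sk nk wt1.
  exists (based_poly t0 a0, based_poly t1 b0); split; rewrite ?size_based_poly //.
  by exists (based_poly t0 a0).[t1] => //=; rewrite (wronskian_based_poly wt1 aO bO' bw).
pose pq k := projT1 (boolp.cid (H k)).
have pqE k := projT2 (boolp.cid (H k)).
pose wd := widen_ord cu.
exists (fun i => (pq (wd i)).1), (fun i => (pq (wd i)).2), (fun i => tau_poly x (h (wd i))).
split=> [i|i j tij]; first exact: pqE.
apply/eqP/negPn/negP => ij; have wij : wd i != wd j by apply: contraNneq ij => /(congr1 val) /= /val_inj ->.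
have [p_size _ [c c0 wr] e1 _] := pqE (wd i).
have p0 : (pq (wd i)).1 != 0.
  apply: contraNneq c0 => e; have := wr; rewrite -/(pq _) e /wronskian mul0r deriv0 mul0r subrr.
  move/esym/eqP; rewrite scaler_eq0 => /orP[] // w0.
  by have := roots_poly_neq0 x; rewrite /roots_poly -/w w0.
have hij := tau_poly_inj xi p0 e1 (_ : ode w (tau_poly x (h (wd j))) (pq (wd i)).1 = 0).
have {}hij : forall k, h (wd i) k = h (wd j) k by apply: hij; rewrite -tij.
have [k [l [e ne]]] := gaudin_simple m0 xi bO wij.
apply: ne; rewrite hE -hij; congr (_ *: _).
have [_ nk] := eigenbasis_rowP m0 (wd i) bO.
have := e; rewrite hE => /eqP; rewrite -subr_eq0 -scalerBl scaler_eq0 (negPf nk) orbF subr_eq0.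
by move/eqP.
Qed.

(** * Derivative of a fraction *)

From mathcomp Require Import all_classical all_reals all_analysis.
Import numFieldNormedType.Exports.

Local Open Scope classical_set_scope.
Local Open Scope complex_scope.
Local Open Scope ring_scope.

Section FracDerive.
Variable K : numFieldType.
Local Notation Ko := (K^o).

Lemma is_derive_horner (p : {poly K}) (x : Ko) :
  is_derive x (1 : Ko) ((fun t => p.[t]) : Ko -> Ko) (p^`().[x]).
Proof.
elim/poly_ind: p => [|p c IH].
  rewrite deriv0 horner0; have -> : (fun t : Ko => (0 : {poly K}).[t]) = cst 0 by apply/funext => t; rewrite horner0.
  exact: is_derive_cst.
have -> : (fun t : Ko => (p * 'X + c%:P).[t]) = ((fun t => p.[t]) : Ko -> Ko) * id + cst c.
  by apply/funext => t; rewrite hornerD hornerMX hornerC.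
apply: is_derive_eq; rewrite addr0 derivD derivM derivX mulr1 derivC addr0 hornerD hornerMX.
by rewrite /GRing.scale /= mulr1 addrC mulrC.
Qed.

Lemma continuous_horner_num (p : {poly K}) (x : Ko) : {for x, continuous ((fun t => p.[t]) : Ko -> Ko)}.
Proof.
apply/differentiable_continuous/derivable1_diffP.
by have [] := is_derive_horner p x.
Qed.

(** The derivative of A / B at 0 is the Wronskian of B and A divided by the square
    of B.  The values of F where B vanishes are irrelevant, since B does not
    vanish near 0. *)
Lemma critical_frac (A B : {poly K}) (F : Ko -> Ko) : B.[0] != 0 ->
  (forall t, B.[t] != 0 -> F t = A.[t] / B.[t]) ->
  is_derive (0 : Ko) (1 : Ko) F 0 <-> (wronskian B A).[0] = 0.
Proof.
move=> B0 FE.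
have H : is_derive (0 : Ko) (1 : Ko) F ((wronskian B A).[0] / B.[0] ^+ 2).
  have nz : \forall t \near (0 : Ko), B.[t] != 0.
    exact: (cvgr_neq0 _ (continuous_horner_num (p := B) (x := 0)) B0).
  apply: (@near_eq_is_derive _ _ _ (((fun t => A.[t]) : Ko -> Ko) * (fun t => (B.[t])^-1 : Ko))).
    by near=> t; rewrite FE //; near: t.
  have [dB vB] := is_derive_horner B 0; have dA := is_derive_horner A 0.
  have dV : is_derive (0 : Ko) (1 : Ko) ((fun t => (B.[t])^-1) : Ko -> Ko) (- (B.[0]) ^- 2 *: B^`().[0]).
    by apply: DeriveDef; [exact: derivableV | rewrite deriveV // vB].
  apply: is_derive_eq; rewrite /GRing.scale /= /wronskian hornerD hornerN !hornerM.
  by field.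
split=> [[_ v0]|w0].
  have [_ v] := H; move: v; rewrite v0 => /esym/eqP; rewrite mulf_eq0 invr_eq0 expf_eq0 (negPf B0) orbF.
  by move/eqP.
by move: H; rewrite w0 mul0r.
Unshelve. all: by end_near. Qed.

End FracDerive.

(** * Critical points on the sphere *)

Section WronskianAlgebra.
Variable K : numFieldType.
Implicit Types p q : {poly K}.

Lemma wronskianC p q : wronskian q p = - wronskian p q.
Proof. by rewrite /wronskian opprB [q * _]mulrC [_^`() * p]mulrC. Qed.

Lemma wronskian_shift p q z :
  wronskian (p \Po ('X + z%:P)) (q \Po ('X + z%:P)) = wronskian p q \Po ('X + z%:P).
Proof.
have E r : (r \Po ('X + z%:P))^`() = r^`() \Po ('X + z%:P).
  by rewrite deriv_comp derivD derivX derivC addr0 mulr1.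
by rewrite /wronskian !E rmorphB !rmorphM.
Qed.

Lemma wronskian_comb p q a b c d :
  wronskian (a *: p + b *: q) (c *: p + d *: q) = (a * d - b * c) *: wronskian p q.
Proof. by rewrite /wronskian !derivD !derivZ -!mul_polyC rmorphB !rmorphM; ring. Qed.

Lemma wronskian_mul k p q : wronskian (k * p) (k * q) = k ^+ 2 * wronskian p q.
Proof. by rewrite /wronskian !derivM; ring. Qed.

(** In degree 2 e + 1 the Wronskian of the two leading monomials cancels; in
    degree 2 e only the two top coefficients of p and q contribute. *)
Lemma wronskian_top e p q : (size p <= e.+2)%N -> (size q <= e.+2)%N ->
  (wronskian p q)`_(2 * e) = p`_e * q`_e.+1 - p`_e.+1 * q`_e.
Proof.
have split_top (r : {poly K}) : (size r <= e.+2)%N ->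
    r = r`_e.+1 *: 'X^(e.+1) + \poly_(i < e.+1) r`_i.
  move=> sr; apply/polyP => i; rewrite coefD coefZ coefXn coef_poly.
  by case: (ltngtP i e.+1) => [h|h|->]; rewrite ?mulr0 ?add0r ?mulr1 ?addr0 // nth_default // (leq_trans sr).
move=> sp sq; set p1 := \poly_(i < e.+1) p`_i; set q1 := \poly_(i < e.+1) q`_i.
have s1 : (size p1 <= e.+1)%N := size_poly _ _.
have s2 : (size q1 <= e.+1)%N := size_poly _ _.
have sX : (size ('X^(e.+1) : {poly K})%R <= e.+2)%N by rewrite size_polyXn.
have topM (f g : {poly K}) : (size f <= e.+2)%N -> (size g <= e.+1)%N ->
    (f * g^`())`_(2 * e) = f`_e.+1 * g`_e *+ e /\ (f^`() * g)`_(2 * e) = f`_e.+1 * g`_e *+ e.+1.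
  move=> sf sg; split.
    case: e sf sg {sp sq p1 q1 s1 s2 sX split_top} => [|e] sf sg.
      rewrite mulr0n (_ : g^`() = 0) ?mulr0 ?coef0 //.
      by rewrite (size1_polyC sg) derivC.
    rewrite (_ : 2 * e.+1 = e.+2 + e)%N; last lia.
    rewrite coefM_top //; last exact: size_deriv_le.
    by rewrite coef_deriv mulrnAr.
  rewrite (_ : 2 * e = e + e)%N; last lia.
  rewrite coefM_top //; last exact: size_deriv_le.
  by rewrite coef_deriv mulrnAl.
have [t1 t2] := topM _ _ sX s1; have [t3 t4] := topM _ _ sX s2.
have [t5 t6] := topM _ _ (leq_trans s1 (leqnSn _)) s2.
have c1 (r : {poly K}) : (\poly_(i < e.+1) r`_i)`_e.+1 = 0 by rewrite coef_poly ltnn.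
have c2 (r : {poly K}) : (\poly_(i < e.+1) r`_i)`_e = r`_e by rewrite coef_poly ltnSn.
have -> : wronskian p q = p`_e.+1 *: ('X^(e.+1) * q1^`() - ('X^(e.+1))^`() * q1)
    - q`_e.+1 *: ('X^(e.+1) * p1^`() - ('X^(e.+1))^`() * p1) + (p1 * q1^`() - p1^`() * q1).
  rewrite /wronskian [p in LHS](split_top p sp) [q in LHS](split_top q sq) -/p1 -/q1 !derivD !derivZ -!mul_polyC; ring.
rewrite coefD !coefB !coefZ !coefB t1 t2 t3 t4 t5 t6 !coefXn eqxx /p1 /q1 !c1 !c2.
rewrite !mul0r !mul0rn !mul1r !mulrSr; ring.
Qed.

End WronskianAlgebra.

Section CriticalPoints.
Variable R : realType.
Local Notation C := R[i].
Variables (P Q : {poly C}) (d : nat).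
Hypothesis PQ : coprimep P Q.
Hypothesis sPQ : maxn (size P) (size Q) = d.+1.

Let horner_shift (p : {poly C}) z t : (p \Po ('X + z%:P)).[t] = p.[z + t].
Proof. by rewrite horner_comp !hornerE addrC. Qed.

(** In the charts the function is P / Q or, at a pole, Q / P, and exchanging P and
    Q only changes the sign of the Wronskian. *)
Lemma critical_finite z : critical_point (ratmap P Q) (Some z) <-> (wronskian P Q).[z] = 0.
Proof.
rewrite /critical_point /=; set l := 'X + z%:P.
have [Qz|Qz] := eqVneq Q.[z] 0.
  have Pz : P.[z] != 0.
    by apply: (coprimep_root (_ : coprimep Q P)); rewrite 1?coprimep_sym // /root Qz.
  rewrite (critical_frac (A := Q \Po l) (B := P \Po l)); last 2 first.
  - by rewrite horner_shift addr0.
  - move=> t; rewrite !horner_shift => h /=; case: eqVneq => [->|_]; first by rewrite mul0r.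
    by rewrite invf_div.
  by rewrite wronskian_shift horner_shift addr0.
rewrite (critical_frac (A := P \Po l) (B := Q \Po l)); last 2 first.
- by rewrite horner_shift addr0.
- by move=> t; rewrite !horner_shift => h /=; rewrite (negPf h).
rewrite wronskian_shift horner_shift addr0 wronskianC hornerN.
by split=> [/eqP|->]; rewrite ?oppr0 // oppr_eq0 => /eqP.
Qed.

(** X ^ d p(1 / X), which describes p in the coordinate at infinity. *)
Definition revp (p : {poly C}) : {poly C} := \poly_(i < d.+1) p`_(d - i).

Lemma horner_revp (p : {poly C}) (t : C) : (size p <= d.+1)%N -> t != 0 -> (revp p).[t] = t ^+ d * p.[t^-1].
Proof.
move=> sp t0; rewrite horner_poly (horner_coef_wide _ sp) mulr_sumr.
rewrite (reindex_inj rev_ord_inj) /=; apply: eq_bigr => i _.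
have id : (i <= d)%N by rewrite -ltnS.
rewrite subSS subKn // mulrCA; congr (_ * _).
have -> : t ^+ d = t ^+ (d - i) * t ^+ i by rewrite -exprD subnK.
by rewrite exprVn mulfK // expf_neq0.
Qed.

(** The Wronskian of the reversed polynomials at 0 is, up to sign, the coefficient
    of degree 2 d - 2 of the Wronskian. *)
Lemma not_critical_inf : (0 < d)%N -> (wronskian P Q)`_(2 * d - 2) != 0 ->
  ~ critical_point (ratmap P Q) None.
Proof.
move=> d0 W; rewrite /critical_point /= sPQ /=.
have sP : (size P <= d.+1)%N by rewrite -sPQ leq_maxl.
have sQ : (size Q <= d.+1)%N by rewrite -sPQ leq_maxr.
have r0 (p : {poly C}) : (revp p).[0] = p`_d by rewrite horner_coef0 coef_poly subn0.
have r1 (p : {poly C}) : (revp p)^`().[0] = p`_d.-1.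
  by rewrite horner_coef0 coef_deriv coef_poly ltnS d0 subn1.
have Wr : (wronskian (revp P) (revp Q)).[0] != 0.
  apply: contraNneq W; rewrite /wronskian hornerD hornerN !hornerM !r0 !r1 => w0.
  have dE : d = d.-1.+1 by rewrite prednK.
  rewrite (_ : 2 * d - 2 = 2 * d.-1)%N; last lia.
  by rewrite wronskian_top -?dE // -[_ - _]opprB w0 oppr0.
have [Qd|Qd] := eqVneq Q`_d 0.
  have Pd : P`_d != 0.
    by apply: contraNneq Wr => Pd; rewrite /wronskian hornerD hornerN !hornerM !r0 Pd Qd mul0r mulr0 subrr.
  rewrite (critical_frac (A := revp Q) (B := revp P)); last 2 first.
  - by rewrite r0.
  - move=> t; case: (eqVneq t 0) => [->|t0] h /=; first by rewrite eqxx /= sPQ /= Qd eqxx r0 Qd mul0r.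
    rewrite (negPf t0) !horner_revp //; move: h; rewrite horner_revp // mulf_eq0 negb_or => /andP[td Pt] /=.
    rewrite -mulf_div mulfV // mul1r; case: eqVneq => [->|_]; first by rewrite mul0r.
    by rewrite invf_div.
  by move/eqP; rewrite (negPf Wr).
rewrite (critical_frac (A := revp P) (B := revp Q)); last 2 first.
- by rewrite r0.
- move=> t; case: (eqVneq t 0) => [->|t0] h /=; first by rewrite eqxx /= sPQ /= (negPf Qd) !r0.
  rewrite (negPf t0) !horner_revp //; move: h; rewrite horner_revp // mulf_eq0 negb_or => /andP[td Qt] /=.
  by rewrite -mulf_div mulfV // mul1r (negPf Qt).
by rewrite wronskianC hornerN => /eqP; rewrite oppr_eq0 (negPf Wr).
Qed.

End CriticalPoints.

(** * Planes spanned by equivalent functions *)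

Section Span.
Variable K : numClosedFieldType.

(** By coprimality the pair (a p2 + b q2, c p2 + d q2) is k (p1, q1) for a
    polynomial k, and k is constant because both Wronskians have the degree of
    w. *)
Lemma equivalent_span (p1 q1 p2 q2 w : {poly K}) (a b c d c1 c2 : K) :
  coprimep p1 q1 -> w != 0 -> c1 != 0 -> c2 != 0 -> a * d - b * c != 0 ->
  wronskian p1 q1 = c1 *: w -> wronskian p2 q2 = c2 *: w ->
  p1 * (c *: p2 + d *: q2) = q1 * (a *: p2 + b *: q2) ->
  exists k : K, k != 0 /\ k *: p1 = a *: p2 + b *: q2.
Proof.
move=> cop w0 c10 c20 det W1 W2 E; set y := a *: p2 + b *: q2 in E *; set z := c *: p2 + d *: q2 in E.
have W : wronskian y z = ((a * d - b * c) * c2) *: w by rewrite wronskian_comb W2 scalerA.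
have Wn : wronskian y z != 0 by rewrite W scaler_eq0 negb_or w0 andbT mulf_neq0.
have p1n : p1 != 0.
  apply: contraNneq c10 => e; move/eqP: W1; rewrite e /wronskian mul0r deriv0 mul0r subrr eq_sym.
  by rewrite scaler_eq0 (negPf w0) orbF.
have : p1 %| y by rewrite -(Gauss_dvdpr y cop) -E dvdp_mulr.
move=> /dvdpP[k yk].
have zk : z = k * q1.
  by apply: (mulfI p1n); rewrite E yk; ring.
have kW : k ^+ 2 * (c1 *: w) = ((a * d - b * c) * c2) *: w.
  by rewrite -W yk zk [k * p1]mulrC [p1 * k]mulrC wronskian_mul W1.
have k0 : k != 0 by apply: contraNneq Wn => e; rewrite yk zk e !mul0r /wronskian mul0r deriv0 mul0r subrr.
have sk : size (k ^+ 2) = 1%N.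
  have e : ((size (k ^+ 2) + size w).-1 = size w)%N.
    have := congr1 (fun r : {poly K} => size r) kW.
    by rewrite size_mul ?expf_neq0 // ?scaler_eq0 ?negb_or ?c10 // !size_scale // mulf_neq0.
  have w1 : (0 < size w)%N by rewrite size_poly_gt0.
  by move: e w1; move: (size w) (size _) => u v; lia.
have {}sk : size k = 1%N.
  have := size_exp k 2; rewrite sk /=; have : (0 < size k)%N by rewrite size_poly_gt0.
  by case: (size k) => [|[|?]].
have /size_poly1P[e e0 ke] : size k == 1%N by rewrite sk.
by exists e; split=> //; rewrite yk ke mul_polyC.
Qed.

End Span.

Section Complexify.
Variable R : realType.
Local Notation C := R[i].
Local Notation toC := (real_complex R).

Lemma map_wronskian (p q : {poly R}) : wronskian (map_poly toC p) (map_poly toC q) = map_poly toC (wronskian p q).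
Proof. by rewrite /wronskian !deriv_map rmorphB !rmorphM. Qed.

Lemma map_ode (w tau v : {poly R}) :
  ode (map_poly toC w) (map_poly toC tau) (map_poly toC v) = map_poly toC (ode w tau v).
Proof. by rewrite /ode !deriv_map rmorphD rmorphB !rmorphM. Qed.

Lemma ode_comb (w tau u v : {poly C}) a b : ode w tau u = 0 -> ode w tau v = 0 -> ode w tau (a *: u + b *: v) = 0.
Proof.
move=> eu ev; transitivity (a *: ode w tau u + b *: ode w tau v); last by rewrite eu ev !scaler0 addr0.
by rewrite /ode !derivD !derivZ -!mul_polyC; ring.
Qed.

Lemma poly_eq0_all (p : {poly C}) : (forall z, p.[z] = 0) -> p = 0.
Proof.
move=> H; apply/eqP/negPn/negP => /closed_nonrootP[z]; by rewrite /root H eqxx.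
Qed.

(** The polynomial identity holds at the infinitely many points where q1 and q2 do
    not vanish. *)
Lemma fractional_eval (p1 q1 p2 q2 : {poly C}) (a b c d : C) : q1 != 0 -> q2 != 0 ->
  ratmap p1 q1 = ratmap (a *: 'X + b%:P) (c *: 'X + d%:P) \o ratmap p2 q2 ->
  p1 * (c *: p2 + d *: q2) = q1 * (a *: p2 + b *: q2).
Proof.
move=> q10 q20 E; apply/eqP; rewrite -subr_eq0; apply/eqP.
have qq : q1 * q2 != 0 by rewrite mulf_neq0.
apply: (mulIf qq); rewrite mul0r; apply: poly_eq0_all => z.
rewrite hornerM [(q1 * q2).[z]]hornerM.
have [->|h1] := eqVneq q1.[z] 0; first by rewrite mul0r mulr0.
have [->|h2] := eqVneq q2.[z] 0; first by rewrite !mulr0.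
have := congr1 (fun f => f (Some z)) E; rewrite /= (negPf h1) (negPf h2) /= !(hornerD, hornerZ, hornerX, hornerC).
case: eqP => // /eqP h3 [e].
rewrite (_ : _ + _ = 0) ?mul0r //.
have {}h3 : c * p2.[z] + d * q2.[z] != 0.
  apply: contraNneq h3 => h.
  have -> : c * (p2.[z] / q2.[z]) + d = (c * p2.[z] + d * q2.[z]) / q2.[z] by field.
  by rewrite h mul0r.
rewrite hornerN !hornerM !hornerD !hornerZ.
have -> : p1.[z] = q1.[z] * (p1.[z] / q1.[z]) by field.
rewrite e; field.
by rewrite h2 h3.
Qed.

End Complexify.

Section Main.
Variable R : realType.
Local Notation C := R[i].
Local Notation toC := (real_complex R).

(** A common root of p and q would be a double root of their Wronskian. *)
Lemma wronskian_coprime n (x : 'I_n -> R) (p q : {poly R}) c : injective x -> c != 0 ->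
  wronskian p q = c *: \prod_i ('X - (x i)%:P) ->
  coprimep (map_poly toC p) (map_poly toC q).
Proof.
move=> xi c0 W; apply/Pdiv.ClosedField.coprimepP => z pz.
apply/negP => qz; set w := \prod_i _ in W.
have W1 : wronskian (map_poly toC p) (map_poly toC q) = (toC c) *: map_poly toC w.
  by rewrite map_wronskian W map_polyZ.
move/rootP: pz => pz; move/rootP: qz => qz.
have tc0 : toC c != 0 by rewrite fmorph_eq0.
have wz : (map_poly toC w).[z] = 0.
  have := congr1 (fun r : {poly C} => r.[z]) W1; rewrite hornerZ hornerD hornerN !hornerM pz qz mul0r mulr0 subrr.
  by move/esym/eqP; rewrite mulf_eq0 (negPf tc0) => /eqP.
have dwz : (map_poly toC w)^`().[z] = 0.
  apply: (mulfI tc0); rewrite mulr0 -hornerZ -derivZ -W1 /wronskian derivB !derivM.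
  by rewrite !(hornerD, hornerN, hornerM) pz qz; ring.
have mw : map_poly toC w = \prod_i ('X - (toC (x i))%:P).
  by rewrite rmorph_prod; apply: eq_bigr => i _; rewrite rmorphB /= map_polyX map_polyC.
move: wz; rewrite mw horner_prod => /eqP/prodf_eq0[i _]; rewrite hornerXsubC subr_eq0 => /eqP zi.
move: dwz; rewrite mw (bigD1 i) //= derivM derivXsubC mul1r hornerD hornerM hornerXsubC zi subrr mul0r addr0.
rewrite horner_prod => /eqP/prodf_eq0[j ji]; rewrite hornerXsubC subr_eq0 => /eqP/(fmorph_inj (real_complex R)) /xi ij.
by rewrite ij eqxx in ji.
Qed.

End Main.

(** * Counting the classes *)

Lemma wronskian_sizes (R : realType) (m n : nat) (x : 'I_n -> R) (p q : {poly R}) c :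
  n = (2 * m)%N -> c != 0 -> (size p <= m.+2)%N -> (size q <= m.+2)%N ->
  wronskian p q = c *: \prod_i ('X - (x i)%:P) ->
  (wronskian p q)`_(2 * m) != 0 /\ maxn (size p) (size q) = m.+2.
Proof.
move=> nm c0 sp sq W.
have W0 : (wronskian p q)`_(2 * m) != 0.
  have mw : \prod_i ('X - (x i)%:P) \is monic by apply: monic_prod_XsubC.
  have sw : size (\prod_i ('X - (x i)%:P)) = (2 * m).+1.
    by rewrite size_prod_XsubC -[index_enum _]enumT size_enum_ord nm.
  by move/monicP: mw; rewrite W coefZ /lead_coef sw /= => ->; rewrite mulr1.
split=> //; apply/eqP; rewrite eqn_leq geq_max sp sq /=.
move: W0; rewrite (wronskian_top sp sq); apply: contraNT; rewrite -ltnNge ltnS geq_max => /andP[h1 h2].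
by rewrite [p`_m.+1]nth_default // [q`_m.+1]nth_default // mulr0 mul0r subrr.
Qed.

Theorem theorem2 (R : realType) (d : nat) (hd : (2 <= d)%N)
    (x : 'I_(2 * d - 2)%N -> R) (hx : injective x) :
  exists F : 'I_(catalan d) -> (sphere R -> sphere R),
    (forall i, [/\ rational_of_degree d (F i), real_rational (F i) &
       critical_points (F i) = range (fun k => Some (x k)%:C : sphere R)]) /\
    (forall i j, i != j -> ~ equivalent (F i) (F j)).
Proof.
case: d hd x hx => [//|m] m0 x hx; rewrite ltnS in m0.
have nm : (2 * m.+1 - 2 = 2 * m)%N by lia.
have [p [q [tau [H tinj]]]] := real_pairs m0 nm hx.
set w := \prod_i ('X - (x i)%:P) in H.
pose toC := real_complex R; pose cp := map_poly toC.
have w0 : cp w != 0.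
  by rewrite map_poly_eq0; apply/prodf_neq0 => i _; rewrite polyXsubC_eq0.
have cw : cp w = \prod_i ('X - (toC (x i))%:P).
  by rewrite /cp rmorph_prod; apply: eq_bigr => i _; rewrite rmorphB /= map_polyX map_polyC.
exists (fun i => ratmap (cp (p i)) (cp (q i))); split=> [i|i j ij].
  have [sp sq [c c0 W] _ _] := H i.
  have cop := wronskian_coprime hx c0 W.
  have [Wtop smax] := wronskian_sizes nm c0 sp sq W.
  have smaxC : maxn (size (cp (p i))) (size (cp (q i))) = m.+2 by rewrite !size_map_poly.
  split.
  - by exists (cp (p i)), (cp (q i)).
  - by exists (p i), (q i); split=> //; rewrite -(coprimep_map (real_complex R)).
  have WC : wronskian (cp (p i)) (cp (q i)) = toC c *: cp w.
    by rewrite map_wronskian W map_polyZ.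
  have tc0 : toC c != 0 by rewrite fmorph_eq0.
  apply/seteqP; split=> [[z|]|_ [k _ <-]].
  - move/(critical_finite cop); rewrite WC hornerZ => /eqP; rewrite mulf_eq0 (negPf tc0) /=.
    rewrite cw horner_prod => /prodf_eq0[k _]; rewrite hornerXsubC subr_eq0 => /eqP zk.
    by exists k => //; rewrite zk.
  - move=> h; exfalso; apply: (not_critical_inf cop smaxC _ _ h) => //.
    by rewrite nm map_wronskian coef_map fmorph_eq0.
  - apply/(critical_finite cop); rewrite WC hornerZ cw horner_prod (bigD1 k) //=.
    by rewrite hornerXsubC subrr mul0r mulr0.
move=> [l [[a [b [c [e [det ->]]]]] E]].
have [_ _ [ci ci0 Wi] oi1 oi2] := H i; have [_ _ [cj cj0 Wj] oj1 oj2] := H j.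
have WiC : wronskian (cp (p i)) (cp (q i)) = toC ci *: cp w by rewrite map_wronskian Wi map_polyZ.
have WjC : wronskian (cp (p j)) (cp (q j)) = toC cj *: cp w by rewrite map_wronskian Wj map_polyZ.
have tci : toC ci != 0 by rewrite fmorph_eq0.
have tcj : toC cj != 0 by rewrite fmorph_eq0.
have nz (f g : {poly R[i]}) (k : R[i]) : k != 0 -> wronskian f g = k *: cp w -> f != 0 /\ g != 0.
  move=> k0 W; have : wronskian f g != 0 by rewrite W scaler_eq0 negb_or k0.
  by move=> h; split; apply: contraNneq h => ->; rewrite /wronskian ?deriv0 ?mul0r ?mulr0 subrr.
have [pi0 qi0] := nz _ _ _ tci WiC; have [_ qj0] := nz _ _ _ tcj WjC.
have lin := fractional_eval qi0 qj0 E.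
have [k [k0 kp]] := equivalent_span (wronskian_coprime hx ci0 Wi) w0 tci tcj det WiC WjC lin.
have oj : ode (cp w) (cp (tau j)) (k *: cp (p i)) = 0.
  by rewrite kp; apply: ode_comb; rewrite map_ode ?oj1 ?oj2 rmorph0.
have oi : ode (cp w) (cp (tau i)) (k *: cp (p i)) = 0.
  have -> : k *: cp (p i) = k *: cp (p i) + 0 *: cp (p i) by rewrite scale0r addr0.
  by apply: ode_comb; rewrite map_ode oi1 rmorph0.
have kpn : k *: cp (p i) != 0 by rewrite scaler_eq0 negb_or k0.
have : cp (tau i) = cp (tau j).
  apply: (mulIf kpn); apply: (addrI (cp w * (k *: cp (p i))^`()^`() - (cp w)^`() * (k *: cp (p i))^`())).
  by rewrite -/(ode _ _ _) oi -/(ode _ _ _) oj.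
move=> /(map_poly_inj (real_complex R)) /tinj ij'.
by rewrite ij' eqxx in ij.
Qed.
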